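(* Let $G$ be a finite group with $k$ conjugacy classes $c_1,\dots,c_k$. There is a one-to-one correspondence $\mathcal P\longleftrightarrow\Pi$ between arbitrary central probability measures $\mathcal P$ on the space $\mathfrak S_G$ of $G$-virtual permutations and arbitrary probability measures $\Pi$ on $$\overline{\nabla}^{(k)}=\Bigl\{(x,\delta):\ x=(x^{(1)},\dots,x^{(k)}),\ \delta=(\delta^{(1)},\dots,\delta^{(k)}),\ x^{(l)}=(x^{(l)}_1\ge x^{(l)}_2\ge\dots\ge 0),\ \delta^{(l)}\ge 0,\ \sum_{i\ge1}x^{(l)}_i\le\delta^{(l)}\ (1\le l\le k),\ \sum_{l=1}^k\delta^{(l)}=1\Bigr\}.$$ Namely, each central probability measure $\mathcal P$ on $\mathfrak S_G$ is a projective limit $\mathcal P=\varprojlim P^{(n)}$ of central probability measures $P^{(n)}$ on $G_n$, and there is a unique probability measure $\Pi$ on $\overline\nabla^{(k)}$ such that for all $n\ge 1$ and all $\Lambda\in\mathbb Y_n^{(k)}$ $$P^{(n)}(\Lambda)=\frac{1}{|K_\Lambda|}\int_{\overline\nabla^{(k)}}\mathbb K(\Lambda,\omega)\,\Pi(d\omega),$$ where $P^{(n)}(\Lambda)$ is the value of $P^{(n)}$ at any element of the conjugacy class $K_\Lambda$ of $G_n$. Conversely, every probability measure $\Pi$ on $\overline\nabla^{(k)}$ gives rise, via this formula, to a central probability measure $\mathcal P=\varprojlim P^{(n)}$ on $\mathfrak S_G$.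
   Context: $G_n=G\sim S(n)$ is the wreath product: the set $G^n\times S(n)$ with multiplication $((g_1,\dots,g_n),s)((h_1,\dots,h_n),t)=((g_1h_{s^{-1}(1)},\dots,g_nh_{s^{-1}(n)}),st)$. $G_n$ is embedded in $G_{n+1}$ by $((g_1,\dots,g_n),s)\mapsto((g_1,\dots,g_n,e_G),s)$ with $s(n+1)=n+1$, and $G_\infty=\bigcup_n G_n$. For $x=((g_1,\dots,g_n),s)\in G_n$ and a cycle $i_1\to i_2\to\dots\to i_r\to i_1$ of $s$, the cycle-product is $g_{i_r}g_{i_{r-1}}\cdots g_{i_1}$; the cycle is of type $c_l$ if its cycle-product belongs to $c_l$. $\mathbb Y_n^{(k)}$ is the set of $k$-tuples $\Lambda=(\lambda^{(1)},\dots,\lambda^{(k)})$ of partitions (Young diagrams) with $|\lambda^{(1)}|+\dots+|\lambda^{(k)}|=n$. The conjugacy classes of $G_n$ are labelled by $\mathbb Y_n^{(k)}$: $K_\Lambda$ consists of the $x$ for which, for every $l$ and $j$, the number of $j$-cycles of type $c_l$ equals the number of parts of $\lambda^{(l)}$ equal to $j$. Canonical projection $p_{n,n+1}:G_{n+1}\to G_n$: let $\tilde x=((g_1,\dots,g_{n+1}),\tilde s)$. If $\tilde s(n+1)=n+1$, then $p_{n,n+1}(\tilde x)=((g_1,\dots,g_n),\tilde s|_{\{1,\dots,n\}})$. Otherwise, put $j=\tilde s(n+1)$; remove $n+1$ from its cycle in $\tilde s$ (so that $\tilde s^{-1}(n+1)$ is now mapped to $j$), delete $g_{n+1}$ from the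 list and replace $g_j$ by $g_jg_{n+1}$. $\mathfrak S_G=\varprojlim G_n$ is the projective limit (compact topological space, with Borel $\sigma$-algebra) with respect to the maps $p_{n,n+1}$: its elements are sequences $(x_1,x_2,\dots)$, $x_n\in G_n$, $p_{n,n+1}(x_{n+1})=x_n$. The group $G_\infty\times G_\infty$ acts on $\mathfrak S_G$ on the right: for $W=(w_1,w_2)$, $xW=y$ with $y_n=w_2^{-1}x_nw_1$ for all $n$ large enough that $w_1,w_2\in G_n$. A probability measure on $G_n$ is central if it is invariant under conjugation by $G_n$; a probability measure on $\mathfrak S_G$ is central if it is invariant under the action of $\mathrm{diag}(G_\infty)=\{(w,w)\}$. $\mathcal P=\varprojlim P^{(n)}$ means that the pushforward of $\mathcal P$ to $G_n$ is $P^{(n)}$ for each $n$. $\overline\nabla^{(k)}$ carries the topology of coordinatewise convergence and the corresponding Borel $\sigma$-algebra. The kernel is, for $\omega=(x,\delta)$, $$\mathbb K(\Lambda,\omega)=\frac{n!}{\prod_{l=1}^k\prod_i\lambda^{(l)}_i!}\prod_{l=1}^k m^{o}_{\lambda^{(l)}}(x^{(l)},\delta^{(l)}),$$ where $m^o_\lambda(x^{(l)},\delta^{(l)})$ is the extended monomial symmetric function, obtained by writing the monomial symmetric function $m_\lambda$ as a polynomial in the power sums $p_r$ and substituting $p_1\mapsto\delta^{(l)}$, $p_r\mapsto\sum_{i\ge1}(x^{(l)}_i)^r$ for $r\ge2$. *)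

(* Defs.v *)
From HB Require Import structures.
From mathcomp Require Import all_boot all_order all_algebra all_fingroup.
From mathcomp Require mpoly.
(* The notations of mpoly clash with those of MathComp-Analysis. *)
Import -(notations) mpoly.
From mathcomp Require Import all_classical all_reals all_analysis.

Set Implicit Arguments.
Unset Strict Implicit.
Unset Printing Implicit Defensive.

Import Order.TTheory GRing.Theory Num.Theory.
Import numFieldNormedType.Exports.

Section Wreath.
Local Open Scope group_scope.
Variable gT : finGroupType.

Record wreath (n : nat) : Type :=
  Wreath { wbase : {ffun 'I_n -> gT} ; wperm : 'S_n }.

Definition wreath_pair n (x : wreath n) := (wbase x, wperm x).
Definition pair_wreath n (p : {ffun 'I_n -> gT} * 'S_n) := Wreath p.1 p.2.
Lemma wreath_pairK n : cancel (@wreath_pair n) (@pair_wreath n).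
Proof. by case. Qed.

HB.instance Definition _ n :=
  Finite.copy (wreath n) (can_type (@wreath_pairK n)).

Section Group.
Variable n : nat.
Implicit Types x y z : wreath n.

(* Permutations multiply from left to right in MathComp, so that
   [wperm y * wperm x] is the map i |-> wperm x (wperm y i). *)
Definition wmul x y : wreath n :=
  Wreath [ffun i => wbase x i * wbase y ((wperm x)^-1 i)] (wperm y * wperm x).
Definition wone : wreath n := Wreath [ffun => 1] 1.
Definition winv x : wreath n :=
  Wreath [ffun i => (wbase x (wperm x i))^-1] (wperm x)^-1.

Lemma wmulA : associative wmul.
Proof.
move=> x y z; congr Wreath; last by rewrite /= mulgA.
by apply/ffunP=> i; rewrite !ffunE /= mulgA invMg permM.
Qed.

Lemma wmul1 : left_id wone wmul.
Proof.
case=> g s; congr Wreath; last by rewrite /= mulg1.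
by apply/ffunP=> i; rewrite !ffunE /= invg1 perm1 mul1g.
Qed.

Lemma wmulV : left_inverse wone winv wmul.
Proof.
case=> g s; congr Wreath; last by rewrite /= mulgV.
by apply/ffunP=> i; rewrite !ffunE /= invgK mulVg.
Qed.

HB.instance Definition _ := Finite_isGroup.Build (wreath n) wmulA wmul1 wmulV.

End Group.

Lemma wreath_eqP n (x y : wreath n) :
  wbase x =1 wbase y -> wperm x =1 wperm y -> x = y.
Proof.
by case: x y => g s [h t] /= eg es; congr Wreath; [apply/ffunP | apply/permP].
Qed.

Lemma wbaseM n (x y : wreath n) i :
  wbase (x * y) i = wbase x i * wbase y ((wperm x)^-1 i).
Proof. by rewrite ffunE. Qed.
Lemma wpermM n (x y : wreath n) i : wperm (x * y) i = wperm x (wperm y i).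
Proof. by rewrite permM. Qed.

Section Embedding.
Variables (m n : nat) (le_mn : (m <= n)%N) (w : wreath m).

Definition wemb_perm_fun (i : 'I_n) : 'I_n :=
  if insub (val i) is Some j then widen_ord le_mn (wperm w j) else i.

Lemma wemb_perm_inj : injective wemb_perm_fun.
Proof.
move=> i1 i2; rewrite /wemb_perm_fun.
case: insubP => [j1 _ e1 | n1]; case: insubP => [j2 _ e2 | n2] //.
- move/(congr1 val)=> /= /val_inj /perm_inj e; apply: val_inj.
  by rewrite -e1 -e2 e.
- by move=> e; move: n2; rewrite -e /= ltn_ord.
- by move=> e; move: n1; rewrite e /= ltn_ord.
Qed.

Definition wemb : wreath n :=
  Wreath [ffun i : 'I_n => if insub (val i) : option 'I_m is Some j
                                then wbase w j else 1 : gT]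
         (perm wemb_perm_inj).

End Embedding.

Section Projection.
Variables (n : nat) (x : wreath n.+1).
Let s := wperm x.
Let g := wbase x.

(* [lift ord_max] is the inclusion of {0, .., n-1} into {0, .., n}, and
   [unlift ord_max] its partial inverse, undefined exactly at [ord_max].  When
   [s] maps i to [ord_max], [s ord_max] is not [ord_max], so the default value
   of [odflt] is never used. *)
Definition wproj_perm_fun (i : 'I_n) : 'I_n :=
  if unlift ord_max (s (lift ord_max i)) is Some j then j
  else odflt i (unlift ord_max (s ord_max)).

Lemma lift_wproj_perm_fun i : lift ord_max (wproj_perm_fun i) =
  if s (lift ord_max i) == ord_max then s ord_max else s (lift ord_max i).
Proof.
rewrite /wproj_perm_fun; case: unliftP => [j -> | e].
  by rewrite eq_sym (negbTE (neq_lift _ _)).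
rewrite e eqxx; case: unliftP => [j -> // | e'].
by have /perm_inj/eqP := etrans e (esym e'); rewrite eq_sym (negbTE (neq_lift _ _)).
Qed.

Lemma wproj_perm_inj : injective wproj_perm_fun.
Proof.
move=> i1 i2 /(congr1 (lift ord_max)); rewrite !lift_wproj_perm_fun.
case: eqP => e1; case: eqP => e2.
- by move=> _; apply/(@lift_inj _ ord_max)/(@perm_inj _ s); rewrite e1 e2.
- by move/perm_inj/eqP; rewrite (negbTE (neq_lift _ _)).
- by move/perm_inj/eqP; rewrite eq_sym (negbTE (neq_lift _ _)).
- by move/perm_inj/lift_inj.
Qed.

Definition wproj : wreath n :=
  Wreath [ffun i => if s ord_max == lift ord_max i
                    then g (lift ord_max i) * g ord_max
                    else g (lift ord_max i)]
         (perm wproj_perm_inj).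

End Projection.

Lemma lift_wproj n (x : wreath n.+1) i : lift ord_max (wperm (wproj x) i) =
  if wperm x (lift ord_max i) == ord_max then wperm x ord_max
  else wperm x (lift ord_max i).
Proof. by rewrite permE lift_wproj_perm_fun. Qed.

Lemma wbase_wproj n (x : wreath n.+1) i : wbase (wproj x) i =
  if wperm x ord_max == lift ord_max i
  then wbase x (lift ord_max i) * wbase x ord_max
  else wbase x (lift ord_max i).
Proof. by rewrite ffunE. Qed.

Lemma val_lift_max n (i : 'I_n) : val (lift ord_max i) = val i.
Proof. exact: lift_max. Qed.

Section Equivariance.
Variable n : nat.
Local Notation emb1 := (wemb (leqnSn n)).
Implicit Types (u v : wreath n) (x : wreath n.+1).

Lemma wemb1_perm_lift u i :
  wperm (emb1 u) (lift ord_max i) = lift ord_max (wperm u i).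
Proof.
rewrite permE /wemb_perm_fun; case: insubP => [j _ ej | ].
  apply: val_inj; rewrite val_lift_max /=.
  by congr (val (wperm u _)); apply: val_inj; rewrite ej val_lift_max.
by rewrite val_lift_max ltn_ord.
Qed.

Lemma wemb1_perm_max u : wperm (emb1 u) ord_max = ord_max.
Proof. by rewrite permE /wemb_perm_fun insubF //= ltnn. Qed.

Lemma wemb1_base_lift u i : wbase (emb1 u) (lift ord_max i) = wbase u i.
Proof.
rewrite ffunE; case: insubP => [j _ ej | ].
  by congr (wbase u _); apply: val_inj; rewrite ej val_lift_max.
by rewrite val_lift_max ltn_ord.
Qed.

Lemma wemb1_base_max u : wbase (emb1 u) ord_max = 1.
Proof. by rewrite ffunE insubF //= ltnn. Qed.

Lemma wemb1_permV_lift u i :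
  (wperm (emb1 u))^-1 (lift ord_max i) = lift ord_max ((wperm u)^-1 i).
Proof. by apply: (@perm_inj _ (wperm (emb1 u))); rewrite wemb1_perm_lift !permKV. Qed.

Lemma wemb1_permV_max u : (wperm (emb1 u))^-1 ord_max = ord_max.
Proof. by apply: (@perm_inj _ (wperm (emb1 u))); rewrite wemb1_perm_max permKV. Qed.

Lemma ord_max_liftP (i : 'I_n.+1) : i = ord_max \/ exists j, i = lift ord_max j.
Proof. by case: (unliftP ord_max i) => [j -> | ->]; [right; exists j | left]. Qed.

Lemma wemb1M : {morph emb1 : u v / u * v}.
Proof.
move=> u v; apply: wreath_eqP => i; rewrite ?wbaseM ?wpermM.
  case: (ord_max_liftP i) => [-> | [j ->]].
    by rewrite wemb1_permV_max !wemb1_base_max mulg1.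
  by rewrite wemb1_permV_lift !wemb1_base_lift wbaseM.
case: (ord_max_liftP i) => [-> | [j ->]]; first by rewrite !wemb1_perm_max.
by rewrite !wemb1_perm_lift wpermM.
Qed.

Lemma wemb1_1 : emb1 1 = 1.
Proof. by apply: (mulgI (emb1 1)); rewrite -wemb1M !mulg1. Qed.

Lemma wemb1V u : emb1 u^-1 = (emb1 u)^-1.
Proof. by apply: (mulgI (emb1 u)); rewrite -wemb1M !mulgV wemb1_1. Qed.

Lemma wprojMl u x : wproj (emb1 u * x) = u * wproj x.
Proof.
apply: wreath_eqP => i; last first.
  apply: (@lift_inj _ ord_max); rewrite lift_wproj !wpermM -wemb1_perm_lift.
  rewrite lift_wproj -{2}(wemb1_perm_max u) (inj_eq perm_inj).
  by case: ifP.
rewrite wbaseM !wbase_wproj !wbaseM wpermM.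
rewrite wemb1_base_lift wemb1_base_max wemb1_permV_lift wemb1_permV_max mul1g.
have -> : (wperm (emb1 u) (wperm x ord_max) == lift ord_max i)
        = (wperm x ord_max == lift ord_max ((wperm u)^-1 i)).
  rewrite -wemb1_permV_lift -[RHS](inj_eq (@perm_inj _ (wperm (emb1 u)))).
  by rewrite permKV.
by case: ifP; rewrite ?mulgA.
Qed.

Lemma wprojMr u x : wproj (x * emb1 u) = wproj x * u.
Proof.
apply: wreath_eqP => i; last first.
  apply: (@lift_inj _ ord_max); rewrite !wpermM !lift_wproj !wpermM.
  by rewrite wemb1_perm_lift wemb1_perm_max.
have eV : lift ord_max ((wperm (wproj x))^-1 i) =
    if wperm x ord_max == lift ord_max i then (wperm x)^-1 ord_max
    else (wperm x)^-1 (lift ord_max i).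
  set j := (wperm (wproj x))^-1 i.
  have -> : i = wperm (wproj x) j by rewrite permKV.
  rewrite lift_wproj; case: (wperm x (lift ord_max j) =P ord_max) => [e | ne].
    by rewrite eqxx; apply: (@perm_inj _ (wperm x)); rewrite permKV.
  rewrite (inj_eq perm_inj) (negbTE (neq_lift _ _)) permK //.
rewrite [RHS]wbaseM -[wbase u _]wemb1_base_lift eV !wbase_wproj.
rewrite !wbaseM wpermM wemb1_perm_max.
case: ifP => [/eqP <- | _] //.
by rewrite permK wemb1_base_max mulg1 mulgA.
Qed.

Lemma wembS m (h : (m <= n)%N) (h' : (m <= n.+1)%N) (w : wreath m) :
  wemb h' w = emb1 (wemb h w).
Proof.
apply: wreath_eqP => i; case: (ord_max_liftP i) => [-> | [j ->]].
- by rewrite wemb1_base_max ffunE insubF //= ltnNge h.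
- rewrite wemb1_base_lift !ffunE.
  by rewrite val_lift_max.
- by rewrite wemb1_perm_max permE /wemb_perm_fun insubF //= ltnNge h.
- rewrite wemb1_perm_lift !permE /wemb_perm_fun.
  rewrite val_lift_max.
  case: insubP => // l _ _; apply: val_inj.
  by rewrite val_lift_max.
Qed.

End Equivariance.

(* The cycle of [wperm x] through i is i -> s i -> s (s i) -> ..; the factors
   are multiplied from the last element of the cycle to the first.  Another
   starting point on the same cycle gives a conjugate product. *)
Definition cycle_product n (x : wreath n) (i : 'I_n) : gT :=
  \prod_(j <- rev (traject (wperm x) i #|porbit (wperm x) i|)) wbase x j.

Definition cycle_has_type n (x : wreath n) (C : {set 'I_n}) (cl : {set gT}) :=
  [exists i in C, cycle_product x i \in cl].

Definition num_cycles n (x : wreath n) (cl : {set gT}) (j : nat) : nat :=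
  #|[set C in porbits (wperm x) | (#|C| == j) && cycle_has_type x C cl]|.

End Wreath.

Definition is_partition (la : seq nat) : bool := sorted geq la && (0 \notin la).

Definition is_multipartition k (n : nat) (La : 'I_k -> seq nat) : bool :=
  [forall l, is_partition (La l)] && (\sum_l sumn (La l) == n).

Definition enumerates_classes (gT : finGroupType) k (c : 'I_k -> {set gT}) :=
  injective c /\ codom c =i classes [set: gT]%G.

Definition Kclass (gT : finGroupType) k (c : 'I_k -> {set gT}) n
    (La : 'I_k -> seq nat) : {set wreath gT n} :=
  finset (fun x : wreath gT n =>
    `[< forall l j, num_cycles x (c l) j = count_mem j (La l) >]).

Section ExtendedMonomial.
Local Open Scope ring_scope.
Variable R : realType.

Definition power_sum M (r : nat) : mpoly M R :=
  \sum_(i < M) mpolyX R (mnm1 i) ^+ r.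

(* The sum of the distinct monomials in M variables whose nonzero exponents are
   the parts of [la], in some order. *)
Definition monomial_sym M (la : seq nat) : mpoly M R :=
  \sum_(m : bmultinom M (sumn la).+1 |
        perm_eq [seq e <- multinom_val m | e != 0%N] la) mpolyX R m.

(* [q] writes m_la as a polynomial in the power sums p_1, p_2, .., its variable
   of index r standing for p_{r+1}.  As m_la is homogeneous of degree
   [sumn la], no p_r with r > sumn la occurs.  There is exactly one such [q], the
   power sums being algebraically independent generators over a field of
   characteristic 0, so that the default value of [xget] below is never used. *)
Definition power_sum_expansion (la : seq nat) : set (mpoly (sumn la) R) :=
  [set q | forall M, monomial_sym M la =
           comp_mpoly [tuple power_sum M r.+1 | r < sumn la] q]%classic.

Definition monomial_in_power_sums (la : seq nat) : mpoly (sumn la) R :=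
  xget 0 (@power_sum_expansion la).

Definition extended_monomial (la : seq nat) (x : nat -> R) (delta : R) : R :=
  meval (fun r : 'I_(sumn la) =>
           if r == 0%N :> nat then delta
           else limn (series (fun i => x i ^+ r.+1)))
        (monomial_in_power_sums la).

End ExtendedMonomial.

Local Open Scope classical_set_scope.

Section VirtualPermutations.
Variable gT : finGroupType.

HB.instance Definition _ n := isPointed.Build (wreath gT n) 1%g.
HB.instance Definition _ n := hasNbhs.Build (wreath gT n) principal_filter.
HB.instance Definition _ n := Discrete_ofNbhs.Build (wreath gT n) erefl.

(* The sequences are indexed from 0; the component at 0 carries no information,
   the group [wreath gT 0] being trivial. *)
Definition coherent : set (prod_topology (wreath gT)) :=
  [set x : forall n, wreath gT n | forall n, wproj (x n.+1) = x n].

Definition virtual_perm : Type := set_type coherent.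

HB.instance Definition _ := Topological.on virtual_perm.

Definition vcoord (n : nat) (x : virtual_perm) : wreath gT n := set_val x n.

Lemma wproj_vcoord n (x : virtual_perm) : wproj (vcoord n.+1 x) = vcoord n x.
Proof. exact: (set_mem (valP x)). Qed.

Lemma wproj1 n : wproj (1 : wreath gT n.+1)%g = 1%g.
Proof.
apply: wreath_eqP => i.
  by rewrite !ffunE /= perm1 (negbTE (neq_lift _ _)) ?ffunE.
apply: (@lift_inj _ ord_max).
by rewrite lift_wproj !perm1 eq_sym (negbTE (neq_lift _ _)).
Qed.

Lemma coherent1 : (fun n => 1%g : wreath gT n) \in coherent.
Proof. by apply/mem_set => n; exact: wproj1. Qed.

HB.instance Definition _ :=
  isPointed.Build virtual_perm (exist _ (fun n => 1%g : wreath gT n) coherent1).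

Fixpoint wdown j n : wreath gT (j + n) -> wreath gT n :=
  if j is j'.+1 then fun x => wdown (wproj x) else id.

(* An element of G_oo x G_oo is given by two elements of some G_m.  For n < m
   the component at n of x(w1, w2) is forced by those at larger indices. *)
Definition vact_seq m (w1 w2 : wreath gT m) (x : virtual_perm) n : wreath gT n :=
  wdown ((wemb (leq_addr n m) w2)^-1 * vcoord (m + n) x
         * wemb (leq_addr n m) w1)%g.

Section Action.
Variables (m : nat) (w1 w2 : wreath gT m) (x : virtual_perm).

Let z n : wreath gT n :=
  if @idP (m <= n)%N is ReflectT h
  then ((wemb h w2)^-1 * vcoord n x * wemb h w1)%g else 1%g.

Let zE n (h : (m <= n)%N) : z n = ((wemb h w2)^-1 * vcoord n x * wemb h w1)%g.
Proof.
rewrite /z; case: {-}_ / idP => [h' | //].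
by rewrite (bool_irrelevance h' h).
Qed.

Let wproj_z n : (m <= n)%N -> wproj (z n.+1) = z n.
Proof.
move=> h; rewrite (zE (leqW h)) (zE h) !(wembS h (leqW h)).
by rewrite -wemb1V wprojMr wprojMl wproj_vcoord.
Qed.

Let wdown_coherent j n (y : forall i, wreath gT i) :
  wproj (@wdown j n.+1 (y (j + n.+1))) = @wdown j.+1 n (y (j.+1 + n)).
Proof.
elim: j y => [//|j IHj] y /=.
exact: (IHj (fun i => wproj (y i.+1))).
Qed.

Let vact_seqE n : vact_seq w1 w2 x n = @wdown m n (z (m + n)).
Proof. by rewrite /vact_seq (zE (leq_addr n m)). Qed.

Lemma vact_coherent : vact_seq w1 w2 x \in coherent.
Proof.
apply/mem_set => n; rewrite !vact_seqE wdown_coherent /=.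
by rewrite wproj_z // leq_addr.
Qed.

Definition vact : virtual_perm := exist _ (vact_seq w1 w2 x) vact_coherent.

Let wdown_stable j n (y : forall i, wreath gT i) :
  (forall i, (n <= i)%N -> wproj (y i.+1) = y i) -> @wdown j n (y (j + n)) = y n.
Proof.
move=> yP; elim: j => [//|j IHj] /=.
by rewrite yP ?leq_addl.
Qed.

Lemma vcoord_vact n (h : (m <= n)%N) :
  vcoord n vact = ((wemb h w2)^-1 * vcoord n x * wemb h w1)%g.
Proof.
rewrite -zE -[RHS](@wdown_stable m) -?vact_seqE //.
by move=> i /(leq_trans h)/wproj_z.
Qed.

End Action.
End VirtualPermutations.

Section Nabla.
Local Open Scope ring_scope.
Variables (R : realType) (k : nat).

Definition nabla_ambient : Type :=
  ({ptws 'I_k -> {ptws nat -> R}} * {ptws 'I_k -> R})%type.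

HB.instance Definition _ := Topological.on nabla_ambient.

Definition nabla_set : set nabla_ambient :=
  [set w | [/\ forall l i, w.1 l i.+1 <= w.1 l i,
               forall l i, 0 <= w.1 l i,
               forall l, 0 <= w.2 l,
               forall l, (\sum_(0 <= i <oo) (w.1 l i)%:E <= (w.2 l)%:E)%E
             & \sum_l w.2 l = 1]].

Definition nabla : Type := set_type nabla_set.

HB.instance Definition _ := Topological.on nabla.

(* [nabla_x w l i] is x^(l)_{i+1}. *)
Definition nabla_x (w : nabla) (l : 'I_k) (i : nat) : R := (set_val w).1 l i.
Definition nabla_delta (w : nabla) (l : 'I_k) : R := (set_val w).2 l.

Definition Kkernel (La : 'I_k -> seq nat) (w : nabla) : R :=
  (\sum_l sumn (La l))`!%:R / (\prod_l \prod_(i <- La l) i`!)%:R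
  * \prod_l extended_monomial (La l) (nabla_x w l) (nabla_delta w l).

End Nabla.

(* Measurable types are pointed in MathComp-Analysis, whereas [nabla R 0] is
   empty.  A group has at least one conjugacy class, so their number is written
   k.+1 from here on. *)
Section NablaPointed.
Local Open Scope ring_scope.
Variables (R : realType) (k : nat).

Let w0 : nabla_ambient R k.+1 := (fun _ _ => 0, fun l => (l == ord0)%:R).

Lemma nabla_point : w0 \in @nabla_set R k.+1.
Proof.
apply/mem_set; split=> //= [l|].
  by rewrite eseries0 // lee_fin ler0n.
by rewrite big_ord_recl big1 ?addr0.
Qed.

HB.instance Definition _ := isPointed.Build (nabla R k.+1) (exist _ w0 nabla_point).

End NablaPointed.

Notation borel T := (g_sigma_algebraType (@open T)).

Definition eq_on_measurable d (T : measurableType d) (R : realType)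
    (mu nu : probability T R) : Prop :=
  forall A, measurable A -> mu A = nu A.

Section Central.
Variables (R : realType) (gT : finGroupType).

Definition wcentral n (P : probability (borel (wreath gT n)) R) : Prop :=
  forall (g : wreath gT n) (A : set (borel (wreath gT n))), measurable A ->
    P ((fun x : wreath gT n => x ^ g)%g @^-1` A) = P A.

Definition vcentral (P : probability (borel (virtual_perm gT)) R) : Prop :=
  forall m (w : wreath gT m) (A : set (borel (virtual_perm gT))),
    measurable A -> P (vact w w @^-1` A) = P A.

Definition is_proj_limit (P : probability (borel (virtual_perm gT)) R)
    (Pn : forall n, probability (borel (wreath gT n)) R) : Prop :=
  forall n (A : set (borel (wreath gT n))), measurable A ->
    pushforward P (@vcoord gT n : _ -> borel (wreath gT n)) A = Pn n A.

Definition represented_by k (c : 'I_k.+1 -> {set gT})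
    (Pn : forall n, probability (borel (wreath gT n)) R)
    (Pi : probability (borel (nabla R k.+1)) R) : Prop :=
  forall n (La : 'I_k.+1 -> seq nat), (1 <= n)%N -> is_multipartition n La ->
  forall x : wreath gT n, x \in Kclass c n La ->
    (Pn n [set x] =
     (#|Kclass c n La|%:R^-1)%:E * \int[Pi]_w (Kkernel La w)%:E)%E.

End Central.

(* Main.v *)
Require Import Defs.
From HB Require Import structures.
From mathcomp Require Import all_boot all_order all_algebra all_fingroup.
From mathcomp Require mpoly.
Import -(notations) mpoly.
From mathcomp Require Import all_classical all_reals all_analysis.
From mathcomp Require Import measurable_realfun ring lra zify.

Set Implicit Arguments.
Unset Strict Implicit.
Unset Printing Implicit Defensive.

Import Order.TTheory GRing.Theory Num.Theory.
Import numFieldNormedType.Exports.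

(** The theorem is a coloured version of Kingman's representation of exchangeable partitions. The
    cycles of an element of G_n, coloured by the classes of their cycle-products, form a coloured
    partition of the n points, and the canonical projection restricts this partition to fewer
    points. A virtual permutation therefore carries a coloured partition of the integers. A point
    (x, delta) of [nabla] records the asymptotic frequencies x^(l)_i of the blocks of colour l and
    the total mass delta^(l) of that colour; the mass not covered by the x^(l)_i is dust.

    Two facts translate the formula of the theorem into this language. Elements with the same
    coloured partition are conjugate ([eqcp_conj]), and there are [weight] of them ([card_eqcp]).
    The kernel divided by the class size is [augm], the augmented monomial function in the extended
    power sums, divided by [weight] ([Kkernel_Kclass]); the class size itself comes from comparing
    coefficients in [sum_wt]. So the formula says ([represented_byP]) that the probability of a
    coloured partition of n points is the Pi-expectation of [augm] at its shape, that is, of the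
    probability that n points sampled from (x, delta) are grouped and coloured in this way.

    From P to Pi: centrality makes the coloured partition exchangeable ([exchangeable]). At the
    frequencies of the blocks among the first n integers, [augm] is exactly the proportion of tuples
    that realise a pattern ([augm_block]), and the expectation of this proportion differs from the
    probability of the pattern by O(1/n) ([expect_iavg_natural]). Applied to second moments, this
    shows that the empirical power sums at n = 4^j have increments summable in mean ([expect_incr]).
    They converge almost surely, by compactness to the power sums of a random point of [nabla]
    ([frequency_limit]), whose law is the measure sought ([direct]).

    Uniqueness of Pi: products of power sums are combinations of values of [augm]
    ([moments_of_augm]), the joint moments of the bounded power sums determine their joint law, and
    the power sums generate the Borel sets of [nabla] ([nabla_moments], [measurable_to_nabla]).

    From Pi to P: the masses given by the formula are nonnegative, because extended monomial
    functions are limits of ordinary ones at nonnegative points ([extended_monomial_ge0]). They are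
    coherent, because summing over all insertions of a new point multiplies by the sum of the
    delta^(l), which is 1 ([sum_wt_wins]). Compactness extends them to a measure ([kolmogorov]),
    which is central since the shape is a conjugacy invariant ([shape_conj]). *)

(** * Augmented monomial symmetric functions of coloured parts *)

Section AugmentedMonomials.
Local Open Scope ring_scope.
Variable L : eqType.
Implicit Types (a b e : L * nat) (s t : seq (L * nat)).

(** All ways in which one entry of the same colour absorbs [a]. Positions count, so equal entries
    give repeated results. *)
Fixpoint merges a s : seq (seq (L * nat)) :=
  if s is b :: s' then
    (if b.1 == a.1 then [:: (b.1, (b.2 + a.2)%N) :: s'] else [::])
    ++ map (cons b) (merges a s')
  else [::].

Lemma size_merges a s t : t \in merges a s -> size t = size s.
Proof.
elim: s t => [|b s IHs] t //=; rewrite mem_cat => /orP[|].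
  by case: ifP => _ //; rewrite inE => /eqP ->.
by case/mapP => u /IHs us ->; rewrite /= us.
Qed.

Section Values.
Variables (S : comNzRingType) (p : L -> nat -> S).

(** A merge of the tail is as long as the tail but not a part of it, so the recursion is on the
    length, supplied as fuel; starting from [n = size s], fuel and list run out together. *)
Fixpoint augm_rec n s : S :=
  if n is n'.+1 then
    if s is a :: s' then
      p a.1 a.2 * augm_rec n' s' - \sum_(t <- merges a s') augm_rec n' t
    else 1
  else 1.

(* The augmented monomial symmetric function (the sum of the products over all
   assignments of distinct variables to the coloured parts), as a polynomial in
   the power sums. *)
Definition augm s := augm_rec (size s) s.

Lemma augm_nil : augm [::] = 1. Proof. by []. Qed.

Lemma augm_cons a s :
  augm (a :: s) = p a.1 a.2 * augm s - \sum_(t <- merges a s) augm t.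
Proof.
rewrite {1}/augm /=; congr (_ - _); apply: eq_big_seq => t ts.
by rewrite /augm (size_merges ts).
Qed.

End Values.

(** Permutations of lists are generated by swapping the first two entries and by acting on the tail:
    the head is moved to its place by successive swaps. *)
Lemma perm_skip_swap_ind (P : seq (L * nat) -> seq (L * nat) -> Prop) :
  (forall s, P s s) ->
  (forall s t u, P s t -> P t u -> P s u) ->
  (forall a s t, perm_eq s t -> P s t -> P (a :: s) (a :: t)) ->
  (forall a b s, P (a :: b :: s) (b :: a :: s)) ->
  forall s t, perm_eq s t -> P s t.
Proof.
move=> Prefl Ptrans Pskip Pswap.
have Pmove a s1 s2 : P (a :: s1 ++ s2) (s1 ++ a :: s2).
  elim: s1 => [|b s1 IHs1] /=; first exact: Prefl.
  apply: Ptrans (Pswap _ _ _) (Pskip _ _ _ _ IHs1).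
  by rewrite perm_sym perm_catC /= perm_cons perm_catC.
elim=> [|a s IHs] t.
  by move/perm_size => /=; case: t.
move=> pt; have at_ : a \in t by rewrite -(perm_mem pt) mem_head.
move: pt; case/splitPr: at_ => t1 t2.
rewrite perm_sym perm_catC /= perm_cons perm_catC perm_sym => pt.
by apply: Ptrans (Pmove a t1 t2); apply: Pskip => //; apply: IHs.
Qed.

Section PermInvariance.
Variables (S : comNzRingType) (p : L -> nat -> S).

(** Invariance of [g] is assumed only for lists of the length of [s], which is all that the
    induction hypothesis in [augm_perm] offers. *)
Lemma sum_merges_perm (g : seq (L * nat) -> S) a s t :
  (forall u v, size u = size s -> perm_eq u v -> g u = g v) -> perm_eq s t ->
  \sum_(u <- merges a s) g u = \sum_(u <- merges a t) g u.
Proof.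
move=> gP pst; move: s t pst g gP.
suff H s t : perm_eq s t -> perm_eq s t /\ forall g : _ -> S,
    (forall u v, size u = size s -> perm_eq u v -> g u = g v) ->
    \sum_(u <- merges a s) g u = \sum_(u <- merges a t) g u.
  by move=> s t /H[].
move: s t; apply: (perm_skip_swap_ind (P := fun s t => perm_eq s t /\ forall g : _ -> S,
    (forall u v, size u = size s -> perm_eq u v -> g u = g v) ->
    \sum_(u <- merges a s) g u = \sum_(u <- merges a t) g u)) => //.
- move=> s t u [pst st] [ptu tu]; split; first exact: perm_trans ptu.
  by move=> g gP; rewrite st // tu // -(perm_size pst).
- move=> b s t pst [_ st]; split; first by rewrite perm_cons.
  move=> g gP /=; rewrite !big_cat !big_map /=; congr (_ + _).
    case: ifP => _; rewrite ?big_nil // !big_seq1.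
    by apply: gP; rewrite //= perm_cons.
  by apply: st => u v /= su uv; apply: gP; rewrite /= ?su // perm_cons.
- have swap b c s : perm_eq [:: b, c & s] [:: c, b & s].
    by rewrite (perm_catCA [:: b] [:: c]).
  move=> b c s; split=> // g gP /=.
  rewrite !map_cat !big_cat /= addrCA; congr (_ + (_ + _)).
  - by case: ifP => _; rewrite ?big_nil // !big_seq1; apply: gP.
  - by case: ifP => _; rewrite ?big_nil // !big_seq1; apply: gP.
  - rewrite !big_map; apply: eq_big_seq => u /size_merges su.
    by apply: gP; rewrite /= ?su.
Qed.

(** After two expansions every term is symmetric in [a] and [b]: the product, the two mixed sums
    taken together, the merge of [a] with [b], and the double sum, where the order of the two merges
    into [s] does not matter. *)
Lemma augm_swap a b s : augm p (a :: b :: s) = augm p (b :: a :: s).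
Proof.
rewrite !augm_cons /= !big_cat !big_map /=.
under [X in _ - (_ + X)]eq_bigr => t _ do rewrite augm_cons.
under [X in _ = _ - (_ + X)]eq_bigr => t _ do rewrite augm_cons.
rewrite !big_split /= -!mulr_sumr !sumrN.
have -> : \sum_(t <- if b.1 == a.1 then [:: (b.1, (b.2 + a.2)%N) :: s] else [::])
            augm p t =
          \sum_(t <- if a.1 == b.1 then [:: (a.1, (a.2 + b.2)%N) :: s] else [::])
            augm p t.
  by rewrite eq_sym; case: eqP => // ->; rewrite addnC.
have -> : \sum_(t <- merges a s) \sum_(u <- merges b t) augm p u =
          \sum_(t <- merges b s) \sum_(u <- merges a t) augm p u.
  have hs (g : _ -> S) r F : \sum_(t <- r) \sum_(u <- [:: F t]) g u =
      \sum_(t <- r) g (F t) :> S.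
    by apply: eq_bigr => t _; rewrite big_seq1.
  have hn (g : _ -> S) (r : seq (seq (L * nat))) :
      \sum_(t <- r) \sum_(u <- [::] : seq (seq (L * nat))) g u = 0 :> S.
    by apply: big1 => t _; rewrite big_nil.
  elim: s (augm p) => [|c s IHs] g /=; first by rewrite !big_nil.
  rewrite !big_cat !big_map /=.
  under [X in _ + X = _]eq_bigr => t _ do rewrite big_cat big_map /=.
  under [X in _ = _ + X]eq_bigr => t _ do rewrite big_cat big_map /=.
  rewrite !big_split /= (IHs (fun t => g (c :: t))) !addrA.
  congr (_ + _); case Eca: (c.1 == a.1); case Ecb: (c.1 == b.1);
    rewrite ?big_nil ?big_seq1 /= ?Eca ?Ecb /= ?big_cons ?big_map ?big_nil.
  - rewrite ?hs -!addrA -!addnA [(a.2 + _)%N]addnC; congr (_ + _).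
    by rewrite addrC.
  - rewrite ?hs ?hn ?big1_eq ?addr0 ?add0r //.
  - rewrite ?hs ?hn ?big1_eq ?addr0 ?add0r //.
  - rewrite ?hn ?big1_eq //.
by ring.
Qed.

Lemma augm_perm s t : perm_eq s t -> augm p s = augm p t.
Proof.
have [n] := ubnP (size s); elim: n s t => // n IHn s t lesn pst.
suff [] : size s = size t /\ augm p s = augm p t by [].
move: s t pst lesn.
apply: (perm_skip_swap_ind
  (P := fun s t => (size s < n.+1)%N -> size s = size t /\ augm p s = augm p t)) => //.
- move=> s t u st tu sn; have [e1 e2] := st sn.
  by rewrite e1 e2; apply: tu; rewrite -e1.
- move=> a s t pst _ /= sn; rewrite (perm_size pst); split=> //.
  rewrite !augm_cons (IHn s t) //; congr (_ - _).
  by apply: sum_merges_perm => // u v su uv; apply: IHn; rewrite // su.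
- by move=> a b s _; rewrite augm_swap.
Qed.

Lemma merges_cat a s t : merges a (s ++ t) =
  [seq u ++ t | u <- merges a s] ++ [seq s ++ u | u <- merges a t].
Proof.
elim: s => [|b s IHs] /=; first by rewrite map_id.
rewrite IHs !map_cat -!map_comp catA; congr (_ ++ _); congr (_ ++ _).
by case: ifP.
Qed.

Lemma merges_notin a s : all (fun b => b.1 != a.1) s -> merges a s = [::].
Proof. by elim: s => //= b s IHs /andP[/negbTE -> /IHs ->]. Qed.

Lemma merges_colors a s u : u \in merges a s -> map fst u = map fst s.
Proof.
elim: s u => //= b s IHs u; rewrite mem_cat => /orP[|/mapP[v /IHs e ->]].
  by case: ifP => //= _; rewrite inE => /eqP ->.
by rewrite /= e.
Qed.

(** Parts of different colours never merge, so the recursion on [s] does not touch [t]. *)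
Lemma augm_cat s t :
  all (fun b => b.1 \notin map fst s) t -> augm p (s ++ t) = augm p s * augm p t.
Proof.
have [n] := ubnP (size s); elim: n s => // n IHn [|a s] /= sn st.
  by rewrite mul1r.
have st' : all (fun b => b.1 \notin map fst s) t.
  by apply: sub_all st => b; rewrite inE negb_or => /andP[].
rewrite !augm_cons IHn // merges_cat (merges_notin (s := t)); last first.
  by apply: sub_all st => b; rewrite inE negb_or => /andP[].
rewrite cats0 big_map mulrBl mulrA mulr_suml; congr (_ - _).
apply: eq_big_seq => u us; apply: IHn; first by rewrite (size_merges us).
by rewrite (merges_colors us).
Qed.

End PermInvariance.

(* The recursion of [augm] expresses that a new variable is either distinct from
   the variables already chosen or equal to exactly one of them. *)
Section InjectiveSums.
Variables (S : comNzRingType) (V : finType) (y : L * nat -> V -> S).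

(** [X] holds the variables already used. The intended [y e v] is the power [e.2] of the variable
    [v], or 0 if [v] has not the colour [e.1]; [yM] keeps the multiplication rule of such powers. *)
Fixpoint injsum s (X : {set V}) : S :=
  if s is e :: s' then \sum_(v | v \notin X) y e v * injsum s' (v |: X) else 1.

Hypothesis yM : forall a b v, y b v * y a v =
  if b.1 == a.1 then y (b.1, (b.2 + a.2)%N) v else 0.

(** The difference of the two sums collects the assignments in which an entry of [s] takes the value
    [v]; being injective, they have exactly one such entry, and by [yM] it absorbs [a]. *)
Lemma injsum_merges a s (X : {set V}) :
  \sum_(v | v \notin X) y a v * (injsum s X - injsum s (v |: X)) =
  \sum_(t <- merges a s) injsum t X.
Proof.
elim: s X => [|e s IHs] X /=.
  by rewrite big_nil big1 // => v _; rewrite subrr mulr0.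
rewrite big_cat big_map /=.
rewrite [X in _ = _ + X]exchange_big /=.
under [X in _ = _ + X]eq_bigr => u uX do rewrite -mulr_sumr -IHs.
have -> : \sum_(t <- if e.1 == a.1 then [:: (e.1, (e.2 + a.2)%N) :: s] else [::])
    injsum t X = \sum_(v | v \notin X) y e v * y a v * injsum s (v |: X).
  under [RHS]eq_bigr do rewrite yM.
  by case: ifP => _; rewrite ?big_seq1 // big_nil big1 // => v _; rewrite mul0r.
under [X in _ = _ + X]eq_bigr => u uX.
  rewrite mulr_sumr.
  under eq_bigl => v do rewrite in_setU1 negb_or andbC.
  over.
rewrite (exchange_big_dep (fun v => v \notin X)) /=; last by move=> ? ? ? /andP[].
rewrite -big_split /=; apply: eq_bigr => v vX.
rewrite [in LHS](bigD1 v) //= mulrBr mulrDr -addrA mulrCA mulrA; congr (_ + _).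
rewrite mulr_sumr.
under [X in _ - _ * X]eq_bigl => u do rewrite in_setU1 negb_or andbC.
rewrite mulr_sumr -sumrB.
apply: eq_big => u; first by rewrite vX eq_sym.
by move=> _; rewrite finset.setUCA; ring.
Qed.

Lemma augm_injsum s : augm (fun l r => \sum_v y (l, r) v) s = injsum s finset.set0.
Proof.
have [n] := ubnP (size s); elim: n s => // n IHn [|a s] //= sn.
rewrite augm_cons IHn // (eq_big_seq (fun t => injsum t finset.set0)); last first.
  by move=> t /size_merges ts; apply: IHn; rewrite ts.
rewrite -injsum_merges mulr_suml -surjective_pairing.
rewrite [X in _ - X](eq_bigl xpredT) => [|v]; last by rewrite finset.in_set0.
rewrite -sumrB [RHS](eq_bigl xpredT) => [|v]; last by rewrite finset.in_set0.
by apply: eq_bigr => v _; ring.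
Qed.

End InjectiveSums.

Lemma merges_parts a s u : u \in merges a s -> a.2 != 0%N ->
  all (fun e => e.2 != 0%N) s ->
  all (fun e => e.2 != 0%N) u /\
  sumn (map snd u) = (a.2 + sumn (map snd s))%N.
Proof.
move=> + a0; elim: s u => //= b s IHs u; rewrite mem_cat => /orP[|].
  case: ifP => //= _; rewrite inE => /eqP -> /andP[b0 s0] /=.
  by rewrite addn_eq0 negb_and b0 s0 addnA [(b.2 + _)%N]addnC.
case/mapP => v /IHs vP -> /andP[b0 /vP[v0 sv]] /=.
by rewrite b0 v0 sv addnCA.
Qed.

(** Merging adds degrees, so only power sums of degree between 1 and the total degree occur. The
    values of [p] outside this range are therefore arbitrary. *)
Lemma eq_augm (S : comNzRingType) (p q : L -> nat -> S) s N :
  (forall l r, (0 < r <= N)%N -> p l r = q l r) ->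
  all (fun e => e.2 != 0%N) s -> (sumn (map snd s) <= N)%N ->
  augm p s = augm q s.
Proof.
move=> pq; have [n] := ubnP (size s); elim: n s => // n IHn [|a s] //= sn.
move=> /andP[a0 s0] sN; rewrite !augm_cons pq ?IHn //.
- congr (_ - _); apply: eq_big_seq => t ts; have [t0 st] := merges_parts ts a0 s0.
  by apply: IHn => //; rewrite ?(size_merges ts) ?st.
- by apply: leq_trans sN; rewrite leq_addl.
- by rewrite lt0n a0; apply: leq_trans sN; rewrite leq_addr.
Qed.

Lemma rmorph_augm (S S' : comNzRingType) (f : {rmorphism S -> S'})
  (p : L -> nat -> S) s : f (augm p s) = augm (fun l r => f (p l r)) s.
Proof.
have [n] := ubnP (size s); elim: n s => // n IHn [|a s] /= sn.
  by rewrite !augm_nil rmorph1.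
rewrite !augm_cons rmorphB rmorphM IHn // rmorph_sum; congr (_ - _).
by apply: eq_big_seq => t /size_merges ts; apply: IHn; rewrite ts.
Qed.

End AugmentedMonomials.

(** * Coefficients of the augmented monomials *)

Section MonomialCoefficients.
Local Open Scope ring_scope.

(** The number of permutations of the positions that exchange equal entries: the ratio of the
    augmented monomial function to the monomial function. *)
Definition mults (T : eqType) (s : seq T) : nat :=
  \prod_(e <- undup s) (count_mem e s)`!.

Lemma mults_cons (T : eqType) (e : T) s :
  mults (e :: s) = ((count_mem e s).+1 * mults s)%N.
Proof.
rewrite /mults /=; case: ifP => es.
  have eu : e \in undup s by rewrite mem_undup.
  rewrite (bigD1_seq e) ?undup_uniq //= [in RHS](bigD1_seq e) ?undup_uniq //=.
  rewrite eqxx add1n factS -mulnA; congr (_ * (_ * _))%N.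
  by apply: eq_bigr => f fe; rewrite eq_sym (negbTE fe).
rewrite big_cons eqxx add1n.
have c0 : count_mem e s = 0%N by apply/count_memPn; rewrite es.
rewrite c0 !mul1n; apply: eq_big_seq => f.
by rewrite mem_undup => fs; case: eqP => // ef; rewrite ef fs in es.
Qed.

Lemma perm_mults (T : eqType) (s t : seq T) : perm_eq s t -> mults s = mults t.
Proof.
move=> st; rewrite /mults.
rewrite (perm_big (undup t)) /=; last exact: perm_undup (perm_mem st).
by apply: eq_bigr => e _; rewrite (seq.permP st).
Qed.

Lemma mults_gt0 (T : eqType) (s : seq T) : (0 < mults s)%N.
Proof. by apply: prodn_gt0 => i; exact: fact_gt0. Qed.

Variables (R : comNzRingType) (L : eqType) (M : nat) (col : 'I_M -> L).
Implicit Types (m : multinom M) (X : {set 'I_M}) (s : seq (L * nat)).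

Lemma mcoeffXUM v r (q : mpoly M R) m :
  mcoeff m (mpolyX R (mnm1 v) ^+ r * q) =
  if (r <= m v)%N then mcoeff (mnm_sub m (mnm_muln (mnm1 v) r)) q else 0.
Proof.
rewrite mpolyXn mulrC; set u := mnm_muln (mnm1 v) r.
have uv w : u w = if v == w then r else 0%N.
  by rewrite mulmnE mnm1E; case: eqP => _; rewrite ?mul0n ?mul1n.
case: ifP => rm.
  have um : mpoly.lem u m by apply/mnm_lepP => w; rewrite uv; case: eqP => // <-.
  by rewrite -{1}(submK um) addmC mcoeffMX.
apply/eqP; rewrite mcoeff_eq0 (perm_mem (msuppMX _ _)).
apply/mapP => -[m' _ em]; move: rm; rewrite em mnmDE uv eqxx.
by rewrite leq_addr.
Qed.

Definition var_power (e : L * nat) (v : 'I_M) : mpoly M R :=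
  if col v == e.1 then mpolyX R (mnm1 v) ^+ e.2 else 0.

Lemma var_powerM a b v : var_power b v * var_power a v =
  if b.1 == a.1 then var_power (b.1, (b.2 + a.2)%N) v else 0.
Proof.
rewrite /var_power /=; case: (col v =P b.1) => [<-|vb].
  by case: ifP => _; rewrite ?mulr0 // exprD.
by rewrite mul0r; case: ifP.
Qed.

Definition labels m X : seq (L * nat) :=
  [seq (col v, m v) | v <- enum 'I_M & (v \notin X) && (m v != 0%N)].

Lemma mem_filter_enum (P : pred 'I_M) v : (v \in [seq v <- enum 'I_M | P v]) = P v.
Proof. by rewrite mem_filter fintype.mem_enum andbT. Qed.

Lemma perm_labels m X v : v \notin X -> m v != 0%N ->
  perm_eq (labels m X) ((col v, m v) :: labels m (v |: X)).
Proof.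
move=> vX mv; rewrite /labels -map_cons; apply: perm_map.
apply: uniq_perm.
- by rewrite filter_uniq // enum_uniq.
- rewrite /= filter_uniq ?enum_uniq // andbT mem_filter.
  by rewrite finset.setU11.
- move=> w; rewrite in_cons !mem_filter_enum in_setU1 negb_or.
  by have [->|_] := eqVneq w v; rewrite ?vX ?mv.
Qed.

Lemma count_labels m X e : e.2 != 0%N ->
  count_mem e (labels m X) = #|[pred v | (v \notin X) && ((col v, m v) == e)]|.
Proof.
move=> e0; rewrite count_map count_filter enumT cardE /enum_mem size_filter.
apply: eq_count => v /=; rewrite !inE andbCA.
have [ee|] := eqVneq (col v, m v) e; rewrite ?andbF //=.
by move: e0; rewrite -ee /= => ->.
Qed.

(** The first entry [e] must go to a variable whose label in [m] is exactly [e]. There are as many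
    of these as [e] occurs in the whole list, and [mults_cons] collects these numbers. *)
Lemma mcoeff_injsum s X m : all (fun e => e.2 != 0%N) s ->
  mcoeff m (injsum var_power s X) =
  if [forall v in X, m v == 0%N] && perm_eq (labels m X) s
  then (mults s)%:R else 0.
Proof.
elim: s X m => [|e s IHs] X m /=.
  move=> _; rewrite mcoeff1 /mults big_nil; case: eqP => [->|m0].
    have -> : [forall v in X, (@mnm0 M) v == 0%N].
      by apply/forall_inP => v _; rewrite mnm0E.
    rewrite /labels (eq_filter (a2 := pred0)) ?filter_pred0 // => v.
    by rewrite mnm0E andbF.
  case: andP => // -[/forall_inP mX /perm_nilP em]; case: m0.
  apply/mnmP => v; rewrite mnm0E; apply/eqP.
  have [/mX //|vX] := boolP (v \in X).
  apply/negPn/negP => mv; have : (col v, m v) \in labels m X.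
    by apply/mapP; exists v => //; rewrite mem_filter_enum vX mv.
  by rewrite em.
move=> /andP[e0 s0]; rewrite raddf_sum /=.
(* Once [v] is used no later factor involves it, so [e] has to exhaust its exponent: only the
   variables labelled [e] contribute. *)
have -> : \sum_(v | v \notin X) mcoeff m (var_power e v * injsum var_power s (v |: X))
  = \sum_(v | (v \notin X) && ((col v, m v) == e))
     if [forall v in X, m v == 0%N] && perm_eq (labels m X) (e :: s)
       then (mults s)%:R else 0 : R.
  rewrite [RHS]big_mkcondr /=; apply: eq_bigr => v vX.
  rewrite /var_power -[_ == e]/(_ && _).
  case: eqP => [cv|_] /=; last by rewrite mul0r mcoeff0.
  rewrite mcoeffXUM; case: leqP => [em|me]; last by rewrite ltn_eqF.
  rewrite IHs //; set m' := mnm_sub _ _.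
  have m'v : m' v = (m v - e.2)%N by rewrite mnmBE mulmnE mnm1E eqxx mul1n.
  have m'w w : w != v -> m' w = m w.
    by move=> wv; rewrite mnmBE mulmnE mnm1E eq_sym (negbTE wv) mul0n subn0.
  have -> : [forall w in v |: X, m' w == 0%N] =
            (m v == e.2) && [forall w in X, m w == 0%N].
    apply/forall_inP/andP => [H|[/eqP H /forall_inP HX] w].
      split; first by have := H v (finset.setU11 _ _); rewrite m'v subn_eq0 eqn_leq em => ->.
      apply/forall_inP => w wX; rewrite -m'w ?H ?in_setU1 ?wX ?orbT //.
      by apply: contraNneq vX => <-.
    rewrite in_setU1; have [-> _|wv] := eqVneq w v; first by rewrite m'v H subnn.
    by move=> /= wX; rewrite m'w // HX.
  case: eqP => //= mv; congr (if _ && _ then _ else _).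
  have -> : labels m' (v |: X) = labels m (v |: X).
    rewrite /labels.
    have mm w : w \notin v |: X -> m' w = m w.
      by rewrite in_setU1 negb_or => /andP[wv _]; rewrite m'w.
    under eq_filter => w.
      rewrite (_ : _ && _ = (w \notin v |: X) && (m w != 0%N)).
        over.
      by case: (boolP (w \in _)) => //= /mm ->.
    apply/eq_in_map => w; rewrite mem_filter_enum => /andP[wX _].
    by rewrite mm.
  have mv0 : m v != 0%N by rewrite mv.
  by rewrite (permPl (perm_labels vX mv0)) cv mv -surjective_pairing perm_cons.
rewrite big_const -count_labels //; case: ifP => [/andP[_ pe]|_].
  by rewrite (seq.permP pe) /= eqxx iter_addr_0 mults_cons natrM mulr_natl.
by elim: (count_mem _ _) => //= n ->; rewrite addr0.
Qed.

End MonomialCoefficients.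

(** * Monomial functions as polynomials in the power sums *)

Section PowerSumExpansion.
Local Open Scope ring_scope.
Variable R : realType.

Definition mono (la : seq nat) : seq (unit * nat) := [seq (tt, r) | r <- la].

Lemma tt_inj : injective (fun r : nat => (tt, r)). Proof. by move=> ? ? []. Qed.

Lemma mults_mono la : mults (mono la) = mults la.
Proof.
rewrite /mults /mono undup_map_inj; last exact: tt_inj.
rewrite big_map; apply: eq_bigr => r _; rewrite count_map.
by congr (_`!); apply: eq_count => r' /=; rewrite (inj_eq tt_inj).
Qed.

Lemma mcoeff_monomial_sym M la m :
  mcoeff m (monomial_sym R M la) =
  (perm_eq [seq e <- multinom_val m | e != 0%N] la)%:R.
Proof.
rewrite raddf_sum /=.
under eq_bigr do rewrite mcoeffX.
case: (boolP (perm_eq _ _)) => [pm|pm]; last first.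
  by rewrite big1 // => m' pm'; case: eqP => // e; rewrite -e pm' in pm.
have dm : (mdeg m < (sumn la).+1)%N.
  rewrite ltnS -(perm_sumn pm) /mdeg.
  rewrite leq_eqVlt; apply/orP; left; apply/eqP.
  rewrite sumnE big_filter [in RHS]big_mkcond; apply: eq_bigr => e _.
  by case: eqP => // ->.
rewrite (bigD1 (BMultinom dm)) //= eqxx big1 ?addr0 // => m' /andP[_ ne].
by case: eqP => // e; case/eqP: ne; apply: val_inj.
Qed.

Lemma injsum_monomial_sym M la : all (fun r => r != 0%N) la ->
  injsum (var_power R (fun _ : 'I_M => tt)) (mono la) finset.set0 =
  (mults la)%:R * monomial_sym R M la.
Proof.
move=> la0; apply/mpolyP => m; rewrite mcoeff_injsum ?all_map //.
rewrite mulr_natl mcoeffMn mcoeff_monomial_sym mults_mono.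
have -> : [forall v in (finset.set0 : {set 'I_M}), m v == 0%N].
  by apply/forall_inP => v; rewrite finset.in_set0.
have -> : labels (fun=> tt) m finset.set0 = mono [seq e <- multinom_val m | e != 0%N].
  rewrite /mono /labels.
  have -> : multinom_val m = [tuple m v | v < M].
    by apply: eq_from_tnth => v; rewrite tnth_mktuple.
  rewrite [in RHS]filter_map -[RHS]map_comp; congr (map _ _).
  by apply: eq_filter => v; rewrite /= finset.in_set0.
have -> s : perm_eq (mono s) (mono la) = perm_eq s la.
  by apply/idP/idP; [exact: (perm_map_inj tt_inj) | exact: perm_map].
by case: (perm_eq _ la); rewrite ?mul0rn.
Qed.

(** The variable of index [r.-1] stands for p_r, the same shift as in [power_sum_expansion]. The
    default 0 is only met at degrees that [eq_augm] excludes. *)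
Definition augm_var n : unit -> nat -> mpoly n R :=
  fun _ r => if insub r.-1 is Some i then mpolyX R (mnm1 i) else 0.

(** Substituting the power sums turns [augm] into a sum over injective assignments of variables,
    whose coefficients were computed above. *)
Lemma comp_augm_var la M : all (fun r => r != 0%N) la ->
  comp_mpoly [tuple power_sum R M r.+1 | r < sumn la]
    (augm (augm_var (sumn la)) (mono la)) = (mults la)%:R * monomial_sym R M la.
Proof.
move=> la0; rewrite rmorph_augm -injsum_monomial_sym // -augm_injsum; last first.
  exact: var_powerM.
apply: (eq_augm (N := sumn la)); first last.
- by rewrite -map_comp map_id.
- by rewrite all_map.
move=> [] r /andP[r0 rla]; rewrite /augm_var.
have rla' : (r.-1 < sumn la)%N by rewrite prednK.
rewrite insubT /= comp_mpolyXU -tnth_nth tnth_mktuple /= prednK //.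
Qed.

(** Supplies the existence behind the choice made in [monomial_in_power_sums]. *)
Lemma power_sum_expansion_augm la : all (fun r => r != 0%N) la ->
  @power_sum_expansion R la
    (((mults la)%:R^-1 : R) *: augm (augm_var (sumn la)) (mono la)).
Proof.
move=> la0 M; rewrite comp_mpolyZ comp_augm_var // mulr_natl.
by rewrite -(scaler_nat (mults la) (_ : mpoly M R)) scalerA mulVf ?scale1r // pnatr_eq0 -lt0n mults_gt0.
Qed.

Lemma meval_power_sum_expansion la q M (v : 'I_M -> R) :
  power_sum_expansion q ->
  meval (fun r : 'I_(sumn la) => \sum_i v i ^+ r.+1) q = meval v (monomial_sym R M la).
Proof.
move=> /(_ M) ->; rewrite comp_mpoly_meval; apply: meval_eq => r.
rewrite tnth_mktuple raddf_sum; apply: eq_bigr => i _.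
by rewrite /= rmorphXn /= mevalXU.
Qed.

Lemma meval_monomial_sym_ge0 M (v : 'I_M -> R) la :
  (forall i, 0 <= v i) -> 0 <= meval v (monomial_sym R M la).
Proof.
move=> v0; rewrite raddf_sum; apply: sumr_ge0 => m _ /=.
by rewrite mevalX; apply: prodr_ge0 => i _; rewrite exprn_ge0.
Qed.

End PowerSumExpansion.

(** * Limits of polynomial expressions *)

Section Limits.
Local Open Scope ring_scope.
Local Open Scope classical_set_scope.
Variables (R : realType) (T : Type) (F : set_system T).
Hypothesis FF : Filter F.

Lemma cvg_sumr I (r : seq I) (P : pred I) (f : I -> T -> R) (l : I -> R) :
  (forall i, P i -> f i @ F --> l i) ->
  (fun t => \sum_(i <- r | P i) f i t) @ F --> \sum_(i <- r | P i) l i.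
Proof. by move=> fl; apply: cvg_big => //; exact: add_continuous. Qed.

Lemma cvg_prodr I (r : seq I) (P : pred I) (f : I -> T -> R) (l : I -> R) :
  (forall i, P i -> f i @ F --> l i) ->
  (fun t => \prod_(i <- r | P i) f i t) @ F --> \prod_(i <- r | P i) l i.
Proof. by move=> fl; apply: cvg_big => //; exact: mul_continuous. Qed.

Lemma cvg_expr (f : T -> R) (l : R) n : f @ F --> l -> (fun t => f t ^+ n) @ F --> l ^+ n.
Proof.
move=> fl; elim: n => [|n IHn].
  by under eq_cvg do rewrite expr0; exact: cvg_cst.
rewrite exprS; under eq_cvg do rewrite exprS.
exact: cvgM.
Qed.

Lemma cvg_meval n (v : T -> 'I_n -> R) (w : 'I_n -> R) (q : mpoly n R) :
  (forall i, (v ^~ i) @ F --> w i) -> (fun t => meval (v t) q) @ F --> meval w q.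
Proof.
move=> vw; rewrite mevalE; under eq_cvg do rewrite mevalE.
apply: cvg_sumr => m _; apply: cvgM; first exact: cvg_cst.
by apply: cvg_prodr => i _; exact: cvg_expr.
Qed.

Lemma cvg_augm (L : eqType) (p : T -> L -> nat -> R) (p' : L -> nat -> R) s :
  (forall l r, (fun t => p t l r) @ F --> p' l r) ->
  (fun t => augm (p t) s) @ F --> augm p' s.
Proof.
move=> pp; have [n] := ubnP (size s); elim: n s => // n IHn [|a s] /= sn.
  exact: cvg_cst.
rewrite augm_cons; under eq_cvg do rewrite augm_cons.
apply: cvgB; first by apply: cvgM; [exact: pp | exact: IHn].
rewrite big_seq; under eq_cvg do rewrite big_seq.
by apply: cvg_sumr => t /size_merges st; apply: IHn; rewrite st.
Qed.

End Limits.

(** * Extended monomial functions at a point (x, delta) *)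

Section ExtendedEvaluation.
Local Open Scope ring_scope.
Local Open Scope classical_set_scope.
Variables (R : realType) (x : nat -> R) (delta : R).
Hypotheses (x0 : forall i, 0 <= x i)
           (xdelta : forall N, \sum_(i < N) x i <= delta).

Definition psum r : R :=
  if r == 1%N then delta else limn (series (fun i => x i ^+ r)).

Lemma delta_ge0 : 0 <= delta.
Proof. by have := xdelta 0; rewrite big_ord0. Qed.

Lemma x_le_delta i : x i <= delta.
Proof.
by apply: le_trans (xdelta i.+1); rewrite big_ord_recr /= lerDr sumr_ge0.
Qed.

Lemma xX_le r i : x i ^+ r.+1 <= delta ^+ r * x i.
Proof.
by rewrite exprSr ler_wpM2r // lerXn2r ?nnegrE ?delta_ge0 // x_le_delta.
Qed.

Lemma series_xX_le r N : series (fun i => x i ^+ r.+1) N <= delta ^+ r * delta.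
Proof.
rewrite /series /= big_mkord.
apply: (@le_trans _ _ (\sum_(i < N) delta ^+ r * x i)).
  by apply: ler_sum => i _; exact: xX_le.
by rewrite -mulr_sumr ler_wpM2l // exprn_ge0 // delta_ge0.
Qed.

Lemma is_cvg_series_xX r : cvgn (series (fun i => x i ^+ r.+1)).
Proof.
apply: nondecreasing_is_cvgn.
  by apply: nondecreasing_series => i _ _; rewrite exprn_ge0.
by exists (delta ^+ r * delta) => _ [N _ <-]; exact: series_xX_le.
Qed.

(** Finitely many variables whose power sums tend to the extended ones: the first N+1 coordinates of
    [x], and the missing mass cut into N+1 equal pieces. Then p_1 is exactly [delta], while the
    pieces disappear from the higher power sums. *)
Definition fin_approx N (v : 'I_(N.+1 + N.+1)) : R :=
  match fintype.split v with
  | inl i => x i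
  | inr _ => (delta - \sum_(i < N.+1) x i) / N.+1%:R
  end.

Lemma approx_ge0 N v : 0 <= @fin_approx N v.
Proof. by rewrite /fin_approx; case: fintype.split => // _; rewrite divr_ge0 // subr_ge0. Qed.

Lemma sum_approx N r : \sum_v @fin_approx N v ^+ r =
  series (fun i => x i ^+ r) N.+1 +
  ((delta - \sum_(i < N.+1) x i) / N.+1%:R) ^+ r *+ N.+1.
Proof.
rewrite big_split_ord /= /series /= big_mkord; congr (_ + _).
  apply: eq_bigr => i _; rewrite /fin_approx.
  by have := unsplitK (inl i : 'I_N.+1 + 'I_N.+1); rewrite /= => ->.
rewrite -[X in _ *+ X]card_ord -sumr_const; apply: eq_bigr => i _; rewrite /fin_approx.
by have := unsplitK (inr i : 'I_N.+1 + 'I_N.+1); rewrite /= => ->.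
Qed.

Lemma cvg_sum_approx r : (0 < r)%N ->
  (fun N => \sum_v @fin_approx N v ^+ r) @ \oo --> psum r.
Proof.
case: r => // r _; rewrite /psum; case: eqP => [->|r0].
  rewrite (_ : (fun N => _) = fun=> delta); first exact: cvg_cst.
  apply/funext => N; rewrite sum_approx expr1 -mulr_natr mulfVK ?pnatr_eq0 //.
  rewrite /series /= big_mkord.
  by rewrite addrC subrK.
under eq_cvg do rewrite sum_approx.
rewrite -[limn _]addr0; apply: cvgD.
  by have := @is_cvg_series_xX r; rewrite -cvg_shiftS.
(* There are N+1 pieces of size at most [delta / N.+1], raised to a power that is at least 2, which
   leaves one factor [N.+1%:R^-1]. *)
apply: (@squeeze_cvgr _ _ _ _ (fun=> 0) (fun N => delta ^+ r.+1 * N.+1%:R^-1)).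
- apply: nearW => N; set d := delta - _.
  have d0 : 0 <= d by rewrite subr_ge0.
  have dd : d <= delta by rewrite gerBl sumr_ge0.
  rewrite mulrn_wge0 ?exprn_ge0 ?divr_ge0 //=.
  rewrite expr_div_n -mulr_natr -mulrA ler_pM ?exprn_ge0 //.
    by rewrite lerXn2r ?nnegrE // delta_ge0.
  case: r r0 => // r _; rewrite exprSr invfM mulfVK ?pnatr_eq0 //.
  rewrite lef_pV2 ?posrE ?exprn_gt0 ?ltr0n //.
  by rewrite exprS ler_peMr ?exprn_ege1 ?ler1n ?ler0n.
- exact: cvg_cst.
- rewrite -[0](mulr0 (delta ^+ r.+1)); apply: cvgM; first exact: cvg_cst.
  exact: cvg_harmonic.
Qed.

Lemma cvg_approx_monomial la (q : mpoly (sumn la) R) : power_sum_expansion q ->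
  (fun N => meval (@fin_approx N) (monomial_sym R (N.+1 + N.+1) la)) @ \oo -->
  meval (fun r : 'I_(sumn la) => psum r.+1) q.
Proof.
move=> qP; under eq_cvg do rewrite -(meval_power_sum_expansion _ qP).
by apply: cvg_meval => r; exact: cvg_sum_approx.
Qed.

Lemma monomial_in_power_sumsP la : all (fun r => r != 0%N) la ->
  power_sum_expansion (monomial_in_power_sums R la).
Proof. by move=> la0; apply: xgetPex; eexists; exact: power_sum_expansion_augm. Qed.

Lemma extended_monomialE la : extended_monomial la x delta =
  meval (fun r : 'I_(sumn la) => psum r.+1) (monomial_in_power_sums R la).
Proof. by apply: meval_eq => r; rewrite /psum eqSS. Qed.

(** A limit of values of an ordinary monomial function at the nonnegative points [fin_approx]. *)
Lemma extended_monomial_ge0 la : all (fun r => r != 0%N) la ->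
  0 <= extended_monomial la x delta.
Proof.
move=> la0; rewrite extended_monomialE.
have qP := cvg_approx_monomial (monomial_in_power_sumsP la0).
rewrite -(cvg_lim _ qP) //; apply: limr_ge; first exact: cvgP qP.
by apply: nearW => N; apply: meval_monomial_sym_ge0 => v; exact: approx_ge0.
Qed.

(** The expansion through [augm] and the chosen one agree with the same monomial function at every
    finite point, hence have the same limit along [fin_approx]. *)
Lemma extended_monomial_augm la : all (fun r => r != 0%N) la ->
  (mults la)%:R * extended_monomial la x delta = augm (fun _ => psum) (mono la).
Proof.
move=> la0; rewrite extended_monomialE.
have qP := cvg_approx_monomial (monomial_in_power_sumsP la0).
have := cvg_approx_monomial (power_sum_expansion_augm R la0).
move=> /(cvg_unique _ qP) -> //; rewrite mevalZ mulrA mulfV ?mul1r; last first.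
  by rewrite pnatr_eq0 -lt0n mults_gt0.
rewrite rmorph_augm; apply: (eq_augm (N := sumn la)).
- move=> l r /andP[r0 rla]; rewrite /augm_var.
  have rla' : (r.-1 < sumn la)%N by rewrite prednK.
  by rewrite insubT /= mevalXU /= prednK.
- by rewrite all_map.
- by rewrite -map_comp map_id.
Qed.

End ExtendedEvaluation.

(** * First return maps and cycle-products *)

Section FirstPassage.
Local Open Scope group_scope.
Variable gT : finGroupType.

(* [x] acts on points with a group component by (i, g) |-> (s i, x_{s i} g).
   [fp x i0 i g h] says that the orbit of (i, g) first returns over [i0] with
   component [h].  The projection [wproj] is an induced (first return) map for
   this action, whence the compatibility of return components. *)
Inductive fp n (x : wreath gT n) (i0 : 'I_n) : 'I_n -> gT -> gT -> Prop :=
| fp_stop i g : wperm x i = i0 -> fp x i0 i g (wbase x i0 * g)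
| fp_step i g h : wperm x i != i0 ->
    fp x i0 (wperm x i) (wbase x (wperm x i) * g) h -> fp x i0 i g h.

Lemma fp_mulr n (x : wreath gT n) i0 i g h t :
  fp x i0 i g h -> fp x i0 i (g * t) (h * t).
Proof.
elim=> {i g h} [i g si|i g h si _ IH]; first by rewrite -mulgA; exact: fp_stop.
by apply: fp_step => //; rewrite mulgA.
Qed.

Lemma fp_fun n (x : wreath gT n) i0 i g h h' :
  fp x i0 i g h -> fp x i0 i g h' -> h = h'.
Proof.
move=> H; elim: H h' => {i g h} [i g si|i g h si _ IH] h' H';
  inversion H'; subst; (try by []); (try exact: IH);
  by match goal with ne : is_true (_ != _) |- _ => rewrite eqxx in ne end.
Qed.

Lemma fp_traject n (x : wreath gT n) i0 m i g :
  (forall t, (t < m)%N -> iter t.+1 (wperm x) i != i0) ->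
  iter m.+1 (wperm x) i = i0 ->
  fp x i0 i g (wbase x i0 *
    (\prod_(j <- rev (traject (wperm x) (wperm x i) m)) wbase x j) * g).
Proof.
elim: m i g => [|m IHm] i g lt_m eq_m.
  by rewrite big_nil mulg1; exact: fp_stop.
apply: fp_step; first exact: (lt_m 0).
rewrite [traject _ _ _]/= rev_cons -cats1 big_cat big_seq1 /= -!mulgA mulgA.
by apply: IHm => [t tm|]; [rewrite -iterSr lt_m | rewrite -iterSr].
Qed.

Lemma cycle_productE n (x : wreath gT n) i : cycle_product x i =
  (\prod_(j <- rev (traject (wperm x) (wperm x i) #|porbit (wperm x) i|.-1))
     wbase x j) * wbase x i.
Proof.
rewrite /cycle_product; case: #|_| (card_porbit_neq0 (wperm x) i) => // r _.
by rewrite [traject _ _ _]/= rev_cons -cats1 big_cat big_seq1.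
Qed.

(** The walk started at [i] meets the factor of [i] last, on its return, whereas [cycle_product] has
    it as the rightmost factor; hence the conjugation. *)
Lemma fp_cycle_product n (x : wreath gT n) i :
  fp x i i 1 (cycle_product x i ^ (wbase x i)^-1).
Proof.
rewrite cycle_productE conjgE invgK mulgK.
rewrite -[X in fp _ _ _ _ X]mulg1.
have r0 := card_porbit_neq0 (wperm x) i.
apply: fp_traject; last by rewrite prednK ?lt0n // iter_porbit.
move=> t tr; apply/eqP => e.
have := uniq_traject_porbit (wperm x) i.
have rt : (t.+1 < #|porbit (wperm x) i|)%N by rewrite -ltn_predRL.
move/(nth_uniq i) => /(_ t.+1 0); rewrite size_traject rt lt0n r0 => /(_ isT isT).
by rewrite !nth_traject ?lt0n // e /= eqxx.
Qed.

Lemma cycle_product_step n (x : wreath gT n) i :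
  cycle_product x (wperm x i) = cycle_product x i ^ (wbase x i)^-1.
Proof.
rewrite [in RHS]cycle_productE conjgE invgK mulgK /cycle_product.
have -> : porbit (wperm x) (wperm x i) = porbit (wperm x) i.
  by apply/eqP; rewrite eq_porbit_mem (mem_porbit _ 1).
case: #|_| (card_porbit_neq0 (wperm x) i) (iter_porbit (wperm x) i) => // r _.
rewrite iterSr => ei.
by rewrite trajectSr ei rev_rcons big_cons.
Qed.

(** One step of the projection is one step of [x], or two when [x] passes through the new point; in
    that case the factor g_j g_{n+1} of the projection is the product of the two factors met. *)
Lemma fp_wproj n (x : wreath gT n.+1) i0 i g h : fp (wproj x) i0 i g h ->
  fp x (lift ord_max i0) (lift ord_max i) g h.
Proof.
have ml (j : 'I_n) : (ord_max == lift ord_max j) = false.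
  by apply/negbTE; exact: neq_lift.
elim=> {i g h} [i g|i g h].
  move=> /(congr1 (lift ord_max)); rewrite lift_wproj wbase_wproj.
  case: eqP => [sm e|sm e].
    rewrite e eqxx -mulgA; apply: fp_step; rewrite ?sm ?ml //; exact: fp_stop.
  rewrite -e (inj_eq perm_inj) ml; exact: fp_stop.
rewrite -(inj_eq (@lift_inj _ ord_max)) lift_wproj wbase_wproj.
have := lift_wproj x i; case: eqP => [sm e ne _|sm e ne _].
  rewrite e eqxx -mulgA => H.
  apply: fp_step; rewrite ?sm ?ml //; apply: fp_step => //.
rewrite e (inj_eq perm_inj) ml => H.
by apply: fp_step => //; rewrite -e.
Qed.

(** Conjugation by [u] is the change of coordinates that [u] itself induces on pairs (point, group
    element). *)
Lemma fp_conj n (u x : wreath gT n) i0 i g h : fp x i0 i g h ->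
  fp (u * x * u^-1) (wperm u i0) (wperm u i) (wbase u (wperm u i) * g)
    (wbase u (wperm u i0) * h).
Proof.
set y := u * x * u^-1.
have yu : y * u = u * x by rewrite mulgKV.
have sy j : wperm y (wperm u j) = wperm u (wperm x j).
  by rewrite -wpermM -[RHS]wpermM yu.
have wy j : wbase y (wperm u (wperm x j)) * wbase u (wperm u j) =
            wbase u (wperm u (wperm x j)) * wbase x (wperm x j).
  have /(congr1 (fun z => wbase z (wperm u (wperm x j)))) := yu.
  by rewrite /= !ffunE /= permK -sy permK.
elim=> {i g h} [i g si|i g h si _ IH].
  by rewrite -si mulgA -wy -mulgA; apply: fp_stop; exact: sy.
apply: fp_step; first by rewrite sy (inj_eq perm_inj).
by rewrite sy mulgA wy -mulgA.
Qed.

Lemma porbit_conj n (u x : wreath gT n) i j :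
  (wperm u j \in porbit (wperm (u * x * u^-1)) (wperm u i)) =
  (j \in porbit (wperm x) i).
Proof.
have sy j' : wperm (u * x * u^-1) (wperm u j') = wperm u (wperm x j').
  by rewrite -wpermM mulgKV wpermM.
have syX m j' : (wperm (u * x * u^-1) ^+ m) (wperm u j') = wperm u ((wperm x ^+ m) j').
  by rewrite !permX; elim: m => //= m ->.
apply/porbitP/porbitP => -[m e]; exists m; last by rewrite syX e.
by apply: (@perm_inj _ (wperm u)); rewrite e syX.
Qed.

Lemma porbit_wproj n (x : wreath gT n.+1) i j :
  (lift ord_max j \in porbit (wperm x) (lift ord_max i)) =
  (j \in porbit (wperm (wproj x)) i).
Proof.
have ml (j' : 'I_n) : (ord_max == lift ord_max j') = false.
  by apply/negbTE; exact: neq_lift.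
apply/porbitP/porbitP => -[m]; last first.
  rewrite permX; elim: m j => [|m IHm] j e.
    by exists 0; rewrite expg0 perm1 e.
  have [m' em'] := IHm _ erefl; rewrite e iterS lift_wproj em'.
  case: eqP => [sm|_].
    by exists m'.+2; rewrite !expgSr !permM sm.
  by exists m'.+1; rewrite expgSr permM.
(* Strong induction on the number of steps, since a passage through [ord_max] takes two steps of [x]
   for one of the projection. *)
rewrite permX; have [N] := ubnP m; elim: N m i => // N IHN [|m] i.
  by move=> _ /lift_inj ->; exists 0; rewrite expg0 perm1.
rewrite ltnS iterSr => mN; have := lift_wproj x i.
case: eqP => [sm e|sm <-]; last first.
  by move=> /(IHN _ _ mN)[m' ->]; exists m'.+1; rewrite expgS permM.
rewrite sm; case: m mN => [|m] mN; first by move/eqP; rewrite eq_sym ml.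
rewrite iterSr -e => /(IHN _ _ (ltnW mN))[m' ->].
by exists m'.+1; rewrite expgS permM.
Qed.

End FirstPassage.

(** * Colours of cycles and the shape of an element *)

Section ColouredCycles.
Local Open Scope group_scope.
Variables (gT : finGroupType) (k : nat) (c : 'I_k.+1 -> {set gT}).
Hypothesis hc : enumerates_classes c.

(** The default is never reached, since the classes cover the group ([cls_mem]). *)
Definition cls (g : gT) : 'I_k.+1 := odflt ord0 [pick l | g \in c l].

Lemma cls_mem g : g \in c (cls g).
Proof.
rewrite /cls; case: pickP => [l //|/= no].
have /codomP[l e] : g ^: [set: gT]%G \in codom c.
  by rewrite hc.2; apply/imsetP; exists g; rewrite ?finset.in_setT.
by have := no l; rewrite -e class_refl.
Qed.

Lemma class_c l h : h \in c l -> c l = h ^: [set: gT]%G.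
Proof.
move=> hl; have : c l \in classes [set: gT]%G by rewrite -hc.2 codom_f.
by case/imsetP => g _ e; move: hl; rewrite e => /class_eqP ->.
Qed.

Lemma cls_eq g l : (g \in c l) = (cls g == l).
Proof.
apply/idP/eqP => [gl|<-]; last exact: cls_mem.
by apply: hc.1; rewrite (class_c gl) (class_c (cls_mem g)).
Qed.

Lemma clsJ g h : cls (g ^ h) = cls g.
Proof.
apply/eqP; rewrite -cls_eq (class_c (cls_mem g)).
by rewrite memJ_class // finset.in_setT.
Qed.

Lemma cls_conj g h : cls g = cls h -> exists t, h = g ^ t.
Proof.
move=> e; have := cls_mem h; rewrite -e (class_c (cls_mem g)).
by case/imsetP => t _ ->; exists t.
Qed.

Lemma card_c l : #|c l| = #|[pred g | cls g == l]|.
Proof. by apply: eq_card => g; rewrite cls_eq. Qed.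

Lemma card_c_gt0 l : (0 < #|c l|)%N.
Proof.
have : c l \in classes [set: gT]%G by rewrite -hc.2 codom_f.
by case/imsetP => g _ ->; apply/card_gt0P; exists g; exact: class_refl.
Qed.

Section Level.
Variable n : nat.
Implicit Types (x y u : wreath gT n) (i j : 'I_n).

Definition col x i : 'I_k.+1 := cls (cycle_product x i).
Definition same x i j : bool := j \in porbit (wperm x) i.

Lemma same_refl x i : same x i i. Proof. exact: porbit_id. Qed.
Lemma same_sym x i j : same x i j = same x j i. Proof. exact: porbit_sym. Qed.
Lemma same_porbit x i j : same x i j -> porbit (wperm x) j = porbit (wperm x) i.
Proof. by move=> ij; apply/eqP; rewrite eq_porbit_mem. Qed.
Lemma same_trans x i j l : same x i j -> same x i l = same x j l.
Proof. by rewrite /same => /same_porbit ->. Qed.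

Lemma fp_col x i h : fp x i i 1 h -> cls h = col x i.
Proof. by move=> H; rewrite -(fp_fun (fp_cycle_product x i) H) clsJ. Qed.

Lemma same_col x i j : same x i j -> col x j = col x i.
Proof.
case/porbitP => m ->; rewrite permX; elim: m => //= m <-.
by rewrite /col cycle_product_step clsJ.
Qed.

Lemma col_conj u x i : col (u * x * u^-1) (wperm u i) = col x i.
Proof.
have := fp_conj u (fp_cycle_product x i); set b := wbase u _.
move=> /(fp_mulr b^-1); rewrite mulg1 mulgV => /fp_col <-.
by rewrite -[X in X * _ * _]invgK -mulgA -conjgE clsJ /col clsJ.
Qed.

Lemma same_conj u x i j :
  same (u * x * u^-1) (wperm u i) (wperm u j) = same x i j.
Proof. exact: porbit_conj. Qed.

Lemma cycle_has_type_col x i l :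
  cycle_has_type x (porbit (wperm x) i) (c l) = (col x i == l).
Proof.
apply/exists_inP/eqP => [[j ij]|<-].
  by rewrite cls_eq => /eqP <-; apply/esym/same_col.
by exists i; [exact: porbit_id | exact: cls_mem].
Qed.

Definition lab x i := (col x i, #|porbit (wperm x) i|).

Lemma same_lab x i j : same x i j -> lab x j = lab x i.
Proof. by move=> ij; rewrite /lab (same_col ij) (same_porbit ij). Qed.

Lemma lab_conj u x i : lab (u * x * u^-1) (wperm u i) = lab x i.
Proof.
rewrite /lab col_conj; congr (_, _).
rewrite -[RHS](card_imset _ (@perm_inj _ (wperm u))); apply: eq_card => j.
rewrite -[j](permKV (wperm u)) [LHS](same_conj u x i) mem_imset //.
exact: perm_inj.
Qed.

Definition is_rep x i := [forall j in porbit (wperm x) i, (i <= j)%N].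
Definition reps x := [seq i <- enum 'I_n | is_rep x i].
(** The multipartition attached to [x], as a list of pairs (class, length) with one entry for each
    cycle; only its permutation class matters. *)
Definition shape x := map (lab x) (reps x).

Lemma mem_reps x i : (i \in reps x) = is_rep x i.
Proof. by rewrite mem_filter fintype.mem_enum andbT. Qed.

Lemma reps_uniq x : uniq (reps x).
Proof. by rewrite filter_uniq // enum_uniq. Qed.

Lemma rep_ex x i : exists2 j, j \in reps x & same x i j.
Proof.
case: (arg_minnP (fun j : 'I_n => j : nat) (same_refl x i)) => j ij jP.
exists j => //; rewrite mem_reps; apply/forall_inP => l jl.
by apply: jP; rewrite (same_trans _ ij).
Qed.

Lemma reps_inj x i j : i \in reps x -> j \in reps x -> same x i j -> i = j.
Proof.
rewrite !mem_reps => /forall_inP iP /forall_inP jP ij; apply/val_inj/eqP.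
by rewrite eqn_leq iP // jP // [_ \in _]same_sym.
Qed.

Lemma sum_same (S : nmodType) x (F : 'I_n -> S) :
  (\sum_i F i = \sum_(i <- reps x) \sum_(j | same x i j) F j)%R.
Proof.
have -> : (\sum_i F i = \sum_i \sum_(j <- reps x | same x i j) F i)%R.
  apply: eq_bigr => i _; have [j jr ij] := rep_ex x i.
  rewrite big_mkcond (bigD1_seq j) ?reps_uniq //= ij big1_seq ?addr0 // => l.
  case/andP => lj lr; case: ifP => // il; case/eqP: lj; apply: (reps_inj lr jr).
  by rewrite -(same_trans _ il) // same_sym.
rewrite (exchange_big_dep xpredT) //=; apply: eq_bigr => i _.
by apply: eq_bigl => j; rewrite same_sym.
Qed.

(** Counts cycles through their points, [e.2] for each. Points are easier to transport than the
    minimal representatives, which conjugation does not preserve. *)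
Lemma count_shape x e :
  (e.2 * count_mem e (shape x) = #|[pred i | lab x i == e]|)%N.
Proof.
rewrite -sum1_card big_mkcond /= (sum_same x) /= count_map -sum1_count big_distrr.
rewrite /= [LHS]big_mkcond /=; apply: eq_bigr => i _; rewrite muln1.
under eq_bigr => j ij do rewrite inE (same_lab ij).
case: eqP => [<-|_]; last by rewrite big1.
by rewrite sum1_card.
Qed.

Lemma shape_gt0 x : all (fun e => e.2 != 0%N) (shape x).
Proof.
by rewrite all_map; apply/allP => i _ /=; rewrite card_porbit_neq0.
Qed.

Lemma sumn_shape x : sumn (map snd (shape x)) = n.
Proof.
rewrite sumnE -map_comp big_map -[RHS]card_ord -sum1_card (sum_same x).
by apply: eq_bigr => i _; rewrite sum1_card.
Qed.

(** Conjugation is a label-preserving bijection of the points, so [count_shape] gives equal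
    multiplicities. Length 0, where that lemma is void, is excluded by [shape_gt0]. *)
Lemma shape_conj u x : perm_eq (shape (u * x * u^-1)) (shape x).
Proof.
apply/allP => e _ /=; have [e0|] := posnP e.2.
  have c0 y : count_mem e (shape y) = 0%N.
    apply/count_memPn/negP => es; have := allP (shape_gt0 y) _ es.
    by rewrite e0.
  by rewrite !c0.
move=> e0; rewrite -(eqn_pmul2l e0) !count_shape.
rewrite -(fintype.card_image (@perm_inj _ (wperm u)) [pred i | lab x i == e]); apply/eqP.
apply: eq_card => i; rewrite -[i](permKV (wperm u)) fintype.mem_image; last exact: perm_inj.
by rewrite !inE lab_conj.
Qed.

Lemma num_cycles_shape x l r :
  num_cycles x (c l) r = count_mem (l, r) (shape x).
Proof.
rewrite /num_cycles count_map -size_filter.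
have inj : {in [pred i | i \in [seq i <- reps x | lab x i == (l, r)]] &,
    injective (porbit (wperm x))}.
  move=> i i'; rewrite inE mem_filter => /andP[_ ir].
  rewrite inE mem_filter => /andP[_ ir'] e.
  by apply: (reps_inj ir ir'); rewrite /same e porbit_id.
have -> : size [seq i <- reps x | (preim (lab x) (pred1 (l, r))) i] =
  #|[seq i <- reps x | lab x i == (l, r)]|.
  by rewrite (card_uniqP _) // filter_uniq // reps_uniq.
rewrite -(card_in_imset inj); apply: eq_card => C; rewrite inE.
apply/andP/imsetP => [[/imsetP[i _ ->]]|[i]].
  have [i' i'r ii'] := rep_ex x i; rewrite -(same_porbit ii') => /andP[Cr].
  rewrite cycle_has_type_col => Cl; exists i' => //.
  by rewrite inE mem_filter i'r andbT xpair_eqE Cl Cr.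
rewrite inE mem_filter xpair_eqE => /andP[/andP[il ij] ir] ->.
by rewrite imset_f // ij cycle_has_type_col il.
Qed.

(** Equality of the coloured partitions of the points into cycles; finer than conjugacy, and coarser
    than equality. *)
Definition eqcp x y :=
  [forall i, col x i == col y i] && [forall i, forall j, same x i j == same y i j].

Lemma eqcpP x y : reflect ((forall i, col x i = col y i) /\
  (forall i j, same x i j = same y i j)) (eqcp x y).
Proof.
apply: (iffP andP) => [[/forallP ec /forallP es]|[ec es]]; split.
- by move=> i; apply/eqP.
- by move=> i j; have /forallP/(_ j)/eqP := es i.
- by apply/forallP => i; rewrite ec.
- by apply/forallP => i; apply/forallP => j; rewrite es.
Qed.

End Level.

(** A first return of the projection lifts to a first return of [x] with the same group component
    ([fp_wproj]), so the cycle-products are conjugate. *)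
Lemma col_wproj n (x : wreath gT n.+1) i : col x (lift ord_max i) = col (wproj x) i.
Proof.
rewrite -(fp_col (fp_wproj (fp_cycle_product (wproj x) i))).
by rewrite clsJ.
Qed.

Lemma same_wproj n (x : wreath gT n.+1) i j :
  same x (lift ord_max i) (lift ord_max j) = same (wproj x) i j.
Proof. exact: porbit_wproj. Qed.

End ColouredCycles.

(** * The fibres of the projection *)

Section Insertion.
Local Open Scope group_scope.
Variable gT : finGroupType.

Lemma ord_max_lift n (i : 'I_n) : (ord_max == lift ord_max i) = false.
Proof. by apply/negbTE; exact: neq_lift. Qed.

Lemma lift_ord_max n (i : 'I_n) : (lift ord_max i == ord_max) = false.
Proof. by rewrite eq_sym ord_max_lift. Qed.

(** The image of the new point and its group component are the only data that the projection
    forgets; a fibre is thus parametrised by a point and a group element. *)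
Lemma wproj_inj n (x y : wreath gT n.+1) : wproj x = wproj y ->
  wperm x ord_max = wperm y ord_max -> wbase x ord_max = wbase y ord_max -> x = y.
Proof.
move=> exy es eg; apply: wreath_eqP => i; case: (ord_max_liftP i) => [->|[j ->]] //.
- have := wbase_wproj x j; rewrite exy wbase_wproj es eg.
  by case: ifP => _ // /mulIg.
- have := lift_wproj x j; rewrite exy lift_wproj es.
  case: eqP => [->|ny]; case: eqP => [->|nx] // e.
    by move: e; rewrite -es => /perm_inj/eqP; rewrite ord_max_lift.
  by move: e => /perm_inj/eqP; rewrite lift_ord_max.
Qed.

(** The two group components are chosen so that the product formed by the projection is 1; for
    [j = ord_max] the transposition is the identity. *)
Definition insertion n (j : 'I_n.+1) (g : gT) : wreath gT n.+1 :=
  Wreath [ffun i => if i == ord_max then g else if i == j then g^-1 else 1]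
         (tperm j ord_max).

Lemma wproj_insertion n (j : 'I_n.+1) g : wproj (insertion j g) = 1.
Proof.
apply: wreath_eqP => i.
  rewrite wbase_wproj /= !ffunE tpermR eqxx lift_ord_max eq_sym.
  by case: (_ == j) => //; rewrite mulVg.
apply: (@lift_inj _ ord_max); rewrite lift_wproj /= perm1 tpermR.
by case: tpermP => [<-|/eqP|_ _]; rewrite ?eqxx ?lift_ord_max.
Qed.

(* The element [x] of G_n with the new point n+1 inserted before [j] (or as a
   fixed point when [j] is [ord_max]). *)
Definition wins n (x : wreath gT n) (j : 'I_n.+1) (g : gT) : wreath gT n.+1 :=
  insertion j (g * (wbase (wemb (leqnSn n) x) j)^-1) * wemb (leqnSn n) x.

Lemma wproj_wins n (x : wreath gT n) j g : wproj (wins x j g) = x.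
Proof. by rewrite wprojMr wproj_insertion mul1g. Qed.

Lemma wperm_wins n (x : wreath gT n) j g : wperm (wins x j g) ord_max = j.
Proof. by rewrite wpermM wemb1_perm_max /= tpermR. Qed.

Lemma wbase_wins n (x : wreath gT n) j g : wbase (wins x j g) ord_max = g.
Proof. by rewrite wbaseM /= !ffunE eqxx tpermV tpermR mulgKV. Qed.

Lemma wins_wproj n (x : wreath gT n.+1) :
  wins (wproj x) (wperm x ord_max) (wbase x ord_max) = x.
Proof. by apply: wproj_inj; rewrite ?wproj_wins ?wperm_wins ?wbase_wins. Qed.

Lemma sum_wproj (S : nmodType) n (x : wreath gT n) (F : wreath gT n.+1 -> S) :
  (\sum_(y | wproj y == x) F y = \sum_j \sum_g F (wins x j g))%R.
Proof.
rewrite pair_big /= (reindex_onto (fun p : 'I_n.+1 * gT => wins x p.1 p.2)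
  (fun y => (wperm y ord_max, wbase y ord_max))).
  apply: eq_bigl => p.
  by rewrite wproj_wins wperm_wins wbase_wins -surjective_pairing !eqxx.
by move=> y /eqP <-; rewrite wins_wproj.
Qed.

Lemma sum_wreathS (S : nmodType) n (F : wreath gT n.+1 -> S) :
  (\sum_y F y = \sum_x \sum_j \sum_g F (wins x j g))%R.
Proof.
rewrite (partition_big (@wproj gT n) xpredT) //=.
by apply: eq_bigr => x _; rewrite -sum_wproj.
Qed.

End Insertion.

(** * How an insertion changes the coloured partition *)

Section InsertionShape.
Local Open Scope group_scope.
Variables (gT : finGroupType) (k : nat) (c : 'I_k.+1 -> {set gT}).
Hypothesis hc : enumerates_classes c.
Notation lab := (lab c). Notation col := (col c). Notation shape := (shape c).
Notation eqcp := (eqcp c).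

Lemma col_wins_lift n (x : wreath gT n) j g i :
  col (wins x j g) (lift ord_max i) = col x i.
Proof. by rewrite col_wproj // wproj_wins. Qed.

Lemma same_wins_lift n (x : wreath gT n) j g i i' :
  same (wins x j g) (lift ord_max i) (lift ord_max i') = same x i i'.
Proof. by rewrite same_wproj wproj_wins. Qed.

Lemma same_wins_max n (x : wreath gT n) g i :
  same (wins x ord_max g) ord_max i = (i == ord_max).
Proof.
apply/porbitP/eqP => [[m ->]|->]; last by exists 0; rewrite perm1.
by rewrite permX; elim: m => //= m ->; rewrite wperm_wins.
Qed.

Lemma col_wins_max n (x : wreath gT n) g : col (wins x ord_max g) ord_max = cls c g.
Proof.
rewrite -(fp_col hc (h := g)) // -{2}(wbase_wins x ord_max g) -[X in fp _ _ _ _ X]mulg1.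
by apply: fp_stop; rewrite wperm_wins.
Qed.

Lemma same_wins_next n (x : wreath gT n) j g : same (wins x j g) ord_max j.
Proof. by apply/porbitP; exists 1%N; rewrite expg1 wperm_wins. Qed.

Lemma same_wins_max_lift n (x : wreath gT n) j g i :
  same (wins x (lift ord_max j) g) ord_max (lift ord_max i) = same x j i.
Proof. by rewrite (same_trans _ (same_wins_next _ _ _)) same_wins_lift. Qed.

Lemma col_wins_max_lift n (x : wreath gT n) j g :
  col (wins x (lift ord_max j) g) ord_max = col x j.
Proof.
rewrite (same_col hc (i := lift ord_max j)) ?col_wins_lift //.
by rewrite same_sym same_wins_next.
Qed.

(** The new point is the largest, so it represents a cycle only when it is alone. *)
Lemma reps_wins n (x : wreath gT n) j g : reps (wins x j g) =
  map (lift ord_max) (reps x) ++ (if j == ord_max then [:: ord_max] else [::]).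
Proof.
rewrite /reps enum_ordSr -cats1 filter_cat /=; congr (_ ++ _).
  rewrite (eq_map (g := lift ord_max)); last first.
    by move=> i; apply: val_inj; rewrite /= /bump leqNgt ltn_ord.
  rewrite filter_map; congr (map _ _); apply: eq_filter => i /=.
  apply/forall_inP/forall_inP => H i' ii'.
    have := H (lift ord_max i'); rewrite [_ \in _]same_wins_lift => /(_ ii').
    by rewrite !val_lift_max.
  case: (ord_max_liftP i') ii' => [-> _|[i'' ->]].
    by rewrite -ltnS ltn_ord.
  by rewrite [_ \in _]same_wins_lift => /H; rewrite !val_lift_max.
have -> : is_rep (wins x j g) ord_max = (j == ord_max); last by case: eqP.
apply/forall_inP/eqP => [H|-> i].
  case: (ord_max_liftP j) => // -[i ej].
  have := H j; rewrite [_ \in _]same_wins_next => /(_ isT).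
  by rewrite ej val_lift_max leqNgt ltn_ord.
by rewrite [_ \in _]same_wins_max => /eqP ->.
Qed.

Lemma card_porbit_wins n (x : wreath gT n) j g i :
  #|porbit (wperm (wins x j g)) (lift ord_max i)| =
  (#|porbit (wperm x) i| + same (wins x j g) (lift ord_max i) ord_max)%N.
Proof.
rewrite -!sum1_card big_mkcond big_ord_recr /=; congr (_ + _)%N.
  rewrite [RHS]big_mkcond; apply: eq_bigr => i' _.
  rewrite (_ : widen_ord _ _ = lift ord_max i'); last first.
    by apply: val_inj; rewrite /= /bump leqNgt ltn_ord.
  by rewrite [_ \in _]same_wins_lift.
Qed.

Definition incr_lab n (x : wreath gT n) (i i' : 'I_n) :=
  let e := lab x i' in if same x i i' then (e.1, e.2.+1) else e.

Lemma shape_wins_max n (x : wreath gT n) g :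
  perm_eq (shape (wins x ord_max g)) ((cls c g, 1%N) :: shape x).
Proof.
rewrite /shape reps_wins eqxx map_cat /= perm_catC /= -map_comp.
have -> : lab (wins x ord_max g) ord_max = (cls c g, 1%N).
  rewrite /lab col_wins_max; congr (_, _).
  by rewrite -(card1 (ord_max : 'I_n.+1)); apply: eq_card => i; exact: same_wins_max.
rewrite perm_cons; apply/permEl.
rewrite (_ : map _ _ = map (lab x) (reps x)) //.
apply/eq_map => i; rewrite /= /lab col_wins_lift card_porbit_wins.
by rewrite same_sym same_wins_max lift_ord_max addn0.
Qed.

Lemma shape_wins_lift n (x : wreath gT n) j g :
  shape (wins x (lift ord_max j) g) = map (incr_lab x j) (reps x).
Proof.
rewrite /shape reps_wins lift_ord_max cats0 -map_comp; apply/eq_map => i.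
rewrite /= /incr_lab /lab col_wins_lift card_porbit_wins same_sym.
by rewrite same_wins_max_lift; case: same; rewrite ?addn1 ?addn0.
Qed.

Lemma eqcp_wproj n (x y : wreath gT n.+1) : eqcp x y -> eqcp (wproj x) (wproj y).
Proof.
case/eqcpP => ec es; apply/eqcpP; split=> [i|i j].
  by rewrite -!col_wproj.
by rewrite -!same_wproj.
Qed.

(** The new point adds only the information which cycle it joins, or its class if it is fixed. When
    it joins a cycle, its group component is irrelevant, because the colour is read off an old
    point. *)
Lemma eqcp_wins n (x y : wreath gT n) j g j' g' : eqcp x y ->
  eqcp (wins x j g) (wins y j' g') =
  if j == ord_max then (j' == ord_max) && (cls c g == cls c g')
  else same (wins x j g) ord_max j' && (j' != ord_max).
Proof.
move=> /eqcpP[ec es].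
case: (ord_max_liftP j) => [->|[i ->]]; case: (ord_max_liftP j') => [->|[i' ->]];
  rewrite ?eqxx ?lift_ord_max /= ?andbF ?andbT.
- apply/eqcpP/eqP => [[ec' _]|eg]; first by move: (ec' ord_max); rewrite !col_wins_max.
  split=> [l|l l'].
    by case: (ord_max_liftP l) => [->|[l' ->]]; rewrite ?col_wins_max ?col_wins_lift.
  case: (ord_max_liftP l) => [->|[m ->]]; case: (ord_max_liftP l') => [->|[m' ->]];
    rewrite ?same_wins_max ?same_wins_lift //.
  by rewrite same_sym same_wins_max same_sym same_wins_max.
- apply/eqcpP => -[_ /(_ ord_max (lift ord_max i'))].
  by rewrite same_wins_next same_wins_max lift_ord_max.
- apply/eqcpP => -[_ /(_ ord_max (lift ord_max i))].
  by rewrite same_wins_next same_wins_max lift_ord_max.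
- rewrite same_wins_max_lift; apply/eqcpP/idP => [[_ /(_ ord_max (lift ord_max i'))]|ii'].
    by rewrite same_wins_next same_wins_max_lift.
  split=> [l|l l'].
    case: (ord_max_liftP l) => [->|[l' ->]]; rewrite ?col_wins_lift //.
    by rewrite !col_wins_max_lift -ec (same_col hc ii').
  have ii'y : same y i i' by rewrite -es.
  case: (ord_max_liftP l) => [->|[m ->]]; case: (ord_max_liftP l') => [->|[m' ->]];
    rewrite ?same_refl ?same_wins_lift //.
    by rewrite !same_wins_max_lift es (same_trans _ ii'y).
  by rewrite same_sym [RHS]same_sym !same_wins_max_lift es (same_trans _ ii'y).
Qed.

End InsertionShape.

(** * Elements with the same coloured partition are conjugate *)

Section BlockConjugation.
Local Open Scope group_scope.
Variables (gT : finGroupType) (k : nat) (c : 'I_k.+1 -> {set gT}).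
Hypothesis hc : enumerates_classes c.
Notation eqcp := (eqcp c).

Lemma eqcp_sym n (x y : wreath gT n) : eqcp x y -> eqcp y x.
Proof. by case/eqcpP => ec es; apply/eqcpP; split=> *; rewrite ?ec ?es. Qed.

Lemma eqcp_trans n (x y z : wreath gT n) : eqcp x y -> eqcp y z -> eqcp x z.
Proof.
case/eqcpP => ec es /eqcpP[ec' es'].
by apply/eqcpP; split=> *; rewrite ?ec ?es ?ec' ?es'.
Qed.

Lemma eqcp_block_conj n (u x : wreath gT n) :
  (forall i, same x i (wperm u i)) -> eqcp x (u * x * u^-1).
Proof.
move=> ux; apply/eqcpP; split=> [i|i j].
  rewrite -[i](permKV (wperm u)) col_conj //.
  by rewrite (same_col hc (ux _)).
rewrite -[i](permKV (wperm u)) -[j](permKV (wperm u)) same_conj.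
set i' := _ i; set j' := _ j.
by rewrite -(same_trans _ (ux i')) same_sym -(same_trans _ (ux j')) same_sym.
Qed.

Lemma wpermX n (x : wreath gT n) m : wperm (x ^+ m) = wperm x ^+ m.
Proof. by elim: m => //= m IHm; rewrite expgS expgSr -IHm. Qed.

Definition top_base n (t : gT) : wreath gT n.+1 :=
  Wreath [ffun i => if i == ord_max then t else 1] 1.

Lemma top_base_conj n t (x : wreath gT n.+1) :
  let y := top_base n t * x * (top_base n t)^-1 in
  [/\ wproj y = wproj x, wperm y = wperm x &
   wbase y ord_max = t * wbase x ord_max *
     (if wperm x ord_max == ord_max then t^-1 else 1)].
Proof.
move=> y; have yx : y * top_base n t = top_base n t * x by rewrite mulgKV.
have sy : wperm y = wperm x.
  by move/(congr1 (@wperm _ _)): yx; rewrite /= mul1g mulg1.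
have wy i : wbase y i * (if (wperm x)^-1 i == ord_max then t else 1) =
    (if i == ord_max then t else 1) * wbase x i.
  move/(congr1 (fun z => wbase z i)): yx.
  by rewrite !wbaseM sy [wbase (top_base n t) _]ffunE [wbase (top_base n t) _]ffunE invg1 perm1.
have sV i : ((wperm x)^-1 i == ord_max) = (wperm x ord_max == i).
  by rewrite -(inj_eq (@perm_inj _ (wperm x))) permKV eq_sym.
split=> //.
  apply: wreath_eqP => i; last by apply: (@lift_inj _ ord_max); rewrite !lift_wproj sy.
  rewrite !wbase_wproj sy; have := wy (lift ord_max i).
  rewrite sV lift_ord_max mul1g; case: eqP => [e|_]; last by rewrite mulg1.
  have := wy ord_max; rewrite sV e lift_ord_max eqxx mulg1 => -> <-.
  by rewrite mulgA.
by have := wy ord_max; rewrite sV eqxx; case: ifP => _ <-; rewrite ?mulgK ?mulg1.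
Qed.

(** By induction a conjugation identifies the projections, and by [wproj_inj] only the new point
    remains to be matched. If it is fixed, a conjugation of its group component suffices. Otherwise
    it is first rotated along its cycle to the right position, and then its component is corrected;
    both operations leave the projection alone. *)
Lemma eqcp_conj n (x y : wreath gT n) : eqcp x y ->
  exists2 u, y = u * x * u^-1 & forall i, same x i (wperm u i).
Proof.
elim: n x y => [|n IHn] x y exy.
  by exists 1; [apply: wreath_eqP => -[] | case].
have [u0 ey0 u0P] := IHn _ _ (eqcp_wproj hc exy).
pose U := wemb (leqnSn n) u0.
have UP i : same x i (wperm U i).
  case: (ord_max_liftP i) => [->|[j ->]].
    by rewrite wemb1_perm_max same_refl.
  by rewrite wemb1_perm_lift same_wproj.
pose x1 := U * x * U^-1.
have px1 : wproj x1 = wproj y by rewrite /x1 -wemb1V wprojMr wprojMl ey0.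
have ex1 : eqcp x x1 := eqcp_block_conj UP.
suff [v ey vP] : exists2 v, y = v * x1 * v^-1 & forall i, same x1 i (wperm v i).
  exists (v * U) => [|i]; first by rewrite ey /x1 invMg !mulgA.
  rewrite wpermM (same_trans _ (UP i)); case/eqcpP: ex1 => _ ->.
  exact: vP.
have {ex1 exy} : eqcp x1 y by exact: eqcp_trans (eqcp_sym ex1) exy.
move: x1 px1 => {UP} x1 px1 e1.
have := e1; rewrite -{1}(wins_wproj x1) -{1}(wins_wproj y) eqcp_wins //; last first.
  exact: eqcp_wproj.
rewrite wins_wproj; case: ifP => [/eqP mx1 /andP[/eqP my /eqP]|mx1 /andP[bs my]].
  case/cls_conj => // t et; exists (top_base n t^-1) => [|i]; last first.
    by rewrite /= perm1 same_refl.
  have [py sy wy] := top_base_conj t^-1 x1.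
  apply: wproj_inj; rewrite ?py ?sy ?wy ?mx1 ?eqxx //.
  by rewrite et conjgE invgK mulgA.
case: (ord_max_liftP (wperm x1 ord_max)) mx1 => [->|[a ea _]]; first by rewrite eqxx.
case: (ord_max_liftP (wperm y ord_max)) my bs => [->|[b eb _]]; first by rewrite eqxx.
rewrite eb => bs.
have {bs} : same (wproj y) a b.
  rewrite -px1 -same_wproj -(same_trans _ (_ : same x1 ord_max _)) //.
  by apply/porbitP; exists 1%N; rewrite expg1.
case/porbitP => m em.
(* A power of the projection commutes with it, so conjugation by [Z] keeps the projection and
   carries the image of the new point from [a] to [b]. *)
pose Z := wemb (leqnSn n) (wproj y ^+ m).
pose x2 := Z * x1 * Z^-1.
have px2 : wproj x2 = wproj y.
  rewrite /x2 -wemb1V wprojMr wprojMl px1.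
  by rewrite -(commuteX m (commute_refl (wproj y))) mulgK.
have mx2 : wperm x2 ord_max = lift ord_max b.
  rewrite /x2 -{1}(wemb1_perm_max (wproj y ^+ m)) -wpermM -mulgA -/Z mulVg mulg1.
  by rewrite wpermM ea wemb1_perm_lift wpermX em.
(* The new point is not fixed by [x2], so conjugation by [top_base n t] multiplies its component by
   [t] on the left. *)
pose t := wbase y ord_max * (wbase x2 ord_max)^-1.
exists (top_base n t * Z) => [|i].
  set v := top_base n t.
  have -> : v * Z * x1 * (v * Z)^-1 = v * x2 * v^-1 by rewrite invMg /x2 !mulgA.
  have [py sy wy] := top_base_conj t x2.
  apply: wproj_inj; rewrite ?py ?sy ?wy ?mx2 ?eb ?lift_ord_max //.
  by rewrite mulg1 mulgKV.
rewrite wpermM /= perm1; case: (ord_max_liftP i) => [->|[j ->]].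
  by rewrite wemb1_perm_max same_refl.
by rewrite wemb1_perm_lift same_wproj px1 wpermX /same mem_porbit.
Qed.

End BlockConjugation.

(** * Counting elements with a given coloured partition, and the coherence identity *)

Section Weights.
Local Open Scope ring_scope.
Variables (gT : finGroupType) (k : nat) (c : 'I_k.+1 -> {set gT}).
Hypothesis hc : enumerates_classes c.
Notation lab := (lab c). Notation shape := (shape c). Notation eqcp := (eqcp c).
Implicit Types (e : 'I_k.+1 * nat) (s : seq ('I_k.+1 * nat)).

(* The number of elements of the wreath product supported on an e.2-cycle of
   type e.1. *)
Definition cyc_weight e : nat := (e.2.-1`! * #|gT| ^ e.2.-1 * #|c e.1|)%N.
Definition weight s : nat := (\prod_(e <- s) cyc_weight e)%N.

Lemma cardgT_gt0 : (0 < #|gT|)%N.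
Proof. by rewrite -cardsT cardG_gt0. Qed.

Lemma weight_gt0 s : (0 < weight s)%N.
Proof.
apply: prodn_gt0 => e; rewrite !muln_gt0 fact_gt0 expn_gt0 cardgT_gt0.
by rewrite (card_c_gt0 hc).
Qed.

Lemma perm_weight s t : perm_eq s t -> weight s = weight t.
Proof. by move=> st; rewrite /weight (perm_big t). Qed.

Lemma weight_wins_max n (x : wreath gT n) g :
  weight (shape (wins x ord_max g)) = (#|c (cls c g)| * weight (shape x))%N.
Proof.
rewrite (perm_weight (shape_wins_max hc x g)) /weight big_cons.
by rewrite /cyc_weight /= fact0 expn0 !mul1n.
Qed.

Lemma cyc_weightS l r : r != 0%N ->
  cyc_weight (l, r.+1) = (r * #|gT| * cyc_weight (l, r))%N.
Proof.
case: r => // r _; rewrite /cyc_weight /= factS expnS; ring.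
Qed.

Lemma weight_wins_lift n (x : wreath gT n) j g :
  weight (shape (wins x (lift ord_max j) g)) =
  (#|porbit (wperm x) j| * #|gT| * weight (shape x))%N.
Proof.
rewrite shape_wins_lift // /weight /shape !big_map.
have [i ir ji] := rep_ex x j.
rewrite (bigD1_seq i) ?reps_uniq //= [in RHS](bigD1_seq i) ?reps_uniq //= mulnA.
congr (_ * _)%N.
  rewrite /incr_lab ji [lab x i](same_lab hc ji) /= cyc_weightS //.
  exact: card_porbit_neq0.
rewrite big_seq_cond [RHS]big_seq_cond; apply: eq_bigr => i' /andP[ir' ne].
rewrite /incr_lab; case: ifP => // ji'; case/eqP: ne.
by apply: (reps_inj ir' ir); rewrite same_sym -(same_trans _ ji) // same_sym.
Qed.

Lemma card_same n (x : wreath gT n) j : #|[pred i | same x j i]| = #|porbit (wperm x) j|.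
Proof. by apply: eq_card. Qed.

Lemma sum_wreathS_nat n (F : wreath gT n.+1 -> nat) :
  (\sum_y F y = \sum_x \sum_j \sum_g F (wins x j g))%N.
Proof. exact: sum_wreathS. Qed.

(** By [eqcp_wins] the new point is either fixed with a component in the prescribed class, or
    inserted before any point of the prescribed cycle with an arbitrary component. The weight grows
    by the same factors. *)
Lemma card_eqcp n (x : wreath gT n) : #|[pred y | eqcp x y]| = weight (shape x).
Proof.
elim: n x => [|n IHn] x.
  rewrite /weight /shape; case: (reps x) => [|[] //]; rewrite big_nil.
  rewrite -(card1 x); apply: eq_card => y; rewrite !inE.
  have -> : y = x by apply: wreath_eqP => -[].
  by rewrite eqxx; apply/eqcpP.
rewrite -(wins_wproj x); move: (wproj x) (wperm x ord_max) (wbase x ord_max) => x0 j g.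
rewrite -sum1_card big_mkcond /= sum_wreathS_nat.
transitivity (\sum_(y | eqcp x0 y) \sum_j' \sum_g'
    (eqcp (wins x0 j g) (wins y j' g') : nat))%N.
  rewrite [RHS]big_mkcond; apply: eq_bigr => y _; case: ifP => [_|/negP ny].
    by apply: eq_bigr => j' _; apply: eq_bigr => g' _; rewrite inE; case: (eqcp _ _).
  rewrite big1 // => j' _; rewrite big1 // => g' _; rewrite inE.
  case: ifP => // /(eqcp_wproj hc); by rewrite !wproj_wins => /ny.
under eq_bigr => y xy do under eq_bigr => j' _ do under eq_bigr => g' _ do
  rewrite eqcp_wins //.
rewrite sum_nat_const IHn mulnC.
case: (ord_max_liftP j) => [->|[i ->]].
  rewrite weight_wins_max; congr (_ * _)%N; rewrite eqxx.
  rewrite (bigD1 ord_max) //= [X in (_ + X)%N]big1 => [|j' /negbTE ->]; last first.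
    by rewrite big1.
  rewrite eqxx addn0 (card_c hc) -sum1_card [RHS]big_mkcond.
  by apply: eq_bigr => g' _; rewrite inE eq_sym; case: eqP.
rewrite weight_wins_lift; congr (_ * _)%N; rewrite lift_ord_max big_ord_recr /=.
rewrite [X in (_ + X)%N]big1 ?addn0 => [|g' _]; last by rewrite eqxx andbF.
rewrite -card_same -sum1_card big_distrl [RHS]big_mkcond; apply: eq_bigr => i' _.
rewrite sum_nat_const (_ : widen_ord _ _ = lift ord_max i'); last first.
  by apply: val_inj; rewrite /= /bump leqNgt ltn_ord.
rewrite same_wins_max_lift lift_ord_max andbT inE.
by case: same; rewrite ?muln0 //= muln1 mul1n; apply: eq_card.
Qed.

Variables (R : numFieldType) (S : comNzRingType) (kappa : {rmorphism R -> S}).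
Variable p : 'I_k.+1 -> nat -> S.

(** [kappa] lets the same identity serve in a polynomial ring, for the class sizes, and over the
    reals, for the coherence of the measures. *)
Definition wt s : S := kappa (weight s)%:R^-1 * augm p s.

Lemma kappa_natV (m : nat) (x : S) : (0 < m)%N ->
  kappa (m%:R^-1) * x *+ m = x.
Proof.
move=> m0; rewrite -mulrnAl -rmorphMn -[_ *+ m]mulr_natl mulfV ?rmorph1 ?mul1r //.
by rewrite pnatr_eq0 -lt0n.
Qed.

(** A part of length 1 is absorbed by lengthening one part by 1. Uniqueness of [r] makes each index
    stand for one position. *)
Lemma sum_merges1 (I : eqType) (r : seq I) (f : I -> 'I_k.+1 * nat)
    (g : seq ('I_k.+1 * nat) -> S) : uniq r ->
  \sum_l \sum_(t <- merges (l, 1%N) (map f r)) g t =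
  \sum_(i <- r) g [seq if i' == i then ((f i').1, (f i').2.+1) else f i' | i' <- r].
Proof.
elim: r g => [|i r IHr] g /=; first by rewrite [RHS]big_nil big1 // => l _; rewrite big_nil.
case/andP => ir ur.
under eq_bigr do rewrite big_cat big_map /=.
rewrite big_split /= (IHr (fun t => g (f i :: t))) // big_cons eqxx; congr (_ + _).
  rewrite (bigD1 (f i).1) //= eqxx big_seq1 big1 ?addr0 => [|l ne]; last first.
    by rewrite eq_sym (negbTE ne) big_nil.
  rewrite addn1; congr (g (_ :: _)); apply/eq_in_map => i' i'r.
  by case: eqP => // e; rewrite -e i'r in ir.
apply: eq_big_seq => i' i'r; case: eqP => // e.
by rewrite e i'r in ir.
Qed.

(** This is the recursion of [augm] for a part of length 1: insertions as a fixed point give the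
    terms with a new part, insertions into a cycle give the merges. The growth of [weight] cancels
    the number of insertions of each kind. *)
Lemma sum_wt_wins n (x : wreath gT n) :
  \sum_j \sum_g wt (shape (wins x j g)) = (\sum_l p l 1%N) * wt (shape x).
Proof.
have -> : (\sum_l p l 1%N) * wt (shape x) = kappa (weight (shape x))%:R^-1 *
    (\sum_l augm p ((l, 1%N) :: shape x) +
     \sum_l \sum_(t <- merges (l, 1%N) (shape x)) augm p t).
  rewrite /wt mulrCA; congr (_ * _); rewrite mulr_suml -big_split /=.
  by apply: eq_bigr => l _; rewrite augm_cons subrK.
rewrite big_ord_recr /= addrC mulrDr; congr (_ + _).
  rewrite (partition_big (cls c) xpredT) //= mulr_sumr; apply: eq_bigr => l _.
  transitivity (\sum_(g | cls c g == l) kappa (#|c l|%:R^-1) *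
      (kappa (weight (shape x))%:R^-1 * augm p ((l, 1%N) :: shape x))).
    apply: eq_bigr => g /eqP gl; rewrite mulrA /wt weight_wins_max natrM invfM rmorphM gl.
    by rewrite (augm_perm _ (shape_wins_max hc x g)) gl.
  rewrite sumr_const (_ : #|_| = #|c l|); first exact/kappa_natV/(card_c_gt0 hc).
  by rewrite (card_c hc).
rewrite (sum_merges1 _ _ (reps_uniq x)) mulr_sumr (sum_same x).
rewrite big_seq [RHS]big_seq; apply: eq_bigr => i ir.
transitivity (\sum_(j | same x i j) kappa ((#|porbit (wperm x) i| * #|gT|)%:R^-1) *
   (kappa (weight (shape x))%:R^-1 * augm p [seq if i' == i then
     ((lab x i').1, (lab x i').2.+1) else lab x i' | i' <- reps x]) *+ #|gT|).
  apply: eq_bigr => j ij; rewrite -sumr_const; apply: eq_bigr => g _.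
  rewrite (_ : widen_ord _ _ = lift ord_max j); last first.
    by apply: val_inj; rewrite /= /bump leqNgt ltn_ord.
  rewrite /wt weight_wins_lift natrM invfM rmorphM mulrA (same_porbit ij).
  congr (_ * augm p _); rewrite shape_wins_lift //; apply/eq_in_map => i' i'r.
  rewrite /incr_lab; case: eqP => [->|ne]; first by rewrite same_sym ij.
  case: ifP => // ji'; case: ne; apply: (reps_inj i'r ir).
  by rewrite same_sym (same_trans _ ij).
rewrite sumr_const -mulrnA mulnC -/(same x i) card_same kappa_natV //.
by rewrite muln_gt0 cardgT_gt0 lt0n card_porbit_neq0.
Qed.

Lemma sum_wt n : \sum_(x : wreath gT n) wt (shape x) = (\sum_l p l 1%N) ^+ n.
Proof.
elim: n => [|n IHn].
  rewrite (bigD1 (1%g : wreath gT 0)) //= big1 ?addr0 => [|x]; last first.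
    by case/eqP; apply: wreath_eqP => -[].
  rewrite /wt /weight /shape; case: (reps _) => [|[] //]; rewrite big_nil.
  by rewrite invr1 rmorph1 mul1r augm_nil.
rewrite sum_wreathS exprS -IHn mulr_sumr; apply: eq_bigr => x _.
exact: sum_wt_wins.
Qed.

End Weights.

(** * Multinomial coefficients *)

Section MultinomialCoefficient.
Local Open Scope ring_scope.

(** The multinomial theorem without denominators. Removing one factor lowers the exponent of some
    [v], which costs [m v], and these exponents add up to the degree. *)
Lemma mcoeff_sumX (R : comNzRingType) M n (m : multinom M) :
  (\prod_v (m v)`!)%:R * mcoeff m ((\sum_v mpolyX R (mnm1 v)) ^+ n) =
  if mdeg m == n then n`!%:R else 0.
Proof.
elim: n m => [|n IHn] m.
  rewrite expr0 mcoeff1 mdeg_eq0; case: eqP => [->|_]; rewrite ?mulr0 // mulr1.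
  by rewrite big1 // => v _; rewrite mnm0E.
rewrite exprS mulr_suml raddf_sum mulr_sumr /=.
transitivity (\sum_v (m v)%:R * (if mdeg m == n.+1 then n`!%:R else 0 : R)).
  apply: eq_bigr => v _; rewrite -[mpolyX R _]expr1 mcoeffXUM.
  have [m0|m1] := posnP (m v); first by rewrite m0 mulr0 mul0r.
  set m' := mnm_sub m _.
  have m'v : m' v = (m v).-1 by rewrite mnmBE mulmnE mnm1E eqxx mul1n subn1.
  have m'w w : w != v -> m' w = m w.
    by move=> wv; rewrite mnmBE mulmnE mnm1E eq_sym (negbTE wv) mul0n subn0.
  have dm : (mdeg m = (mdeg m').+1)%N.
    rewrite !mdegE (bigD1 v) //= [in RHS](bigD1 v) //= m'v -addSn prednK //.
    by congr (_ + _)%N; apply: eq_bigr => w wv; rewrite m'w.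
  have -> : (\prod_w (m w)`! = m v * \prod_w (m' w)`!)%N.
    rewrite (bigD1 v) //= [in RHS](bigD1 v) //= m'v mulnA; congr (_ * _)%N.
      by case: (m v) m1.
    by apply: eq_bigr => w wv; rewrite m'w.
  by rewrite natrM -mulrA IHn dm eqSS.
rewrite -mulr_suml -natr_sum -mdegE; case: eqP => [->|_]; last by rewrite mulr0.
by rewrite -natrM factS.
Qed.

End MultinomialCoefficient.

(** * The size of a conjugacy class *)

Section ClassSize.
Local Open Scope ring_scope.
Variables (gT : finGroupType) (k : nat) (c : 'I_k.+1 -> {set gT}).
Hypothesis hc : enumerates_classes c.
Notation shape := (shape c).

Definition parts (La : 'I_k.+1 -> seq nat) : seq ('I_k.+1 * nat) :=
  flatten [seq [seq (l, r) | r <- La l] | l <- enum 'I_k.+1].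

Lemma big_parts (S : Type) (idx : S) (op : Monoid.com_law idx) La
    (F : 'I_k.+1 * nat -> S) :
  \big[op/idx]_(e <- parts La) F e = \big[op/idx]_l \big[op/idx]_(r <- La l) F (l, r).
Proof.
by rewrite big_flatten big_map big_enum /=; apply: eq_bigr => l _; rewrite big_map.
Qed.

Lemma count_parts La l r : count_mem (l, r) (parts La) = count_mem r (La l).
Proof.
rewrite -sum1_count big_mkcond big_parts (bigD1 l) //= [X in (_ + X)%N]big1.
  rewrite addn0 -sum1_count [RHS]big_mkcond; apply: eq_bigr => r' _.
  by rewrite xpair_eqE eqxx.
by move=> l' ne; rewrite big1 // => r' _; rewrite xpair_eqE (negbTE ne).
Qed.

Lemma Kclass_shape n La (x : wreath gT n) :
  (x \in Kclass c n La) = perm_eq (shape x) (parts La).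
Proof.
rewrite inE; apply/asboolP/idP => [H|H l j].
  by apply/allP => -[l r] _ /=; rewrite count_parts -num_cycles_shape // H.
by rewrite num_cycles_shape // (seq.permP H) count_parts.
Qed.

Lemma parts_neq0 n (La : 'I_k.+1 -> seq nat) : is_multipartition n La -> all (fun e => e.2 != 0%N) (parts La).
Proof.
case/andP => /forallP H _; apply/allP => e /flattenP[_ /mapP[l _ ->]].
case/mapP => r rl -> /=; have /andP[_] := H l.
by apply: contraNneq => r0; rewrite -r0.
Qed.

Lemma la_neq0 n (La : 'I_k.+1 -> seq nat) l : is_multipartition n La -> all (fun r => r != 0%N) (La l).
Proof.
case/andP => /forallP/(_ l)/andP[_ H] _; apply/allP => r rl.
by apply: contraNneq H => r0; rewrite -r0.
Qed.

Lemma sumn_parts n (La : 'I_k.+1 -> seq nat) : is_multipartition n La -> sumn (map snd (parts La)) = n.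
Proof.
case/andP => _ /eqP <-; rewrite sumnE big_map big_parts.
by apply: eq_bigr => l _; rewrite sumnE.
Qed.

(** Compares the coefficients of one monomial in [sum_wt]. On the left each [x] of shape [s]
    contributes [mults s] over [weight c s] by [mcoeff_injsum], and any other [x] contributes 0; on
    the right stands the multinomial coefficient. *)
Lemma card_shape (s : seq ('I_k.+1 * nat)) n : all (fun e => e.2 != 0%N) s ->
  sumn (map snd s) = n ->
  (#|[pred x : wreath gT n | perm_eq (shape x) s]| * mults s *
    \prod_(e <- s) e.2`! = n`! * weight c s)%N.
Proof.
move=> s0 sn.
(* One variable for each entry of [s], with the colour of the entry; the monomial [m] has the parts
   as exponents. *)
pose M := size s; pose tn := tnth (in_tuple s).
pose cl (v : 'I_M) := (tn v).1; pose m : multinom M := Multinom [tuple (tn v).2 | v < M].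
pose p (l : 'I_k.+1) r := \sum_v var_power rat cl (l, r) v.
have mE v : m v = (tn v).2 by rewrite mnmE.
have sE : s = map tn (enum 'I_M) by rewrite map_tnth_enum.
have dm : mdeg m = n.
  rewrite mdegE -sn sumnE big_map sE big_map enumT.
  by apply: eq_bigr => v _; rewrite mE.
have labE : labels cl m finset.set0 = s.
  rewrite /labels [RHS]sE; have -> : [seq v <- enum 'I_M |
      (v \notin finset.set0) && (m v != 0%N)] = enum 'I_M.
    apply/all_filterP/allP => v _; rewrite /= finset.in_set0 mE /=.
    by apply: (allP s0); rewrite mem_tnth.
  by apply: eq_map => v; rewrite mE -surjective_pairing.
have psum : \sum_l p l 1%N = \sum_v mpolyX rat (mnm1 v).
  rewrite exchange_big /=; apply: eq_bigr => v _; rewrite (bigD1 (cl v)) //=.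
  rewrite big1 => [|l ne]; last by rewrite /var_power /= eq_sym (negbTE ne).
  by rewrite /var_power /= eqxx addr0 expr1.
have fm : (\prod_(e <- s) e.2`! = \prod_v (m v)`!)%N.
  by rewrite sE big_map enumT; apply: eq_bigr => v _; rewrite mE.
have := sum_wt hc (@mpolyC M rat : {rmorphism rat -> mpoly M rat}) p n.
move/(congr1 (fun q => (\prod_v (m v)`!)%:R * mcoeff m q)).
rewrite psum mcoeff_sumX dm eqxx raddf_sum /=.
have -> : \sum_(x : wreath gT n) mcoeff m (wt c (@mpolyC M rat) p (shape x)) =
    (#|[pred x : wreath gT n | perm_eq (shape x) s]| * mults s)%:R / (weight c s)%:R.
  rewrite -sum1_card big_distrl /= natr_sum mulr_suml [RHS]big_mkcond /=.
  apply: eq_bigr => x _; rewrite /wt mcoeffCM augm_injsum; last exact: var_powerM.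
  rewrite mcoeff_injsum ?shape_gt0 // labE inE [perm_eq (shape x) s]perm_sym.
  have -> : [forall v in (finset.set0 : {set 'I_M}), m v == 0%N].
    by apply/forall_inP => v; rewrite finset.in_set0.
  rewrite /=; case: ifP => [ps|_]; last by rewrite mulr0.
  by rewrite mul1n mulrC (perm_mults ps) (perm_weight c ps).
rewrite mulrA => /(canRL (divfK _)); rewrite pnatr_eq0 -lt0n weight_gt0 // => /(_ isT).
move=> H; apply/eqP; rewrite -(eqr_nat rat) fm mulnC !natrM; apply/eqP.
by rewrite -natrM H.
Qed.

Lemma card_Kclass n La : is_multipartition n La ->
  (#|Kclass c n La| * mults (parts La) * \prod_(e <- parts La) e.2`! =
   n`! * weight c (parts La))%N.
Proof.
move=> LaP; rewrite -(card_shape (parts_neq0 LaP) (sumn_parts LaP)).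
by congr (_ * _ * _)%N; apply: eq_card => x; rewrite Kclass_shape inE.
Qed.

Lemma mults_parts La : mults (parts La) = (\prod_l mults (La l))%N.
Proof.
rewrite /parts; transitivity (\prod_(l <- enum 'I_k.+1) mults (La l))%N; last first.
  by rewrite big_enum.
elim: (enum 'I_k.+1) (enum_uniq 'I_k.+1) => [|l ls IHls] /=.
  by rewrite /mults !big_nil.
case/andP => lls uls; rewrite big_cons -IHls //; set t := flatten _.
have tl r : (l, r) \notin t.
  apply/flattenP => -[_ /mapP[l' l'ls ->]] /mapP[r' _ [e _]].
  by rewrite e l'ls in lls.
elim: (La l) => [|r rs IHrs] /=.
  by rewrite [mults [::]]/mults big_nil mul1n.
rewrite !mults_cons IHrs mulnA; congr (_.+1 * _ * _)%N.
rewrite count_cat count_map (count_memPn (tl r)) addn0.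
by apply: eq_count => r' /=; rewrite xpair_eqE eqxx.
Qed.

End ClassSize.

(** * Factorisation over the colours *)

Section Recolouring.
Local Open Scope ring_scope.
Variables (L L' : eqType) (f : L -> L') (S : comNzRingType) (p : L' -> nat -> S).
Hypothesis f_inj : injective f.
Let rc (e : L * nat) := (f e.1, e.2).

Lemma merges_recolour a s : merges (rc a) (map rc s) = map (map rc) (merges a s).
Proof.
elim: s => //= b s ->; rewrite map_cat -!map_comp (inj_eq f_inj).
by congr (_ ++ _); case: ifP.
Qed.

Lemma augm_recolour s : augm p (map rc s) = augm (p \o f) s.
Proof.
have [n] := ubnP (size s); elim: n s => // n IHn [|a s] //= sn.
rewrite !augm_cons /= IHn // merges_recolour big_map; congr (_ - _).
by apply: eq_big_seq => t /size_merges st; apply: IHn; rewrite st.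
Qed.

End Recolouring.

Section AugmParts.
Local Open Scope ring_scope.
Variables (k : nat) (S : comNzRingType) (p : 'I_k.+1 -> nat -> S).

Lemma augm_parts La : augm p (parts La) = \prod_l augm (fun _ => p l) (mono (La l)).
Proof.
rewrite /parts; transitivity
  (\prod_(l <- enum 'I_k.+1) augm (fun _ => p l) (mono (La l))); last first.
  by rewrite big_enum.
elim: (enum 'I_k.+1) (enum_uniq 'I_k.+1) => [|l ls IHls] /=.
  by rewrite big_nil.
case/andP => lls uls; rewrite big_cons -IHls // augm_cat.
  congr (_ * _); rewrite -(augm_recolour (f := fun _ : unit => l)); last by case=> -[].
  by rewrite /mono -map_comp.
apply/allP => e /flattenP[_ /mapP[l' l'ls ->]] /mapP[r' _ ->] /=.
by apply/mapP => -[_ /mapP[r _ ->]] /= e'; rewrite -e' l'ls in lls.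
Qed.

End AugmParts.

(** * The kernel in terms of augmented monomials *)

Section KernelValue.
Local Open Scope ring_scope.
Variables (R : realType) (gT : finGroupType) (k : nat) (c : 'I_k.+1 -> {set gT}).
Hypothesis hc : enumerates_classes c.

Definition pnabla (w : nabla R k.+1) (l : 'I_k.+1) (r : nat) : R :=
  psum (nabla_x w l) (nabla_delta w l) r.

Lemma nablaP (w : nabla R k.+1) : nabla_set (set_val w).
Proof. exact: set_mem (valP w). Qed.

Lemma nabla_x_ge0 (w : nabla R k.+1) l i : 0 <= nabla_x w l i :> R.
Proof. by have [_ + _ _ _] := nablaP w; apply. Qed.

Lemma nabla_x_le (w : nabla R k.+1) l N : \sum_(i < N) nabla_x w l i <= nabla_delta w l :> R.
Proof.
have [_ _ _ /(_ l) + _] := nablaP w; rewrite -lee_fin; apply: le_trans.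
rewrite -sumEFin -(big_mkord xpredT (fun i => (nabla_x w l i)%:E)).
by apply: nneseries_lim_ge => i _ _; rewrite lee_fin nabla_x_ge0.
Qed.

Lemma Kkernel_augm n (La : 'I_k.+1 -> seq nat) (w : nabla R k.+1) : is_multipartition n La ->
  Kkernel La w = n`!%:R / (\prod_(e <- parts La) e.2`!)%:R / (mults (parts La))%:R *
    augm (pnabla w) (parts La).
Proof.
move=> LaP; rewrite /Kkernel; case/andP: (LaP) => _ /eqP ->.
rewrite big_parts -!mulrA; congr (_ * (_ * _)).
rewrite augm_parts mults_parts natr_prod.
rewrite -prodfV -big_split /=; apply: eq_bigr => l _.
rewrite -extended_monomial_augm ?(la_neq0 l LaP) //.
- by rewrite mulKf // pnatr_eq0 -lt0n mults_gt0.
- by move=> i; exact: nabla_x_ge0.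
- by move=> N; exact: nabla_x_le.
Qed.

(** The factorials and multiplicities in the class size are those of the kernel, so that only
    [weight] survives in the quotient. *)
Lemma Kkernel_Kclass n (La : 'I_k.+1 -> seq nat) (w : nabla R k.+1) : is_multipartition n La ->
  (#|Kclass c n La|%:R)^-1 * Kkernel La w =
  (weight c (parts La))%:R^-1 * augm (pnabla w) (parts La).
Proof.
move=> LaP; rewrite (Kkernel_augm w LaP) mulrA; congr (_ * _).
have := card_Kclass hc LaP.
move/(congr1 (fun m : nat => m%:R : R)); rewrite !natrM => E.
have w0 : (weight c (parts La))%:R != 0 :> R by rewrite pnatr_eq0 -lt0n weight_gt0.
have n0 : n`!%:R != 0 :> R by rewrite pnatr_eq0 -lt0n fact_gt0.
have m0 : (mults (parts La))%:R != 0 :> R by rewrite pnatr_eq0 -lt0n mults_gt0.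
have f0 : (\prod_(e <- parts La) e.2`!)%:R != 0 :> R.
  by rewrite pnatr_eq0 -lt0n prodn_gt0 // => e; exact: fact_gt0.
have K0 : #|Kclass c n La|%:R != 0 :> R.
  apply: contra_eq_neq E => ->; rewrite !mul0r eq_sym mulf_neq0 //.
have alg (K1 m1 f1 n1 w1 : R) : w1 != 0 -> m1 != 0 -> f1 != 0 -> K1 != 0 ->
    K1 * m1 * f1 = n1 * w1 -> K1^-1 * (n1 / f1 / m1) = w1^-1.
  move=> w10 m10 f10 K10 e; have -> : n1 = K1 * m1 * f1 / w1 by rewrite e mulfK.
  by field; rewrite m10 f10 K10 w10.
exact: alg.
Qed.

Lemma augm_pnabla_ge0 n (La : 'I_k.+1 -> seq nat) (w : nabla R k.+1) : is_multipartition n La ->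
  0 <= augm (pnabla w) (parts La).
Proof.
move=> LaP; rewrite augm_parts; apply: prodr_ge0 => l _.
rewrite -extended_monomial_augm ?(la_neq0 l LaP) //.
- rewrite mulr_ge0 // extended_monomial_ge0 ?(la_neq0 l LaP) //.
  + by move=> i; exact: nabla_x_ge0.
  + by move=> N; exact: nabla_x_le.
- by move=> i; exact: nabla_x_ge0.
- by move=> N; exact: nabla_x_le.
Qed.

End KernelValue.

(** * Power sums as continuous functions on [nabla] *)

Section NablaTopology.
Local Open Scope ring_scope.
Local Open Scope classical_set_scope.
Variables (R : realType) (k : nat).
Notation nab := (nabla R k.+1).
Implicit Types (w : nab) (l : 'I_k.+1).

Lemma nabla_x_nincr w l i j : (i <= j)%N -> nabla_x w l j <= nabla_x w l i.
Proof.
have [+ _ _ _ _] := nablaP w => /(_ l) dec.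
elim: j => [|j IHj]; first by rewrite leqn0 => /eqP ->.
by rewrite leq_eqVlt => /orP[/eqP -> //|/IHj]; apply: le_trans; exact: dec.
Qed.

Lemma nabla_delta_ge0 w l : 0 <= nabla_delta w l.
Proof. by have [_ _ + _ _] := nablaP w; apply. Qed.

Lemma sum_nabla_delta w : \sum_l nabla_delta w l = 1.
Proof. by have [_ _ _ _] := nablaP w. Qed.

Lemma nabla_delta_le1 w l : nabla_delta w l <= 1.
Proof.
rewrite -(sum_nabla_delta w) (bigD1 l) //= lerDl.
by apply: sumr_ge0 => l' _; exact: nabla_delta_ge0.
Qed.

Lemma sum_nabla_x_le1 w l N : \sum_(i < N) nabla_x w l i <= 1.
Proof. exact: le_trans (nabla_x_le w l N) (nabla_delta_le1 w l). Qed.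

(** The N+1 largest coordinates are at least [nabla_x w l N] and sum to at most 1. *)
Lemma nabla_x_le_inv w l N : nabla_x w l N <= N.+1%:R^-1.
Proof.
rewrite -[leRHS]mul1r ler_pdivlMr ?ltr0Sn //; apply: le_trans (sum_nabla_x_le1 w l N.+1).
rewrite mulr_natr -[X in _ *+ X]card_ord -sumr_const; apply: ler_sum => i _.
by apply: nabla_x_nincr; rewrite -ltnS.
Qed.

Lemma nabla_x_le1 w l i : nabla_x w l i <= 1.
Proof.
by apply: le_trans (nabla_x_le_inv w l i) _; rewrite invf_le1 ?ler1n ?ltr0Sn.
Qed.

Lemma cvg_series_nabla w l r : cvgn (series (fun i => nabla_x w l i ^+ r.+1)).
Proof.
apply: (@is_cvg_series_xX _ _ (nabla_delta w l)) => [i|N].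
  exact: nabla_x_ge0.
exact: nabla_x_le.
Qed.

Lemma pnablaE w l r : pnabla w l r.+2 = limn (series (fun i => nabla_x w l i ^+ r.+2)).
Proof. by []. Qed.

Lemma pnabla1 w l : pnabla w l 1 = nabla_delta w l.
Proof. by []. Qed.

Lemma pnabla_tail_ge w l r N :
  nabla_x w l N ^+ r.+2 <= pnabla w l r.+2 - series (fun i => nabla_x w l i ^+ r.+2) N.
Proof.
rewrite lerBrDl pnablaE.
have -> : series (fun i => nabla_x w l i ^+ r.+2) N + nabla_x w l N ^+ r.+2 =
    series (fun i => nabla_x w l i ^+ r.+2) N.+1.
  by rewrite /series /= big_nat_recr.
apply: nondecreasing_cvgn_le; last exact: cvg_series_nabla.
by apply: nondecreasing_series => i _ _; rewrite exprn_ge0 // nabla_x_ge0.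
Qed.

(** All but one of the factors of each tail term are bounded by the first tail coordinate, and the
    remaining factors sum to at most 1. *)
Lemma pnabla_tail_le w l r N :
  pnabla w l r.+2 - series (fun i => nabla_x w l i ^+ r.+2) N <= nabla_x w l N ^+ r.+1.
Proof.
rewrite lerBlDl pnablaE; apply: limr_le; first exact: cvg_series_nabla.
near=> M; have NM : (N <= M)%N by near: M; exact: nbhs_infty_ge.
rewrite -lerBlDl sub_series_geq //.
apply: (@le_trans _ _ (\sum_(N <= i < M) nabla_x w l N ^+ r.+1 * nabla_x w l i)).
  apply: ler_sum_nat => i /andP[Ni _]; rewrite exprSr ler_wpM2r ?nabla_x_ge0 //.
  by rewrite lerXn2r ?nnegrE ?nabla_x_ge0 // nabla_x_nincr.
rewrite -mulr_sumr -[leRHS]mulr1 ler_wpM2l ?exprn_ge0 ?nabla_x_ge0 //.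
apply: le_trans (sum_nabla_x_le1 w l M); rewrite -(big_mkord xpredT (nabla_x w l)).
rewrite (@big_cat_nat _ _ _ N 0 M) //= lerDr.
by apply: sumr_ge0 => i _; exact: nabla_x_ge0.
Unshelve. all: by end_near. Qed.

Lemma pnabla_ge0 w l r : 0 <= pnabla w l r.+1.
Proof.
case: r => [|r]; first by rewrite pnabla1 nabla_delta_ge0.
have := pnabla_tail_ge w l r 0; rewrite /series /= big_geq // subr0.
by apply: le_trans; rewrite exprn_ge0 // nabla_x_ge0.
Qed.

Lemma pnabla_le1 w l r : pnabla w l r.+1 <= 1.
Proof.
case: r => [|r]; first by rewrite pnabla1 nabla_delta_le1.
have := pnabla_tail_le w l r 0; rewrite /series /= big_geq // subr0.
by move=> /le_trans; apply; rewrite exprn_ile1 ?nabla_x_ge0 ?nabla_x_le1.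
Qed.

(** In degree at least 2 the tails are small uniformly on [nabla], so coordinatewise convergence
    suffices. In degree 1 mass may escape to dust, and the value is the separate coordinate
    delta^(l). *)
Lemma cvg_pnabla T (F : set_system T) (v : T -> nab) w l r : Filter F ->
  (forall i, (fun t => nabla_x (v t) l i) @ F --> nabla_x w l i) ->
  (fun t => nabla_delta (v t) l) @ F --> nabla_delta w l ->
  (fun t => pnabla (v t) l r.+1) @ F --> pnabla w l r.+1.
Proof.
move=> FF vx vd; case: r => [|r]; first exact: vd.
apply/cvgrPdist_le => e e0.
(* The tail from N on is at most [nabla_x w l N], hence at most [N.+1%:R^-1], which this choice
   brings below [e / 3] for all points at once. *)
pose N := Num.truncn (3 / e).
have Ne : N.+1%:R^-1 <= e / 3.
  rewrite -[leRHS]invrK lef_pV2 ?posrE ?ltr0Sn ?invr_gt0 ?divr_gt0 // invf_div.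
  by apply/ltW; rewrite truncnS_gt // divr_ge0 // ltW.
have tl (u : nab) : `|pnabla u l r.+2 - series (fun i => nabla_x u l i ^+ r.+2) N| <= e / 3.
  rewrite ger0_norm; last first.
    by apply: le_trans (pnabla_tail_ge u l r N); rewrite exprn_ge0 ?nabla_x_ge0.
  apply: le_trans (pnabla_tail_le u l r N) _; apply: le_trans Ne.
  apply: le_trans (nabla_x_le_inv u l N).
  by rewrite -[leRHS]expr1 ler_wiXn2l ?nabla_x_ge0 ?nabla_x_le1.
have sc : (fun t => series (fun i => nabla_x (v t) l i ^+ r.+2) N) @ F -->
    series (fun i => nabla_x w l i ^+ r.+2) N.
  by rewrite /series /=; apply: cvg_sumr => i _; apply: cvg_expr.
have e3 : 0 < e / 3 by rewrite divr_gt0.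
move/cvgrPdist_le/(_ _ e3): sc; apply: filterS => t st.
set a := pnabla w _ _; set b := pnabla _ _ _.
rewrite (_ : a - b = (a - series (fun i => nabla_x w l i ^+ r.+2) N) +
   (series (fun i => nabla_x w l i ^+ r.+2) N - series (fun i => nabla_x (v t) l i ^+ r.+2) N)
   - (b - series (fun i => nabla_x (v t) l i ^+ r.+2) N)); last by ring.
apply: le_trans (ler_normB _ _) _; rewrite (_ : e = e / 3 + e / 3 + e / 3); last by field.
by apply: lerD; [apply: le_trans (ler_normD _ _) _; apply: lerD|]; rewrite ?tl ?st.
Qed.

Lemma cvg_nabla (F : set_system nab) w : Filter F ->
  (forall l i, (fun v => nabla_x v l i) @ F --> nabla_x w l i) ->
  (forall l, (fun v => nabla_delta v l) @ F --> nabla_delta w l) -> F --> w.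
Proof.
move=> FF Fx Fd.
suff H : set_val @ F --> (set_val w : nabla_ambient R k.+1).
  move=> U [_ [[V oV <-] /= Vw VU]]; rewrite nbhs_filterE.
  apply: filterS VU _; apply: H; rewrite nbhsE; exists V => //.
have pc (I : Type) (Y : topologicalType) (G : set_system {ptws I -> Y}) (f : {ptws I -> Y}) :
    Filter G -> (forall i, (fun h : {ptws I -> Y} => h i) @ G --> f i) -> G --> f.
  move=> FG Gf; apply/cvg_sup => i U [_ [[V oV <-] /= Vf VU]].
  rewrite nbhs_filterE; apply: filterS VU _; apply: Gf.
  by rewrite nbhsE; exists V.
have H1 : (fun v : nab => (set_val v).1) @ F --> ((set_val w).1 : {ptws 'I_k.+1 -> {ptws nat -> R}}).
  by apply: (pc) => l; apply: (pc) => i; exact: Fx.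
have H2 : (fun v : nab => (set_val v).2) @ F --> ((set_val w).2 : {ptws 'I_k.+1 -> R}).
  by apply: (pc) => l; exact: Fd.
move=> U [[A B] /= [wA wB] AB].
have FA : F [set v | A (set_val v).1] by exact: (H1 _ wA).
have FB : F [set v | B (set_val v).2] by exact: (H2 _ wB).
suff : F [set v : nab | U (set_val v)] by [].
apply: filterS (filterI FA FB) => v [/= vA vB].
by rewrite [set_val v]surjective_pairing; exact: AB.
Qed.

End NablaTopology.

(** * Limits along ultrafilters *)

Section UltraLimits.
Local Open Scope ring_scope.
Local Open Scope classical_set_scope.

Lemma ultra_fmap T T' (U : set_system T) (f : T -> T') :
  UltraFilter U -> UltraFilter (f @ U).
Proof.
move=> UU; split; first exact: fmap_proper_filter.
move=> G PG fG; rewrite eqEsubset; split=> // A GA.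
have [//|UnA] := in_ultra_setVsetC (f @^-1` A) UU.
have GnA : G (~` A) by apply: fG.
have [x [Ax nAx]] := filter_ex (filterI GA GnA).
by [].
Qed.

Lemma ultra_bounded_cvg (R : realType) T (U : set_system T) (f : T -> R) a b :
  UltraFilter U -> (forall t, a <= f t <= b) -> exists l : R, f @ U --> l.
Proof.
move=> UU fab; have := @segment_compact R a b; rewrite compact_ultra.
move=> /(_ (f @ U) (ultra_fmap f UU)) [|l [_ fl]]; last by exists l.
  rewrite nbhs_filterE /fmap /=.
  by apply: filterE => t; rewrite /= in_itv; exact: fab.
Qed.

End UltraLimits.

Lemma measurable_forall d (T : measurableType d) (I : countType) (P : I -> set T) :
  (forall i, measurable (P i)) -> measurable [set t | forall i, P i t]%classic.
Proof.
move=> mP; rewrite [X in measurable X](_ : _ = ~` (\bigcup_i ~` P i))%classic.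
  apply: measurableC; apply: countable_bigcupT_measurable => [|i].
    exact: countableP.
  exact: measurableC.
rewrite setC_bigcup; apply/seteqP; split=> [t H i _|t H i]; rewrite ?setCK //.
by have := H i Logic.I; rewrite setCK.
Qed.

(** * Compactness of [nabla] and measurability of maps into it *)

Section NablaLimits.
Local Open Scope ring_scope.
Local Open Scope classical_set_scope.
Variables (R : realType) (k : nat).
Notation nab := (nabla R k.+1).

(** Compactness: all coordinates are bounded, so they converge along an ultrafilter finer than the
    sequence; the constraints pass to the limit, and by [cvg_pnabla] so do the power sums. *)
Lemma nabla_cluster (v : nat -> nab) (h : 'I_k.+1 -> nat -> R) :
  (forall l r, (fun j => pnabla (v j) l r.+1) @ \oo --> h l r) ->
  exists w : nab, forall l r, pnabla w l r.+1 = h l r.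
Proof.
move=> vh; have [U [UU oU]] := ultraFilterLemma eventually_filter.
have [X XP] : exists X : 'I_k.+1 -> nat -> R,
    forall l i, (fun j => nabla_x (v j) l i) @ U --> X l i.
  have H l i : exists x : R, (fun j => nabla_x (v j) l i) @ U --> x.
    by apply: (@ultra_bounded_cvg _ _ _ _ 0 1) => j; rewrite nabla_x_ge0 nabla_x_le1.
  exists (fun l i => projT1 (cid (H l i))) => l i; exact: (projT2 (cid (H l i))).
have [D DP] : exists D : 'I_k.+1 -> R,
    forall l, (fun j => nabla_delta (v j) l) @ U --> D l.
  have H l : exists x : R, (fun j => nabla_delta (v j) l) @ U --> x.
    by apply: (@ultra_bounded_cvg _ _ _ _ 0 1) => j; rewrite nabla_delta_ge0 nabla_delta_le1.
  exists (fun l => projT1 (cid (H l))) => l; exact: (projT2 (cid (H l))).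
have X0 l i : 0 <= X l i.
  apply: (ler_cvg_to (cvg_cst 0) (XP l i)); apply: filterE => j.
  exact: nabla_x_ge0.
have XD : (X, D) \in @nabla_set R k.+1.
  apply/mem_set; split=> /=.
  - move=> l i; apply: (ler_cvg_to (XP l i.+1) (XP l i)); apply: filterE => j.
    exact: nabla_x_nincr.
  - exact: X0.
  - move=> l; apply: (ler_cvg_to (cvg_cst 0) (DP l)); apply: filterE => j.
    exact: nabla_delta_ge0.
  - move=> l; apply: lime_le.
      by apply: is_cvg_nneseries => i _ _; rewrite lee_fin.
    apply: nearW => N; rewrite sumEFin lee_fin.
    rewrite big_mkord; apply: (ler_cvg_to (cvg_sumr _ _) (DP l)).
      by move=> i _; exact: XP.
    by apply: filterE => j; exact: nabla_x_le.
  - have H : (fun j => \sum_l nabla_delta (v j) l) @ U --> \sum_l D l.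
      by apply: cvg_sumr => l _; exact: DP.
    have H1 : (fun j => \sum_l nabla_delta (v j) l) @ U --> (1 : R).
      by under eq_cvg do rewrite sum_nabla_delta; exact: cvg_cst.
    exact: (cvg_unique _ H H1).
pose w : nab := exist _ ((X, D) : nabla_ambient R k.+1) XD; exists w => l r.
have H : (fun j => pnabla (v j) l r.+1) @ U --> pnabla w l r.+1.
  by apply: cvg_pnabla; [move=> i; exact: XP | exact: DP].
have H' : (fun j => pnabla (v j) l r.+1) @ U --> h l r.
  by apply: cvg_trans (vh l r); exact: cvg_app.
exact: (cvg_unique _ H H').
Qed.

Section Measurability.
Variables (d : measure_display) (T : measurableType d) (v : T -> nab).
Hypothesis mp : forall l r, measurable_fun setT (fun t => pnabla (v t) l r.+1).

(** The tail of the power sum of degree r+2 lies between the powers r+2 and r+1 of its first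
    coordinate, so for large r it detects whether this coordinate exceeds [a]. Thus the coordinates
    are recovered from the power sums one after the other. *)
Lemma nabla_x_gt (w : nab) l N (a : R) : 0 <= a -> (a < nabla_x w l N) <->
  exists r, a ^+ r.+1 < pnabla w l r.+2 - series (fun i => nabla_x w l i ^+ r.+2) N.
Proof.
move=> a0; set x := nabla_x w l N; have x0 : 0 <= x by exact: nabla_x_ge0.
split=> [ax|[r]]; last first.
  move=> /lt_le_trans/(_ (pnabla_tail_le w l r N)); rewrite -/x => H.
  by rewrite ltNge; apply/negP => xa; move: H; rewrite ltNge lerXn2r.
apply: contrapT => /forallNP H.
have xlt : 0 < x by exact: le_lt_trans ax.
(* That is, [x ^+ r.+2 <= a ^+ r.+1]; since [x^-1 * a < 1], the right-hand side tends to 0. *)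
have {}H r : x <= x^-1 * a * (x^-1 * a) ^+ r.
  rewrite -exprS exprMn exprVn mulrC ler_pdivlMr ?exprn_gt0 // -exprS.
  apply: le_trans (pnabla_tail_ge w l r N) _.
  by have /negP := H r; rewrite -leNgt.
have : x <= 0.
  apply: (ler_cvg_to (cvg_cst x) (@cvg_geometric R (x^-1 * a) (x^-1 * a) _)).
    rewrite ger0_norm; last by rewrite mulr_ge0 // invr_ge0.
    by rewrite mulrC ltr_pdivrMr // mul1r.
  by apply: nearW => r; exact: H.
by rewrite leNgt xlt.
Qed.

Lemma measurable_nabla_x l N : measurable_fun setT (fun t => nabla_x (v t) l N).
Proof.
have [n] := ubnP N; elim: n N => // n IHn N; rewrite ltnS => Nn.
have mq r : measurable_fun setT (fun t => pnabla (v t) l r.+2 -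
    series (fun i => nabla_x (v t) l i ^+ r.+2) N).
  apply: measurable_funB; first exact: mp.
  rewrite /series /=; under eq_fun do rewrite big_mkord.
  apply: measurable_sum => i; apply: measurable_funX; apply: IHn.
  exact: leq_trans (ltn_ord i) Nn.
apply: (measurability _ (RGenOInfty.measurableE R)) => //.
move=> /= _ [_ [a ->] <-]; rewrite setTI preimage_itvoy.
have [a0|a0] := leP 0 a; last first.
  rewrite [X in measurable X](_ : _ = setT) //; apply/seteqP; split=> // t _ /=.
  exact: lt_le_trans a0 (nabla_x_ge0 _ _ _).
rewrite [X in measurable X](_ : _ = \bigcup_r [set t | a ^+ r.+1 <
  pnabla (v t) l r.+2 - series (fun i => nabla_x (v t) l i ^+ r.+2) N]).
  apply: bigcupT_measurable => r; rewrite -preimage_itvoy -[X in measurable X]setTI.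
  exact: mq.
apply/seteqP; split=> [t /= /nabla_x_gt - /(_ a0)[r]|t [r _] /= H].
  by exists r.
by apply/nabla_x_gt => //; exists r.
Qed.

Definition box N (q : {ffun 'I_k.+1 * 'I_N.+1 -> rat} * {ffun 'I_k.+1 -> rat}) : set nab :=
  [set u | (forall l (i : 'I_N.+1), ball (ratr (q.1 (l, i)) : R) N.+1%:R^-1 (nabla_x u l i)) /\
           forall l, ball (ratr (q.2 l) : R) N.+1%:R^-1 (nabla_delta u l)].

Lemma measurable_box N q : measurable (v @^-1` @box N q).
Proof.
have mball (f : T -> R) (y e : R) : measurable_fun setT f ->
    measurable [set t | ball y e (f t)].
  move=> mf; rewrite -[X in measurable X]setTI.
  by apply: (mf measurableT); exact: measurable_ball.
rewrite [X in measurable X](_ : _ =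
    [set t | forall p, ball (ratr (q.1 p) : R) N.+1%:R^-1 (nabla_x (v t) p.1 p.2)] `&`
    [set t | forall l, ball (ratr (q.2 l) : R) N.+1%:R^-1 (nabla_delta (v t) l)]).
  apply: measurableI; apply: measurable_forall => p; apply: mball.
    exact: measurable_nabla_x.
  exact: mp _ 0.
apply/seteqP; split=> t [/= H1 H2]; split=> //.
  by case=> l i; exact: H1.
Qed.

Lemma open_box (U : set nab) w : open U -> U w -> exists N q, box q w /\ @box N q `<=` U.
Proof.
move=> oU Uw.
(* Otherwise there are points outside [U] ever closer to [w] in ever more coordinates, and they
   converge to [w]. The bound is the diameter of a box built from balls of radius [N.+1%:R^-1]. *)
have [N NP] : exists N, [set u | (forall l i, (i <= N)%N -> `|nabla_x w l i - nabla_x u l i| <= 2 / N.+1%:R) /\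
     forall l, `|nabla_delta w l - nabla_delta u l| <= 2 / N.+1%:R] `<=` U.
  apply: contrapT => /forallNP H.
  have {}H N : exists u, [/\ ~ U u, forall l i, (i <= N)%N ->
      `|nabla_x w l i - nabla_x u l i| <= 2 / N.+1%:R &
      forall l, `|nabla_delta w l - nabla_delta u l| <= 2 / N.+1%:R].
    by have /existsNP[u /not_implyP[[u1 u2] nU]] := H N; exists u.
  pose u N := projT1 (cid (H N)).
  have uP N : [/\ ~ U (u N), forall l i, (i <= N)%N ->
      `|nabla_x w l i - nabla_x (u N) l i| <= 2 / N.+1%:R &
      forall l, `|nabla_delta w l - nabla_delta (u N) l| <= 2 / N.+1%:R].
    exact: (projT2 (cid (H N))).
  have c0 : (fun N => 2 / N.+1%:R : R) @ \oo --> (0 : R).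
    by rewrite -[X in _ --> X](mulr0 2); apply: cvgM; [exact: cvg_cst | exact: cvg_harmonic].
  have uw : u @ \oo --> w.
    apply: cvg_nabla => [l i|l]; apply/cvgrPdist_le => e e0;
      move/cvgrPdist_le/(_ _ e0): c0 => c0; rewrite near_map; near=> N.
      have [_ uN _] := uP N; apply: (@le_trans _ _ (2 / N.+1%:R)).
        by apply: uN; near: N; exact: nbhs_infty_ge.
      apply: le_trans (ler_norm _) _; rewrite -normrN -sub0r; near: N; exact: c0.
    have [_ _ /(_ l) uN] := uP N; apply: le_trans uN _.
    apply: le_trans (ler_norm _) _; rewrite -normrN -sub0r; near: N; exact: c0.
  have : \forall N \near \oo, U (u N) by apply: uw; exact: open_nbhs_nbhs.
  by move=> /filter_ex[N UuN]; have [/(_ UuN)] := uP N.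
have e0 : (0 : R) < N.+1%:R^-1 by rewrite invr_gt0.
have rq_ (e x : R) : 0 < e -> exists q : rat, ball (ratr q : R) e x.
  move=> ep; have : x - e < x + e by lra.
  case/rat_in_itvoo => q; rewrite in_itv /= => /andP[q1 q2]; exists q.
  by rewrite /ball /= ltr_distlC; apply/andP; split; lra.
have rq x := rq_ _ x e0.
pose Q (x : R) := projT1 (cid (rq x)).
have QP x : ball (ratr (Q x) : R) N.+1%:R^-1 x by exact: (projT2 (cid (rq x))).
exists N, ([ffun p : 'I_k.+1 * 'I_N.+1 => Q (nabla_x w p.1 p.2)],
  [ffun l => Q (nabla_delta w l)]).
split; first by split=> [l i|l]; rewrite /= ffunE; exact: QP.
have tri (a b c e : R) : ball c e a -> ball c e b -> `|a - b| <= 2 * e.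
  rewrite /ball /= => ca cb; rewrite (_ : a - b = (c - b) - (c - a)); last by ring.
  by apply: le_trans (ler_normB _ _) _; lra.
move=> u [/= u1 u2]; apply: NP; split=> [l i iN|l].
  have := u1 l (Ordinal (iN : (i < N.+1)%N)); rewrite ffunE /=.
  by move/(tri _ _ _ _ (QP _)).
by have := u2 l; rewrite ffunE; move/(tri _ _ _ _ (QP _)).
Unshelve. all: by end_near. Qed.

(** Every open set is a union of rational boxes, of which there are countably many, and preimages of
    boxes are measurable as soon as the power sums are. *)
Lemma measurable_to_nabla : measurable_fun setT (v : T -> borel nab).
Proof.
apply: (measurability (@open nab : set (set (borel nab)))) => //.
move=> _ [U oU <-]; rewrite setTI.
pose I := {N : nat & ({ffun 'I_k.+1 * 'I_N.+1 -> rat} * {ffun 'I_k.+1 -> rat})%type}.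
rewrite [X in measurable X](_ : _ = \bigcup_(i : I)
  if `[< @box (tag i) (tagged i) `<=` U >] then v @^-1` @box (tag i) (tagged i) else set0).
  apply: countable_bigcupT_measurable; first exact: countableP.
  by move=> i; case: ifP => _; [exact: measurable_box | exact: measurable0].
apply/seteqP; split=> [t /= Uvt|t [i _]].
  have [N [q [bq qU]]] := open_box oU Uvt.
  exists (existT _ N q) => //=; rewrite ifT //; exact/asboolP.
by case: ifP => // /asboolP; apply.
Qed.

End Measurability.
End NablaLimits.

(** * Expectations of bounded measurable functions *)

Section BoundedExpectation.
Local Open Scope ring_scope.
Local Open Scope classical_set_scope.
Context {d : measure_display} {T : measurableType d} {R : realType}.
Variable P : probability T R.
Implicit Types (f g : T -> R).

(** Integrable under every probability and closed under the ring operations, so that expectations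
    can be computed as real numbers. *)
Definition bmeas f :=
  measurable_fun setT f /\ exists M, forall t, `|f t| <= M.

Lemma bmeas_cst (r : R) : bmeas (fun _ => r).
Proof. by split; [exact: measurable_cst | exists `|r|]. Qed.

Lemma bmeasD f g : bmeas f -> bmeas g -> bmeas (fun t => f t + g t).
Proof.
move=> [mf [M fM]] [mg [N gN]]; split; first exact: measurable_funD.
by exists (M + N) => t; apply: le_trans (ler_normD _ _) _; apply: lerD.
Qed.

Lemma bmeasM f g : bmeas f -> bmeas g -> bmeas (fun t => f t * g t).
Proof.
move=> [mf [M fM]] [mg [N gN]]; split; first exact: measurable_funM.
by exists (M * N) => t; rewrite normrM; apply: ler_pM.
Qed.

Lemma bmeasZ r f : bmeas f -> bmeas (fun t => r * f t).
Proof. by move=> bf; apply: bmeasM bf; exact: bmeas_cst. Qed.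

Lemma bmeasN f : bmeas f -> bmeas (fun t => - f t).
Proof.
move=> /(bmeasZ (-1)); rewrite (_ : (fun t => -1 * f t) = (fun t => - f t)) //.
by apply/funext => t; rewrite mulN1r.
Qed.

Lemma bmeasB f g : bmeas f -> bmeas g -> bmeas (fun t => f t - g t).
Proof. by move=> bf /bmeasN; exact: bmeasD. Qed.

Lemma bmeas_sum I (r : seq I) (F : I -> T -> R) :
  (forall i, bmeas (F i)) -> bmeas (fun t => \sum_(i <- r) F i t).
Proof.
move=> bF; elim: r => [|i r IHr].
  by under eq_fun do rewrite big_nil; exact: bmeas_cst.
by under eq_fun do rewrite big_cons; exact: bmeasD.
Qed.

Lemma bmeas_prod I (r : seq I) (F : I -> T -> R) :
  (forall i, bmeas (F i)) -> bmeas (fun t => \prod_(i <- r) F i t).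
Proof.
move=> bF; elim: r => [|i r IHr].
  by under eq_fun do rewrite big_nil; exact: bmeas_cst.
by under eq_fun do rewrite big_cons; exact: bmeasM.
Qed.

Lemma bmeasX f n : bmeas f -> bmeas (fun t => f t ^+ n).
Proof.
move=> bf; elim: n => [|n IHn]; first exact: bmeas_cst.
by under eq_fun do rewrite exprS; exact: bmeasM.
Qed.

Lemma bmeas_indic (A : set T) : measurable A -> bmeas (fun t => (t \in A)%:R).
Proof.
move=> mA; split; first exact: (measurable_indic mA).
by exists 1 => t; case: (t \in A); rewrite ?normr1 ?normr0.
Qed.

Lemma bmeas_integrable f : bmeas f -> P.-integrable setT (EFin \o f).
Proof.
move=> [mf [M fM]]; apply: measurable_bounded_integrable => //.
  by apply: le_lt_trans (probability_le1 P measurableT) _; rewrite ltry.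
exists M; split; first exact: num_real.
by move=> x Mx t _; apply: le_trans (fM t) (ltW Mx).
Qed.

Definition expect f : R := \int[P]_x f x.

Lemma integral_expect f : bmeas f -> (\int[P]_x (f x)%:E = (expect f)%:E)%E.
Proof.
by move=> bf; rewrite fineK //; apply: integrable_fin_num => //; exact: bmeas_integrable.
Qed.

Lemma expectD f g : bmeas f -> bmeas g ->
  expect (fun t => f t + g t) = expect f + expect g.
Proof. by move=> bf bg; apply: RintegralD => //; exact: bmeas_integrable. Qed.

Lemma expectB f g : bmeas f -> bmeas g ->
  expect (fun t => f t - g t) = expect f - expect g.
Proof. by move=> bf bg; apply: RintegralB => //; exact: bmeas_integrable. Qed.

Lemma expectZ r f : bmeas f -> expect (fun t => r * f t) = r * expect f.
Proof. by move=> bf; apply: RintegralZl => //; exact: bmeas_integrable. Qed.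

Lemma expect_cst r : expect (fun _ => r) = r.
Proof.
by rewrite /expect Rintegral_cst // [X in fine X](@probability_setT _ _ _ P) mulr1.
Qed.

Lemma expect_sum I (r : seq I) (F : I -> T -> R) : (forall i, bmeas (F i)) ->
  expect (fun t => \sum_(i <- r) F i t) = \sum_(i <- r) expect (F i).
Proof.
move=> bF; elim: r => [|i r IHr].
  by under eq_fun do rewrite big_nil; rewrite big_nil expect_cst.
under eq_fun do rewrite big_cons.
by rewrite big_cons -IHr expectD //; exact: bmeas_sum.
Qed.

Lemma expect_ge0 f : (forall t, 0 <= f t) -> 0 <= expect f.
Proof. by move=> f0; apply: Rintegral_ge0. Qed.

Lemma le_expect f g : bmeas f -> bmeas g -> (forall t, f t <= g t) ->
  expect f <= expect g.
Proof. by move=> bf bg fg; apply: le_Rintegral => //; exact: bmeas_integrable. Qed.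

Lemma expect_indic (A : set T) : measurable A ->
  expect (fun t => (t \in A)%:R) = fine (P A).
Proof.
move=> mA; rewrite /expect /Rintegral.
by have := integral_indic P measurableT mA; rewrite setIT => <-.
Qed.

Lemma cvg_expect (F : nat -> T -> R) f M : (forall n, bmeas (F n)) -> bmeas f ->
  (forall n t, `|F n t| <= M) ->
  {ae P, forall t, (fun n => F n t) @ \oo --> f t} ->
  (fun n => expect (F n)) @ \oo --> expect f.
Proof.
move=> bF bf FM Ff.
have [] := @dominated_convergence _ T R P setT measurableT (fun n t => (F n t)%:E)
  (EFin \o f) (cst M%:E).
- by move=> n; apply/measurable_EFinP; exact: (bF n).1.
- by apply/measurable_EFinP; exact: bf.1.
- by apply: filterS Ff => t Ft _; apply/cvg_EFin; [exact: nearW | exact: Ft].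
- exact: (bmeas_integrable (bmeas_cst M)).
- by apply: aeW => t n _ /=; rewrite lee_fin.
move=> _ _; rewrite integral_expect //.
under eq_fun do rewrite integral_expect //.
by move/fine_cvgP => [].
Qed.

End BoundedExpectation.
Arguments expect {d T R} P f.

(** * The moments of the power sums determine a measure on [nabla] *)

Section Moments.
Local Open Scope ring_scope.
Local Open Scope classical_set_scope.
Variable R : realType.

Lemma bernoulli_inv (x : R) N : 0 <= x <= 1 -> (1 - x) ^+ N * (1 + N%:R * x) <= 1.
Proof.
case/andP => x0 x1; elim: N => [|N IHN]; first by rewrite mul0r addr0 expr0 mulr1.
apply: le_trans IHN; rewrite exprSr -mulrA ler_wpM2l ?exprn_ge0 ?subr_ge0 //.
have : 0 <= N%:R * x * x by rewrite !mulr_ge0.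
by rewrite -natr1; nra.
Qed.

(** One factor [Num.sqrt q ^+ n] keeps [n%:R] bounded, by Bernoulli's inequality, and the other
    tends to 0. *)
Lemma cvg_nat_geometric (q : R) : 0 <= q < 1 -> (fun n => n%:R * q ^+ n) @ \oo --> 0.
Proof.
case/andP => q0 q1.
have s0 : 0 <= Num.sqrt q := sqrtr_ge0 q.
have s1 : Num.sqrt q < 1 by rewrite -sqrtr1 ltr_sqrt.
pose C := (1 - Num.sqrt q)^-1.
have ns n : n%:R * Num.sqrt q ^+ n <= C.
  rewrite /C -[leRHS]mul1r ler_pdivlMr ?subr_gt0 //.
  apply: le_trans (bernoulli_inv n (_ : 0 <= 1 - Num.sqrt q <= 1)).
    rewrite subKr mulrAC mulrC ler_wpM2l ?exprn_ge0 // lerDr //.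
  by rewrite subr_ge0 ltW //= gerBl.
apply: (@squeeze_cvgr _ _ _ _ (fun=> 0) (fun n => C * Num.sqrt q ^+ n)).
- apply: nearW => n; rewrite mulr_ge0 ?exprn_ge0 //= -{1}(sqr_sqrtr q0) -exprM mulnC exprM.
  by rewrite expr2 mulrA ler_wpM2r ?exprn_ge0.
- exact: cvg_cst.
- by apply: cvg_geometric; rewrite ger0_norm.
Qed.

(** A polynomial in [y] tending to the indicator of [y < t]: the outer exponent times the inner
    power is n (y/t)^n, which tends to 0 below t and to infinity from t on. The factor [m] brings
    the inner quotient into [0, 1]. *)
Definition soft_step (y t : R) (m n : nat) : R :=
  (1 - (y / (m%:R * t)) ^+ n) ^+ (n * m ^ n).

Lemma soft_step_itv y t m n : 0 <= y -> y <= m%:R * t -> 0 <= soft_step y t m n <= 1.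
Proof.
move=> y0 ymt; have mt : 0 <= m%:R * t by exact: le_trans ymt.
have z0 : 0 <= (y / (m%:R * t)) ^+ n by rewrite exprn_ge0 // divr_ge0.
have z1 : (y / (m%:R * t)) ^+ n <= 1.
  rewrite exprn_ile1 ?divr_ge0 //; move: mt; rewrite le_eqVlt => /orP[/eqP <-|mt].
    by rewrite invr0 mulr0.
  by rewrite ler_pdivrMr // mul1r.
by rewrite /soft_step exprn_ge0 ?exprn_ile1 ?subr_ge0 ?gerBl.
Qed.

Lemma cvg_soft_step y t m : 0 <= y -> 0 < t -> (0 < m)%N -> y <= m%:R * t ->
  soft_step y t m @ \oo --> ((y < t)%R%:R : R).
Proof.
move=> y0 t0 m0 ymt.
have mt : 0 < m%:R * t by rewrite mulr_gt0 ?ltr0n.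
pose z n := (y / (m%:R * t)) ^+ n; pose K n := (n * m ^ n)%N.
have z01 n : 0 <= z n <= 1.
  have mt0 := ltW mt; apply/andP; split; first by rewrite exprn_ge0 ?divr_ge0.
  by rewrite exprn_ile1 ?divr_ge0 // ler_pdivrMr // mul1r.
have zK n : (K n)%:R * z n = n%:R * (y / t) ^+ n.
  rewrite /K /z natrM natrX -mulrA -exprMn; congr (_ * _ ^+ _).
  by field; rewrite lt0r_neq0 // pnatr_eq0 -lt0n m0.
have bern (x : R) N : 0 <= x <= 1 -> 1 - N%:R * x <= (1 - x) ^+ N.
  case/andP => x0 x1; elim: N => [|N IHN]; first by rewrite mul0r subr0 expr0.
  rewrite exprS; apply: le_trans (_ : (1 - x) * (1 - N%:R * x) <= _).
    have : 0 <= N%:R * x * x by rewrite !mulr_ge0.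
    by rewrite -natr1; nra.
  by rewrite ler_wpM2l // subr_ge0.
have [yt|ty] := ltP y t.
  have q1 : 0 <= y / t < 1 by rewrite divr_ge0 ?(ltW t0) //= ltr_pdivrMr // mul1r.
  apply: (@squeeze_cvgr _ _ _ _ (fun n => 1 - n%:R * (y / t) ^+ n) (fun=> 1)).
  - apply: nearW => n; rewrite -zK bern //=.
    by have /andP[] := soft_step_itv n y0 ymt.
  - rewrite -[X in _ --> X]subr0; apply: cvgB; first exact: cvg_cst.
    exact: cvg_nat_geometric.
  - exact: cvg_cst.
apply: (@squeeze_cvgr _ _ _ _ (fun=> 0) (fun n => n.+1%:R^-1)).
- apply: nearW => n; have /andP[-> _] /= := soft_step_itv n y0 ymt.
  rewrite -[leRHS]mul1r ler_pdivlMr ?ltr0Sn //; apply: le_trans (bernoulli_inv (K n) (z01 n)).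
  rewrite ler_wpM2l ?exprn_ge0 ?subr_ge0 ?(andP (z01 n)).2 //.
  rewrite zK -natr1 addrC lerD2l ler_peMr // exprn_ege1 //.
  by rewrite ler_pdivlMr // mul1r.
- exact: cvg_cst.
- exact: cvg_harmonic.
Qed.

Variable k : nat.
Notation nab := (nabla R k.+1).

Lemma continuous_nabla_x l i : continuous (fun w : nab => nabla_x w l i).
Proof.
move=> w; rewrite /nabla_x.
apply: (@continuous_comp _ _ _ (fun w : nab => set_val w)
  (fun v : nabla_ambient R k.+1 => v.1 l i)); first exact: initial_continuous.
apply: (@continuous_comp _ _ _ (fun v : nabla_ambient R k.+1 => v.1)
  (fun v : {ptws 'I_k.+1 -> {ptws nat -> R}} => v l i)); first exact: cvg_fst.
apply: (@continuous_comp _ _ _ (fun v : {ptws 'I_k.+1 -> {ptws nat -> R}} => v l)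
  (fun v : {ptws nat -> R} => v i)); exact: proj_continuous.
Qed.

Lemma continuous_nabla_delta l : continuous (fun w : nab => nabla_delta w l).
Proof.
move=> w; rewrite /nabla_delta.
apply: (@continuous_comp _ _ _ (fun w : nab => set_val w)
  (fun v : nabla_ambient R k.+1 => v.2 l)); first exact: initial_continuous.
apply: (@continuous_comp _ _ _ (fun v : nabla_ambient R k.+1 => v.2)
  (fun v : {ptws 'I_k.+1 -> R} => v l)); first exact: cvg_snd.
exact: proj_continuous.
Qed.

Lemma continuous_pnabla l r : continuous (fun w : nab => pnabla w l r.+1).
Proof.
move=> w; apply: (cvg_pnabla (F := nbhs (w : nab)) (nbhs_filter w)) => [i|].
  exact: continuous_nabla_x.
exact: continuous_nabla_delta.
Qed.

Lemma bmeas_pnabla l r : bmeas (fun w : borel nab => pnabla w l r.+1).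
Proof.
split; last by exists 1 => w; rewrite ger0_norm ?pnabla_le1 ?pnabla_ge0.
apply: (measurability _ (RGenOInfty.measurableE R)) => //.
move=> /= _ [_ [a ->] <-]; rewrite setTI; apply: sub_sigma_algebra.
apply: (open_comp (f := fun w : nab => pnabla w l r.+1)); last exact: interval_open.
by move=> w _; exact: continuous_pnabla.
Qed.

Definition moment (rho : seq ('I_k.+1 * nat)) (w : nab) : R :=
  \prod_(e <- rho) pnabla w e.1 e.2.+1.

Lemma bmeas_moment rho : bmeas (moment rho : borel nab -> R).
Proof. by apply: bmeas_prod => e; exact: bmeas_pnabla. Qed.

Variables Pi Pi' : probability (borel nab) R.

(** Test functions that the two measures do not distinguish, even after multiplication by a monomial
    in the power sums. With all [rho] included, the class is stable under such multiplications,
    hence under the polynomials [soft_step]. *)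
Definition same_moments (f : borel nab -> R) := bmeas f /\ forall rho,
  expect Pi (fun w => f w * moment rho w) = expect Pi' (fun w => f w * moment rho w).

Lemma same_momentsM f e : same_moments f ->
  same_moments (fun w => f w * pnabla w e.1 e.2.+1).
Proof.
move=> [bf Hf]; split=> [|rho]; first by apply: bmeasM => //; exact: bmeas_pnabla.
have := Hf (e :: rho); rewrite /moment; under eq_fun do rewrite big_cons mulrA.
by move=> ->; congr (expect _ _); apply/funext => w; rewrite big_cons mulrA.
Qed.

Lemma same_momentsX f e n : same_moments f ->
  same_moments (fun w => f w * pnabla w e.1 e.2.+1 ^+ n).
Proof.
move=> Hf; elim: n => [|n IHn].
  by under eq_fun do rewrite expr0 mulr1.
by under eq_fun do rewrite exprSr mulrA; exact: same_momentsM.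
Qed.

Lemma same_momentsB f g c : same_moments f -> same_moments g ->
  same_moments (fun w => f w - c * g w).
Proof.
move=> [bf Hf] [bg Hg]; split=> [|rho]; first by apply: bmeasB => //; exact: bmeasZ.
have bm := bmeas_moment rho.
rewrite (_ : (fun w => _) = (fun w => f w * moment rho w - c * (g w * moment rho w))).
  by rewrite !expectB ?expectZ ?Hf ?Hg //; do ?[apply: bmeasZ]; exact: bmeasM.
by apply/funext => w; rewrite mulrBl mulrA.
Qed.

Lemma same_moments_cvg (F : nat -> borel nab -> R) f M :
  (forall n, same_moments (F n)) -> bmeas f -> (forall n w, `|F n w| <= M) ->
  (forall w, (fun n => F n w) @ \oo --> f w) -> same_moments f.
Proof.
move=> HF bf FM Ff; split=> // rho; have bm := bmeas_moment rho.
have cv (Q : probability (borel nab) R) :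
    (fun n => expect Q (fun w => F n w * moment rho w)) @ \oo -->
    expect Q (fun w => f w * moment rho w).
  apply: (@cvg_expect _ _ _ _ _ _ M).
  - by move=> n; apply: bmeasM => //; exact: (HF n).1.
  - exact: bmeasM.
  - move=> n w; rewrite normrM -[leRHS]mulr1; apply: ler_pM => //.
    rewrite /moment normr_prod; apply: prodr_ile1 => e _ /=.
    by rewrite normr_ge0 ger0_norm ?pnabla_le1 ?pnabla_ge0.
  - by apply: aeW => w; apply: cvgM; [exact: Ff | exact: cvg_cst].
have := cv Pi'; under eq_cvg do rewrite -(HF _).2.
by move=> H; apply: (cvg_unique _ (cv Pi) H).
Qed.

Lemma same_moments_lt f e (t : R) : same_moments f ->
  same_moments (fun w => f w * (pnabla w e.1 e.2.+1 < t)%R%:R).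
Proof.
move=> Hf; have [bf _] := Hf.
have mlt : measurable [set w : borel nab | pnabla w e.1 e.2.+1 < t].
  rewrite -preimage_itvNyo -[X in measurable X]setTI.
  by apply: (bmeas_pnabla e.1 e.2).1 => //; exact: measurable_itv.
have blt : bmeas (fun w : borel nab => f w * (pnabla w e.1 e.2.+1 < t)%R%:R).
  apply: bmeasM => //; have := bmeas_indic (R := R) mlt; congr bmeas.
  by apply/funext => w; congr ((nat_of_bool _)%:R); apply/idP/idP; rewrite inE.
have [t0|t0] := leP t 0.
  have -> : (fun w => f w * (pnabla w e.1 e.2.+1 < t)%R%:R) = (fun w => f w - 1 * f w).
    apply/funext => w; rewrite mul1r subrr ltNge.
    by rewrite (le_trans t0 (pnabla_ge0 _ _ _)) mulr0.
  exact: same_momentsB.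
(* Large enough that [m%:R * t] is at least 1, which bounds every power sum. *)
pose m := (Num.truncn t^-1).+1.
have mt1 : 1 <= m%:R * t.
  by rewrite -ler_pdivrMr // div1r ltW // truncnS_gt // invr_ge0 ltW.
have [M fM] := bf.2.
apply: (@same_moments_cvg (fun n w => f w * soft_step (pnabla w e.1 e.2.+1) t m n) _ M) => //.
- move=> n; rewrite /soft_step; elim: (n * m ^ n)%N => [|K IHK].
    by under eq_fun do rewrite expr0 mulr1.
  set c := (m%:R * t)^-1 ^+ n.
  rewrite (_ : (fun w => _) = (fun w =>
     f w * (1 - (pnabla w e.1 e.2.+1 / (m%:R * t)) ^+ n) ^+ K -
     c * (f w * (1 - (pnabla w e.1 e.2.+1 / (m%:R * t)) ^+ n) ^+ K *
          pnabla w e.1 e.2.+1 ^+ n))).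
    by apply: same_momentsB => //; exact: same_momentsX.
  by apply/funext => w; rewrite exprSr [(_ / _) ^+ n]exprMn -/c; ring.
- move=> n w; rewrite normrM -[leRHS]mulr1; apply: ler_pM => //.
  have /andP[s0 s1] := soft_step_itv n (pnabla_ge0 w e.1 e.2)
    (le_trans (pnabla_le1 w e.1 e.2) mt1).
  by rewrite ger0_norm.
- move=> w; apply: cvgM; first exact: cvg_cst.
  by apply: cvg_soft_step => //; rewrite ?pnabla_ge0 // (le_trans (pnabla_le1 _ _ _)).
Qed.

Definition lower_box (s : seq (('I_k.+1 * nat) * R)) : set (borel nab) :=
  [set w | all (fun et => pnabla w et.1.1 et.1.2.+1 < et.2) s].

Lemma measurable_lower_box s : measurable (lower_box s).
Proof.
elim: s => [|et s IHs]; first by rewrite [X in measurable X](_ : _ = setT) //; apply/seteqP.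
rewrite [X in measurable X](_ : _ =
    [set w | pnabla w et.1.1 et.1.2.+1 < et.2] `&` lower_box s).
  apply: measurableI => //; rewrite -preimage_itvNyo -[X in measurable X]setTI.
  by apply: (bmeas_pnabla _ _).1 => //; exact: measurable_itv.
by apply/seteqP; split=> w /= => [/andP[]|[a b]] //; apply/andP.
Qed.

(** Indicators of the sets [lower_box] are limits of polynomials in the power sums, so the measures
    agree on them. These sets are stable under intersection and generate the Borel sets. *)
Lemma nabla_moments : (forall rho, expect Pi (moment rho) = expect Pi' (moment rho)) ->
  eq_on_measurable Pi Pi'.
Proof.
move=> Hm.
have Hbox s : same_moments (fun w => (w \in lower_box s)%:R).
  elim: s => [|et s IHs].
    rewrite (_ : (fun w => _) = fun=> 1); last by apply/funext => w; rewrite mem_set.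
    split=> [|rho]; first exact: bmeas_cst.
    by have := Hm rho; congr (_ = _); congr (expect _ _); apply/funext => w; rewrite mul1r.
  rewrite (_ : (fun w => _) = (fun w => (w \in lower_box s)%:R *
    (pnabla w et.1.1 et.1.2.+1 < et.2)%R%:R)); first exact: same_moments_lt.
  apply/funext => w; rewrite -natrM mulnb andbC; congr ((nat_of_bool _)%:R).
  apply/idP/andP => [|[lt_et /set_mem ws]]; first by move/set_mem => /= /andP[-> H]; split=> //; exact/mem_set.
  by apply/mem_set => /=; apply/andP.
pose G := range lower_box.
(* By [measurable_to_nabla], applied to the identity from the sigma-algebra generated by [G] to the
   Borel one. *)
have sG A : measurable A -> <<s G >> A.
  move=> mA; have mid : measurable_fun setT
      ((id : g_sigma_algebraType G -> nab) : g_sigma_algebraType G -> borel nab).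
    apply: (@measurable_to_nabla R k _ (g_sigma_algebraType G) id) => l r.
    apply: (measurability _ (RGenInftyO.measurableE R)) => //.
    move=> /= _ [_ [a ->] <-]; rewrite setTI; apply: sub_sigma_algebra.
    exists [:: ((l, r), a)] => //; rewrite preimage_itvNyo.
    by rewrite /lower_box; apply/seteqP; split=> w /=; rewrite andbT.
  by have := mid measurableT A mA; rewrite setTI.
move=> A mA; apply: (@g_sigma_algebra_measure_unique _ R (borel nab) G _ (fun=> setT)) => //.
- by move=> _ [s _ <-]; exact: measurable_lower_box.
- by move=> _; exists [::] => //; apply/seteqP.
- by apply/seteqP; split=> // w _; exists 0%N.
- move=> _ _ [s _ <-] [s' _ <-]; exists (s ++ s') => //.
  by apply/seteqP; split=> w; rewrite /lower_box /= all_cat => /andP.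
- move=> _ [s _ <-]; have ms := measurable_lower_box s.
  have [_ /(_ [::])] := Hbox s.
  have -> : (fun w => (w \in lower_box s)%:R * moment [::] w) =
      (fun w => (w \in lower_box s)%:R).
    by apply/funext => w; rewrite /moment big_nil mulr1.
  rewrite !expect_indic // => H.
  by rewrite -[LHS]fineK ?fin_num_measure // -[RHS]fineK ?fin_num_measure // H.
- by move=> _; rewrite (le_lt_trans (probability_le1 Pi measurableT)) // ltry.
- exact: sG.
Qed.

End Moments.

(** * The representation formula and the uniqueness of the representing measure *)

Section Representation.
Local Open Scope ring_scope.
Local Open Scope classical_set_scope.
Variables (R : realType) (gT : finGroupType) (k : nat) (c : 'I_k.+1 -> {set gT}).
Hypothesis hc : enumerates_classes c.
Notation nab := (nabla R k.+1).
Notation shape := (shape c).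

Lemma bmeas_augm s : all (fun e => e.2 != 0%N) s ->
  bmeas (fun w : borel nab => augm (pnabla w) s).
Proof.
have [n] := ubnP (size s); elim: n s => // n IHn [|a s] /= sn.
  by move=> _; exact: bmeas_cst.
case/andP => a0 s0; under eq_fun do rewrite augm_cons.
apply: bmeasB.
  apply: bmeasM; last exact: IHn.
  by rewrite -(prednK (_ : 0 < a.2)%N) ?lt0n //; exact: bmeas_pnabla.
under eq_fun do rewrite big_seq big_mkcond /=.
apply: bmeas_sum => t; case: (boolP (t \in merges a s)) => [ts|_]; last exact: bmeas_cst.
by apply: IHn; [rewrite (size_merges ts) | exact: (merges_parts ts a0 s0).1].
Qed.

Lemma expect_augm_cons (Q : probability (borel nab) R) (f : borel nab -> R) l r s :
  bmeas f -> all (fun e => e.2 != 0%N) s ->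
  expect Q (fun w => f w * (pnabla w l r.+1 * augm (pnabla w) s)) =
  expect Q (fun w => f w * augm (pnabla w) ((l, r.+1) :: s)) +
  \sum_(t <- merges (l, r.+1) s) expect Q (fun w => f w * augm (pnabla w) t).
Proof.
move=> bf s0.
have b1 : bmeas (fun w => f w * augm (pnabla w) ((l, r.+1) :: s)).
  by apply: bmeasM => //; exact: bmeas_augm.
rewrite big_seq big_mkcond /=.
pose F t (w : borel nab) := if t \in merges (l, r.+1) s then f w * augm (pnabla w) t else 0.
have bF t : bmeas (F t).
  rewrite /F; case: (boolP (t \in merges (l, r.+1) s)) => [ts|_]; last exact: bmeas_cst.
  by apply: bmeasM => //; apply: bmeas_augm; exact: (merges_parts ts _ s0).1.
rewrite (eq_bigr (fun t => expect Q (F t))); last first.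
  by move=> t _; rewrite /F; case: (boolP (t \in merges (l, r.+1) s)) => // _; rewrite expect_cst.
rewrite -expect_sum // -expectD //; last exact: bmeas_sum.
congr (expect _ _); apply/funext => w.
rewrite augm_cons mulrBr /= (_ : \sum_(t <- _) F t w =
   f w * \sum_(t <- merges (l, r.+1) s) augm (pnabla w) t) ?subrK //.
rewrite mulr_sumr [RHS]big_seq [RHS]big_mkcond /=.
by apply: eq_bigr => t _; rewrite /F; case: ifP.
Qed.

(** Multiplying [augm] by a power sum gives [augm] with one more part plus the merges, so by
    induction every product of power sums is a sum of values of [augm]. The extra factor
    [augm (pnabla w) s] keeps the induction going. *)
Lemma moments_of_augm (Q Q' : probability (borel nab) R) :
  (forall s, all (fun e => e.2 != 0%N) s ->
     expect Q (fun w => augm (pnabla w) s) = expect Q' (fun w => augm (pnabla w) s)) ->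
  forall rho, expect Q (moment rho) = expect Q' (moment rho).
Proof.
move=> H rho.
suff main s : all (fun e => e.2 != 0%N) s ->
    expect Q (fun w => moment rho w * augm (pnabla w) s) =
    expect Q' (fun w => moment rho w * augm (pnabla w) s).
  have := main [::] isT; congr (_ = _); congr (expect _ _);
  by apply/funext => w; rewrite augm_nil mulr1.
elim: rho s => [|[l r] rho IHrho] s s0.
  have E (Q0 : probability (borel nab) R) :
      expect Q0 (fun w => moment [::] w * augm (pnabla w) s) =
      expect Q0 (fun w => augm (pnabla w) s).
    by congr (expect _ _); apply/funext => w; rewrite /moment big_nil mul1r.
  by rewrite !E H.
have E (Q0 : probability (borel nab) R) :
    expect Q0 (fun w => moment ((l, r) :: rho) w * augm (pnabla w) s) =
    expect Q0 (fun w => moment rho w * (pnabla w l r.+1 * augm (pnabla w) s)).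
  congr (expect _ _); apply/funext => w; rewrite /moment big_cons /=; ring.
rewrite !E !expect_augm_cons //; try exact: bmeas_moment.
rewrite IHrho //; congr (_ + _); apply: eq_big_seq => t ts.
by rewrite IHrho //; exact: (merges_parts ts _ s0).1.
Qed.

Definition shape_la (s : seq ('I_k.+1 * nat)) (l : 'I_k.+1) : seq nat :=
  sort geq [seq e.2 | e <- s & e.1 == l].

Lemma perm_shape_la s : perm_eq (parts (shape_la s)) s.
Proof.
apply/allP => -[l r] _ /=; rewrite count_parts /shape_la.
rewrite (seq.permP (permEl (perm_sort _ _))) count_map count_filter.
by apply/eqP; apply: eq_count => -[l' r']; rewrite /= xpair_eqE andbC.
Qed.

Lemma shape_la_multipartition s n : all (fun e => e.2 != 0%N) s ->
  sumn (map snd s) = n -> is_multipartition n (shape_la s).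
Proof.
move=> s0 sn; apply/andP; split.
  apply/forallP => l; apply/andP; split.
    by apply: sort_sorted => i j; rewrite /geq /= leq_total.
  rewrite mem_sort; apply/negP => /mapP[e]; rewrite mem_filter => /andP[_ es] e0.
  by have := allP s0 _ es; rewrite -e0.
rewrite -sn -(perm_sumn (perm_map snd (perm_shape_la s))) sumnE big_map big_parts.
by apply/eqP; apply: eq_bigr => l _; rewrite sumnE.
Qed.

(** Every element lies in the class labelled by its own shape, so the formula can be read element by
    element, with the kernel replaced by [Kkernel_Kclass]. *)
Lemma represented_byP (Pn : forall n, probability (borel (wreath gT n)) R)
    (Q : probability (borel nab) R) :
  represented_by c Pn Q <-> forall n (x : wreath gT n), (1 <= n)%N ->
    Pn n [set x] = ((weight c (shape x))%:R^-1 *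
      expect Q (fun w => augm (pnabla w) (shape x)))%:E.
Proof.
have key n La (x : wreath gT n) : is_multipartition n La -> x \in Kclass c n La ->
    ((#|Kclass c n La|%:R^-1)%:E * \int[Q]_w (Kkernel La w)%:E)%E =
    ((weight c (shape x))%:R^-1 * expect Q (fun w => augm (pnabla w) (shape x)))%:E.
  move=> LaP; rewrite Kclass_shape // => px.
  have K0 : #|Kclass c n La|%:R != 0 :> R.
    rewrite pnatr_eq0 -lt0n; apply/card_gt0P; exists x.
    by rewrite Kclass_shape.
  have KE : (fun w : nab => (Kkernel La w)%:E) = (fun w => (#|Kclass c n La|%:R *
      ((weight c (parts La))%:R^-1 * augm (pnabla w) (parts La)))%:E).
    by apply/funext => w; rewrite -(Kkernel_Kclass hc w LaP) mulVKf.
  have ba : bmeas (fun w : borel nab => augm (pnabla w) (parts La)).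
    exact/bmeas_augm/(parts_neq0 LaP).
  rewrite KE integral_expect; last by do 2 apply: bmeasZ.
  rewrite expectZ ?expectZ //; last exact: bmeasZ.
  rewrite -EFinM mulKf // (perm_weight c px).
  by under eq_fun do rewrite -(augm_perm _ px).
split=> [H n x n1|H n La n1 LaP x xK].
  have LaP := shape_la_multipartition (shape_gt0 c x) (sumn_shape c x).
  have xK : x \in Kclass c n (shape_la (shape x)).
    by rewrite Kclass_shape // perm_sym perm_shape_la.
  by rewrite (H n _ n1 LaP x xK) (key n _ x).
by rewrite (key n _ x) // H.
Qed.

(** No explicit element is built: the right-hand side of the counting formula is positive, so the
    number of elements is not 0. *)
Lemma shape_ex s n : all (fun e => e.2 != 0%N) s -> sumn (map snd s) = n ->
  exists x : wreath gT n, perm_eq (shape x) s.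
Proof.
move=> s0 sn; have := card_shape hc s0 sn.
have [[x px] _|no] := pselect (exists x : wreath gT n, perm_eq (shape x) s).
  by exists x.
rewrite eq_card0 => [|x]; last by rewrite inE; apply/negP => px; apply: no; exists x.
rewrite !mul0n => /esym/eqP.
by rewrite muln_eq0 !gtn_eqF ?fact_gt0 ?(weight_gt0 hc).
Qed.

Lemma represented_unique Pn (Q Q' : probability (borel nab) R) :
  represented_by c Pn Q -> represented_by c Pn Q' -> eq_on_measurable Q Q'.
Proof.
move=> /represented_byP HQ /represented_byP HQ'.
apply/nabla_moments/moments_of_augm => s s0.
(* Total degree 0 is not covered by the formula, which starts at n = 1; there the list is empty and
   [augm] is 1. *)
have [s1|] := posnP (sumn (map snd s)).
  case: s s0 s1 => [|e s] /=; first by rewrite /augm /= !expect_cst.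
  by case/andP => + _; case: e.2.
move=> n1; have [x px] := shape_ex s0 erefl.
have := HQ _ x n1; rewrite (HQ' _ x n1) => -[/mulfI H].
under eq_fun do rewrite -(augm_perm _ px).
by apply/esym/H; rewrite invr_eq0 pnatr_eq0 -lt0n (weight_gt0 hc).
Qed.

End Representation.

(** * Image measures *)

Section Pushforward.
Local Open Scope ring_scope.
Local Open Scope classical_set_scope.
Context {d d' : measure_display} {T : measurableType d} {T' : measurableType d'}.
Variables (R : realType) (P : probability T R) (f : T -> T').
Hypothesis mf : measurable_fun setT f.

Let mf_mixin := isMeasurableFun.Build _ _ _ _ _ mf.
Let mf_pack : {mfun T >-> T'} := HB.pack f mf_mixin.

Definition push : probability T' R := distribution P mf_pack.

Lemma pushE A : push A = P (f @^-1` A).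
Proof. by []. Qed.

Lemma expect_push (g : T' -> R) : bmeas g -> expect push g = expect P (g \o f).
Proof.
move=> bg; have bgf : bmeas (g \o f).
  split; last by have [M gM] := bg.2; exists M => t; exact: gM.
  exact: measurableT_comp bg.1 mf.
apply: EFin_inj; rewrite -!integral_expect //.
rewrite (integral_pushforward (mu := P) mf) //.
- by apply/measurable_EFinP; exact: bg.1.
- exact: (bmeas_integrable P bgf).
Qed.

End Pushforward.

(** * Cylinders in the space of virtual permutations *)

Section Cylinders.
Local Open Scope classical_set_scope.
Variable gT : finGroupType.
Notation vperm := (virtual_perm gT).
Implicit Types (x y : vperm).

Lemma wdown_vcoord j n x : @wdown gT j n (vcoord (j + n) x) = vcoord n x.
Proof. by elim: j => //= j IHj; rewrite wproj_vcoord. Qed.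

Lemma vcoord_le n m x y : (n <= m)%N -> vcoord m x = vcoord m y -> vcoord n x = vcoord n y.
Proof.
move=> nm; rewrite -(subnK nm) => e.
by rewrite -(wdown_vcoord (m - n) n x) e wdown_vcoord.
Qed.

Lemma wemb_id n (w : wreath gT n) : wemb (leqnn n) w = w.
Proof.
apply: wreath_eqP => i; rewrite ?ffunE ?permE /wemb_perm_fun;
  (case: insubP => [j _ ej|]; last by rewrite ltn_ord);
  have -> : j = i by exact: val_inj.
- by [].
- exact: val_inj.
Qed.

Lemma wemb1 m n (h : (m <= n)%N) : wemb h (1%g : wreath gT m) = 1%g.
Proof.
apply: wreath_eqP => i; rewrite ?ffunE ?permE /wemb_perm_fun; case: insubP => [j _ ej|] //.
- by rewrite ffunE.
- by rewrite perm1; exact: val_inj.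
Qed.

(** The translate by [w] of the sequence of identities passes through [w]. *)
Lemma vcoord_surj n (w : wreath gT n) : exists x, vcoord n x = w.
Proof.
exists (vact w 1%g (point : vperm)).
by rewrite (vcoord_vact _ _ _ (leqnn n)) wemb1 wemb_id invg1 mul1g mul1g.
Qed.

Definition level n (A : set vperm) := forall x y, vcoord n x = vcoord n y -> A x -> A y.

Lemma level_le n m A : (n <= m)%N -> level n A -> level m A.
Proof. by move=> nm nA x y /(vcoord_le nm); exact: nA. Qed.

Definition cylinder A := exists n, level n A.

Lemma cylinder0 : cylinder set0. Proof. by exists 0%N. Qed.

Lemma cylinderU : setU_closed cylinder.
Proof.
move=> A B [n nA] [m mB]; exists (maxn n m) => x y xy [Ax|Bx].
  by left; apply: level_le nA _ _ xy Ax; exact: leq_maxl.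
by right; apply: level_le mB _ _ xy Bx; exact: leq_maxr.
Qed.

Lemma cylinderC : setC_closed cylinder.
Proof. by move=> A [n nA]; exists n => x y xy nAx Ay; apply: nAx; exact: nA Ay. Qed.

Lemma ultra_finite_cst T (U : set_system T) (I : finType) (f : T -> I) :
  UltraFilter U -> exists v, U (f @^-1` [set v]).
Proof.
move=> UU; apply: contrapT => /forallNP H.
have {}H v : U (~` (f @^-1` [set v])).
  by have [/H|] := in_ultra_setVsetC (f @^-1` [set v]) UU.
have : U [set t | forall v, ~ f t = v] by exact: filter_forall.
by move=> /filter_ex[t /(_ (f t))].
Qed.

(* Finite intersection property of cylinders, through a limit point along an
   ultrafilter of the sequence of witnesses. *)
Lemma cylinder_compact (F : nat -> set vperm) (C : set vperm) :
  cylinder C -> (forall i, cylinder (F i)) -> C `<=` \bigcup_i F i ->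
  exists N, C `<=` \bigcup_(i < N) F i.
Proof.
move=> [n0 nC] cF CF; apply: contrapT => /forallNP H.
have {}H N : exists x, C x /\ forall i, (i < N)%N -> ~ F i x.
  have /existsNP[x /not_implyP[Cx nFx]] := H N; exists x; split=> // i iN Fx.
  by apply: nFx; exists i.
pose x N := projT1 (cid (H N)).
have xP N : C (x N) /\ forall i, (i < N)%N -> ~ F i (x N) by exact: (projT2 (cid (H N))).
have [U [UU oU]] := ultraFilterLemma eventually_filter.
have cst m : exists v, U [set N | vcoord m (x N) = v].
  exact: (ultra_finite_cst (fun N => vcoord m (x N)) UU).
pose y m := projT1 (cid (cst m)).
have yP m : U [set N | vcoord m (x N) = y m] by exact: (projT2 (cid (cst m))).
have yc : (y : prod_topology (wreath gT)) \in coherent (gT := gT).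
  apply/mem_set => m; have [N [e1 e2]] := filter_ex (filterI (yP m) (yP m.+1)).
  by rewrite -e1 -e2 wproj_vcoord.
pose z : vperm := exist _ (y : prod_topology (wreath gT)) yc.
have zP m : U [set N | vcoord m (x N) = vcoord m z] by exact: yP.
have Cz : C z.
  by have [N e] := filter_ex (zP n0); exact: nC e (xP N).1.
have [i _ Fz] := CF z Cz; have [m mF] := cF i.
have big : U [set N | (i < N)%N] by apply: oU; exact: nbhs_infty_gt.
have [N [e iN]] := filter_ex (filterI (zP m) big).
by apply: (xP N).2 iN _; apply: mF Fz.
Qed.

Lemma cylinder_open A : cylinder A -> open (A : set vperm).
Proof.
have vc m : continuous (@vcoord gT m : vperm -> wreath gT m).
  move=> x; apply: (@continuous_comp _ _ _ (fun x : vperm => set_val x)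
    (fun y : prod_topology (wreath gT) => y m)); first exact: initial_continuous.
  exact: proj_continuous.
move=> [n nA]; rewrite (_ : A = @vcoord gT n @^-1` (@vcoord gT n @` A)).
  by apply: open_comp => [x _|]; [exact: vc | exact: discrete_open].
apply/seteqP; split=> [x Ax|x [y Ay e]]; first by exists x.
exact: nA e Ay.
Qed.

(** Otherwise points outside [U] that agree with [x] up to higher and higher levels would converge
    to [x]. *)
Lemma open_cylinder (U : set vperm) x : open U -> U x ->
  exists n, forall y, vcoord n y = vcoord n x -> U y.
Proof.
move=> oU Ux; apply: contrapT => /forallNP H.
have {}H n : exists y, vcoord n y = vcoord n x /\ ~ U y.
  by have /existsNP[y /not_implyP[e nU]] := H n; exists y.
pose y n := projT1 (cid (H n)).
have yP n : vcoord n (y n) = vcoord n x /\ ~ U (y n) by exact: (projT2 (cid (H n))).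
have yx : y @ \oo --> x.
  suff yx : (fun n => set_val (y n)) @ \oo --> (set_val x : prod_topology (wreath gT)).
    move=> V [_ [[W oW <-] /= Wx WV]].
    have : \forall n \near \oo, W (set_val (y n)) by apply: yx; exact: open_nbhs_nbhs.
    by apply: filterS => n; exact: WV.
  apply/cvg_sup => m V [_ [[W oW <-] /= Wx WV]].
  suff : \forall n \near \oo, V (set_val (y n)) by [].
  near=> n; apply: WV; rewrite /=.
  have -> : set_val (y n) m = set_val x m; last by [].
  apply: vcoord_le (yP n).1; near: n; exact: nbhs_infty_ge.
have : \forall n \near \oo, U (y n) by apply: yx; exact: open_nbhs_nbhs.
by move=> /filter_ex[n]; exact: (yP n).2.
Unshelve. all: by end_near. Qed.

(** The groups G_n are finite, so there are countably many elementary cylinders, and an open set is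
    the union of those that it contains. *)
Lemma borel_cylinder : @measurable _ (borel vperm) = <<s cylinder >>.
Proof.
apply/seteqP; split; last first.
  by apply: sub_smallest2r; [exact: smallest_sigma_algebra | exact: cylinder_open].
apply: smallest_sub; first exact: smallest_sigma_algebra.
move=> U oU.
pose I := {n : nat & wreath gT n}.
pose cyl (i : I) := @vcoord gT (tag i) @^-1` [set tagged i].
rewrite (_ : U = \bigcup_(i : I) if `[< cyl i `<=` U >] then cyl i else set0).
  apply: (@countable_bigcupT_measurable _ (g_sigma_algebraType cylinder)).
    exact: countableP.
  move=> i; apply: sub_sigma_algebra; case: ifP => _; last exact: cylinder0.
  by exists (tag i) => x y e; rewrite /cyl /= => <-.
apply/seteqP; split=> [x Ux|x [i _]]; last by case: ifP => // /asboolP; apply.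
have [n nU] := open_cylinder oU Ux.
by exists (existT _ n (vcoord n x)) => //=; rewrite ifT //; apply/asboolP.
Qed.

End Cylinders.

Fact cyl_display : measure_display. Proof. exact: default_measure_display. Qed.

(** A second name for the space, carrying the algebra of cylinders from which the measure is
    extended. *)
Definition cyl_vperm (gT : finGroupType) : Type := virtual_perm gT.
HB.instance Definition _ (gT : finGroupType) := Pointed.on (cyl_vperm gT).
HB.instance Definition _ (gT : finGroupType) := isAlgebraOfSets.Build cyl_display
  (cyl_vperm gT) (@cylinder0 gT) (@cylinderU gT) (@cylinderC gT).

(** * Construction of a measure from coherent masses *)

Section FinitePreimage.
Local Open Scope ring_scope.
Local Open Scope classical_set_scope.
Context {d : measure_display} {T : measurableType d}.
Variables (R : realType) (Q : probability T R) (I : finType) (f : T -> I).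
Hypothesis mf : forall i, measurable (f @^-1` [set i]).

Lemma prob_preimage (B : set I) :
  Q (f @^-1` B) = (\sum_(i | i \in B) Q (f @^-1` [set i]))%E.
Proof.
have QF (s : seq I) : uniq s -> Q (\big[setU/set0]_(i <- s) (f @^-1` [set i])) =
    (\sum_(i <- s) Q (f @^-1` [set i]))%E.
  elim: s => [|i s IHs]; first by rewrite !big_nil measure0.
  move=> /= /andP[ys us]; rewrite !big_cons -(IHs us); apply: measureU => //.
    exact: bigsetU_measurable.
  rewrite -bigcup_seq; apply/seteqP; split=> // x [Fx [z /= zs Fzx]].
  by move: ys; rewrite -(Fx : _ = i) (Fzx : _ = z) zs.
rewrite -big_enum_cond /= -[RHS]big_filter -QF ?filter_uniq -?enumT ?enum_uniq //.
congr (Q _); rewrite -bigcup_seq; apply/seteqP; split=> [x Bx|x [i /=]].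
  exists (f x) => //=; rewrite mem_filter /= fintype.mem_enum unfold_in.
  by case: pselect.
by rewrite mem_filter /= fintype.mem_enum unfold_in; case: pselect => // Bi _ e;
  rewrite /preimage /= (e : f x = i).
Qed.

End FinitePreimage.

Section Extension.
Local Open Scope ring_scope.
Local Open Scope classical_set_scope.
Variables (R : realType) (gT : finGroupType) (mu : forall n, wreath gT n -> R).
Notation vperm := (virtual_perm gT).

Hypothesis mu_ge0 : forall n (y : wreath gT n), 0 <= mu y.
Hypothesis mu_total : \sum_(y : wreath gT 0) mu y = 1.
Hypothesis mu_coh : forall n (y : wreath gT n), mu y = \sum_(z | wproj z == y) mu z.

Definition base n (A : set vperm) : pred (wreath gT n) :=
  fun y => `[< exists x, vcoord n x = y /\ A x >].

Definition mass n (A : set vperm) : R := \sum_(y : wreath gT n | base A y) mu y.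

Lemma baseE n (A : set vperm) x : level n A -> base (n := n) A (vcoord n x) = `[< A x >].
Proof.
move=> nA; apply/asboolP/asboolP => [[x' [e Ax']]|Ax]; last by exists x.
exact: nA e Ax'.
Qed.

Lemma massS n (A : set vperm) : level n A -> mass n.+1 A = mass n A.
Proof.
move=> nA; rewrite /mass; under [RHS]eq_bigr do rewrite mu_coh.
rewrite (partition_big (@wproj gT n) (base A)) /=; last first.
  by move=> z /asboolP[x [<- Ax]]; apply/asboolP; exists x; rewrite wproj_vcoord.
apply: eq_bigr => y Ay; apply: eq_bigl => z.
case: (wproj z =P y) => [zy|]; rewrite ?andbF // andbT.
have [x xz] := vcoord_surj z.
rewrite -xz baseE; last exact: level_le nA.
by rewrite -(baseE _ nA) -wproj_vcoord xz zy.
Qed.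

Lemma mass_level n m (A : set vperm) : (n <= m)%N -> level n A -> mass m A = mass n A.
Proof.
move=> nm nA; rewrite -(subnK nm); elim: (m - n)%N => // j IHj.
by rewrite addSn massS ?IHj //; apply: level_le nA; rewrite leq_addl.
Qed.

(** The level is picked by choice; by coherence every admissible level gives the same mass
    ([cyl_contentE]). *)
Definition cyl_content (A : set (cyl_vperm gT)) : \bar R :=
  if pselect (cylinder A) is left cA then (mass (projT1 (cid cA)) A)%:E else 0%E.

Lemma cyl_contentE n A : level n A -> cyl_content A = (mass n A)%:E.
Proof.
move=> nA; rewrite /cyl_content; case: pselect => [cA|[]]; last by exists n.
case: cid => m mA /=; congr (_%:E).
by rewrite -(mass_level (leq_maxl m n) mA) (mass_level (leq_maxr m n) nA).
Qed.

Lemma mass_ge0 n A : 0 <= mass n A. Proof. exact: sumr_ge0. Qed.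

Lemma cyl_content_ge0 A : (0 <= cyl_content A)%E.
Proof. by rewrite /cyl_content; case: pselect => // ?; rewrite lee_fin mass_ge0. Qed.

Lemma cyl_content0 : cyl_content set0 = 0%E.
Proof.
rewrite (@cyl_contentE 0) // /mass big_pred0 // => y.
by apply/asboolP => -[x []].
Qed.

Lemma cyl_contentU A B : cylinder A -> cylinder B -> A `&` B = set0 ->
  cyl_content (A `|` B) = (cyl_content A + cyl_content B)%E.
Proof.
move=> [n nA] [m mB] AB; pose N := maxn n m.
have NA : level N A by apply: level_le nA; exact: leq_maxl.
have NB : level N B by apply: level_le mB; exact: leq_maxr.
have NAB : level N (A `|` B).
  by move=> x y xy [Ax|Bx]; [left; exact: NA xy Ax | right; exact: NB xy Bx].
rewrite !(@cyl_contentE N) // -EFinD; congr (_%:E); rewrite /mass.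
rewrite (bigID (base (n := N) A)) /=; congr (_ + _); apply: eq_bigl => y;
  have [x <-] := vcoord_surj y; rewrite !baseE //.
  by apply/andP/asboolP => [[_ /asboolP]|Ax] //; split; apply/asboolP => //; left.
apply/andP/asboolP => [[/asboolP[] // Ax /asboolP]|Bx] //.
split; apply/asboolP; first by right.
by move=> Ax; have : (A `&` B) x by []; rewrite AB.
Qed.

Lemma cyl_content_additive : measure_function.semi_additive cyl_content.
Proof.
by apply/additive2P; [exact: cyl_content0 | move=> A B cA cB; exact: cyl_contentU].
Qed.

HB.instance Definition _ := isContent.Build _ _ R cyl_content
  cyl_content_ge0 cyl_content_additive.

(** By compactness a disjoint sequence of cylinders whose union is a cylinder has only finitely many
    nonempty members, so finite additivity is enough. *)
Lemma cyl_content_sigma_additive : semi_sigma_additive cyl_content.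
Proof.
move=> F cF tF cUF.
have [N NP] : exists N, \bigcup_i F i `<=` \bigcup_(i < N) F i.
  exact: cylinder_compact.
have F0 i : (N <= i)%N -> F i = set0.
  move=> Ni; apply/seteqP; split=> // x Fx.
  have [j /= jN Fjx] : (\bigcup_(i < N) F i) x by apply: NP; exists i.
  have ij : i = j by apply: tF => //; exists x.
  by move: jN; rewrite -ij ltnNge Ni.
have -> : \bigcup_i F i = \big[setU/set0]_(i < N) F i.
  rewrite -bigcup_mkord; apply/seteqP; split=> // x [i _ Fx]; by exists i.
rewrite measure_semi_additive //; last first.
  by rewrite -bigcup_mkord; rewrite (_ : \bigcup_(i < N) F i = \bigcup_i F i) //;
     apply/seteqP; split=> // x [i _ Fx]; exists i.
apply: cvg_near_cst; near=> n.
have Nn : (N <= n)%N by near: n; exact: nbhs_infty_ge.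
rewrite (big_cat_nat _ Nn) //= big_mkord.
rewrite [X in (_ + X)%E](_ : _ = 0%E) ?adde0 // big_nat big1 // => i /andP[Ni _].
by rewrite F0 // cyl_content0.
Unshelve. all: by end_near. Qed.

HB.instance Definition _ := Content_isMeasure.Build _ _ R cyl_content
  cyl_content_sigma_additive.

Definition cyl_extension := measure_extension cyl_content.

HB.instance Definition _ := Measure.on cyl_extension.

Lemma cyl_extensionE n (A : set vperm) : level n A -> cyl_extension A = (mass n A)%:E.
Proof.
move=> nA; rewrite /cyl_extension /measure_extension measurable_mu_extE; last by exists n.
exact: cyl_contentE.
Qed.

Lemma cyl_extensionT : cyl_extension setT = 1%E.
Proof.
rewrite (@cyl_extensionE 0) // /mass -mu_total; congr (_%:E); apply: eq_bigl => y.
by apply/asboolP; have [x e] := vcoord_surj y; exists x.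
Qed.

HB.instance Definition _ :=
  Measure_isProbability.Build _ _ _ cyl_extension cyl_extensionT.

(** The extension lives on the sigma-algebra generated by the cylinders, which is the Borel one by
    [borel_cylinder]; the identity map carries it over. *)
Lemma kolmogorov : exists P : probability (borel vperm) R,
  forall n (A : set vperm), level n A -> P A = (mass n A)%:E.
Proof.
pose I := g_sigma_algebraType (@measurable _ (cyl_vperm gT)).
have mid : measurable_fun setT ((id : vperm -> vperm) : I -> borel vperm).
  by move=> _ A; rewrite setTI borel_cylinder.
by exists (push cyl_extension mid) => n A nA; exact: (cyl_extensionE nA).
Qed.

End Extension.

(** * Measures on virtual permutations, their marginals and centrality *)

Section VpermMeasurability.
Local Open Scope classical_set_scope.
Variables (gT : finGroupType).
Notation vperm := (virtual_perm gT).

Lemma measurable_cylinder (A : set vperm) : cylinder A -> measurable (A : set (borel vperm)).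
Proof. by move=> cA; apply: sub_sigma_algebra; exact: cylinder_open. Qed.

Lemma level_vcoord n (B : set (wreath gT n)) : level n (@vcoord gT n @^-1` B).
Proof. by move=> x y e; rewrite /= e. Qed.

Lemma measurable_vcoord n :
  measurable_fun setT (@vcoord gT n : borel vperm -> borel (wreath gT n)).
Proof.
by move=> _ B _; rewrite setTI; apply: measurable_cylinder; exists n; exact: level_vcoord.
Qed.

Lemma wreath_measurable n (B : set (borel (wreath gT n))) : measurable B.
Proof. by apply: sub_sigma_algebra; exact: discrete_open. Qed.

End VpermMeasurability.

Section VpermUnique.
Local Open Scope ring_scope.
Local Open Scope classical_set_scope.
Variables (R : realType) (gT : finGroupType).
Notation vperm := (virtual_perm gT).

Variables P P' : probability (borel vperm) R.

Lemma vperm_unique : (forall n (y : wreath gT n),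
    P (@vcoord gT n @^-1` [set y]) = P' (@vcoord gT n @^-1` [set y])) ->
  eq_on_measurable P P'.
Proof.
move=> H A mA.
apply: (@measure_unique _ R (borel vperm) (@cylinder gT) (fun=> setT)) => //.
- exact: borel_cylinder.
- move=> B C [n nB] [m mC]; exists (maxn n m) => x y xy [Bx Cx]; split.
    by apply: level_le nB _ _ xy Bx; exact: leq_maxl.
  by apply: level_le mC _ _ xy Cx; exact: leq_maxr.
- by move=> _; exists 0%N.
- by apply/seteqP; split=> // x _; exists 0%N.
- move=> B [n nB]; have -> : B = @vcoord gT n @^-1` (@vcoord gT n @` B).
    by apply/seteqP; split=> [x Bx|x [y By e]]; [exists x | exact: nB e By].
  have mv y : measurable (@vcoord gT n @^-1` [set y] : set (borel vperm)).
    by apply: measurable_cylinder; exists n; exact: level_vcoord.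
  apply: etrans (prob_preimage P mv _) (etrans _ (esym (prob_preimage P' mv _))).
  by apply: eq_bigr => y _; exact: H.
- by move=> _; rewrite (le_lt_trans (probability_le1 P measurableT)) // ltry.
Qed.

End VpermUnique.

Section CentralMarginals.
Local Open Scope ring_scope.
Local Open Scope classical_set_scope.
Variables (R : realType) (gT : finGroupType).
Notation vperm := (virtual_perm gT).
Implicit Types P : probability (borel vperm) R.

Definition marginal P n : probability (borel (wreath gT n)) R :=
  push P (@measurable_vcoord gT n).

Lemma marginalE P n (A : set (wreath gT n)) : marginal P n A = P (@vcoord gT n @^-1` A).
Proof. by []. Qed.

Lemma marginal_proj_limit P : is_proj_limit P (marginal P).
Proof. by []. Qed.

Lemma vcoord_vact_conj n m (w : wreath gT m) (h : (m <= n)%N) (x : vperm) :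
  vcoord n (vact w w x) = (vcoord n x ^ wemb h w)%g.
Proof. by rewrite (vcoord_vact _ _ _ h) conjgE mulgA. Qed.

Lemma wcentral_marginal P n : vcentral P -> wcentral (marginal P n).
Proof.
move=> cP g A _; rewrite !marginalE.
have mA : measurable (@vcoord gT n @^-1` A : set (borel vperm)).
  by apply: measurable_cylinder; exists n; exact: level_vcoord.
rewrite -(cP n g _ mA); congr (P _); apply/seteqP; split=> x;
  by rewrite /preimage /= (vcoord_vact_conj g (leqnn n)) wemb_id.
Qed.

Lemma wcentral_point n (Q : probability (borel (wreath gT n)) R) :
  (forall g y, Q [set (y ^ g)%g] = Q [set y]) -> wcentral Q.
Proof.
move=> Qc g A _.
have mT (B : set (borel (wreath gT n))) : measurable B by exact: wreath_measurable.
rewrite (prob_preimage (f := fun x : borel (wreath gT n) => (x ^ g)%g) Q) //.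
rewrite [in RHS](_ : A = id @^-1` A) // (prob_preimage (f := (id : borel (wreath gT n) -> wreath gT n)) Q) //.
apply: eq_bigr => y _; rewrite -[RHS](Qc g^-1%g); congr (Q _).
by apply/seteqP; split=> x /= => [<-|->]; rewrite ?conjgK ?conjgKV.
Qed.

Lemma measurable_vact m (w1 w2 : wreath gT m) :
  measurable_fun setT (vact w1 w2 : borel vperm -> borel vperm).
Proof.
have mcyl (B : set (borel vperm)) : cylinder B -> measurable (vact w1 w2 @^-1` B : set (borel vperm)).
  move=> [n nB]; apply: measurable_cylinder; exists (m + n)%N => x y e.
  apply: nB; apply: (@vcoord_le _ n (m + n)%N); first exact: leq_addl.
  by rewrite !(vcoord_vact _ _ _ (leq_addr n m)) e.
move=> _ B mB; rewrite setTI.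
have : <<s @cylinder gT >> B by rewrite -borel_cylinder.
apply: (smallest_sub (C := sigma_algebra setT) (X := [set B | measurable (vact w1 w2 @^-1` B : set (borel vperm))])); last first.
  by move=> C /mcyl.
split=> /=; first by rewrite preimage_set0; exact: measurable0.
- by move=> C mC; rewrite setTD preimage_setC; exact: measurableC.
- by move=> F mF; rewrite preimage_bigcup; exact: bigcup_measurable.
Qed.

(** An event at level n and an element of G_m are both visible at level max(m, n), where the action
    is an ordinary conjugation; events at finite levels determine the measure. *)
Lemma vcentral_marginal P : (forall n, wcentral (marginal P n)) -> vcentral P.
Proof.
move=> cP m w A mA.
rewrite -(pushE P (measurable_vact w w)).
apply: vperm_unique mA => n y; rewrite pushE.
have [x xy] := vcoord_surj y.
have [h h'] : (n <= maxn m n)%N /\ (m <= maxn m n)%N by rewrite leq_maxl leq_maxr.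
pose B : set (wreath gT (maxn m n)) := @vcoord gT _ @` (@vcoord gT n @^-1` [set y]).
have vB z : B (vcoord (maxn m n) z) <-> vcoord n z = y.
  split=> [[z' /= zy /(vcoord_le h) <-] //|zy]; by exists z.
have := cP _ (wemb h' w) B (@wreath_measurable _ _ _); rewrite !marginalE => cB.
have eB : @vcoord gT n @^-1` [set y] = @vcoord gT _ @^-1` B.
  by apply/seteqP; split=> z /= => /vB.
rewrite eB -cB; congr (P _); apply/seteqP; split=> z.
  by rewrite /preimage /= (vcoord_vact_conj w h').
by rewrite /preimage /= (vcoord_vact_conj w h').
Qed.

Lemma represented_proj_unique k (c : 'I_k.+1 -> {set gT}) (hc : enumerates_classes c)
    P P' Pn Pn' Pi :
  is_proj_limit P Pn -> is_proj_limit P' Pn' ->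
  represented_by c Pn Pi -> represented_by c Pn' Pi -> eq_on_measurable P P'.
Proof.
move=> lP lP' /(represented_byP hc) rP /(represented_byP hc) rP'.
apply: vperm_unique => n y.
have := lP n [set y] (@wreath_measurable _ _ _); rewrite /pushforward => ->.
have := lP' n [set y] (@wreath_measurable _ _ _); rewrite /pushforward => ->.
(* At level 0 the formula says nothing, but the group is trivial and its only element has mass 1. *)
case: n y => [|n] y; last by rewrite rP ?rP'.
have -> : [set y] = setT :> set (wreath gT 0).
  by apply/seteqP; split=> // z _; apply: wreath_eqP => -[].
by rewrite !probability_setT.
Qed.

End CentralMarginals.

(** * From a measure on [nabla] to a central measure *)

Section Converse.
Local Open Scope ring_scope.
Local Open Scope classical_set_scope.
Variables (R : realType) (gT : finGroupType) (k : nat) (c : 'I_k.+1 -> {set gT}).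
Hypothesis hc : enumerates_classes c.
Notation nab := (nabla R k.+1).
Notation vperm := (virtual_perm gT).
Variable Pi : probability (borel nab) R.
Notation shape := (shape c).

Definition pimass n (y : wreath gT n) : R :=
  (weight c (shape y))%:R^-1 * expect Pi (fun w => augm (pnabla w) (shape y)).

Lemma pimass_ge0 n (y : wreath gT n) : 0 <= pimass y.
Proof.
apply: mulr_ge0; first by rewrite invr_ge0 ler0n.
apply: expect_ge0 => w; rewrite -(augm_perm _ (perm_shape_la (shape y))).
apply: (@augm_pnabla_ge0 _ _ n); apply: shape_la_multipartition; last exact: sumn_shape.
exact: shape_gt0.
Qed.

Lemma bmeas_shape n (y : wreath gT n) :
  bmeas (fun w : borel nab => augm (pnabla w) (shape y)).
Proof. exact/bmeas_augm/shape_gt0. Qed.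

Lemma pimassE n (y : wreath gT n) :
  pimass y = expect Pi (fun w => (wt c idfun (pnabla w) (shape y) : R)).
Proof. by rewrite /pimass -expectZ //; exact: bmeas_shape. Qed.

(** At each point of [nabla] this is [sum_wt_wins], where the factor is the sum of the delta^(l),
    that is 1. *)
Lemma pimass_coh n (y : wreath gT n) : pimass y = \sum_(z | wproj z == y) pimass z.
Proof.
rewrite sum_wproj pimassE; under [RHS]eq_bigr do under eq_bigr do rewrite pimassE.
have bw m (z : wreath gT m) : bmeas (fun w : borel nab => (wt c idfun (pnabla w) (shape z) : R)).
  by apply: bmeasZ; exact: bmeas_shape.
under [RHS]eq_bigr do rewrite -expect_sum //.
rewrite -expect_sum; last by move=> j; exact: bmeas_sum.
congr (expect Pi _); apply/funext => w; rewrite sum_wt_wins // (eq_bigr _ (fun l _ => pnabla1 w l)).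
by rewrite sum_nabla_delta mul1r.
Qed.

Lemma wreath0 (y : wreath gT 0) : y = 1%g.
Proof. by apply: wreath_eqP => -[]. Qed.

Lemma pimass_total : \sum_(y : wreath gT 0) pimass y = 1.
Proof.
rewrite (big_pred1 (1%g : wreath gT 0)) => [|y]; last exact/esym/eqP/wreath0.
rewrite /pimass; have -> : shape (1%g : wreath gT 0) = [::].
  apply/eqP; rewrite -size_eq0; have := sumn_shape c (1%g : wreath gT 0).
  by case: (shape _) (shape_gt0 c (1%g : wreath gT 0)) => //= -[l []].
rewrite /weight big_nil invr1 mul1r (_ : (fun _ => _) = fun=> 1) ?expect_cst //.
Qed.

Lemma converse : exists P : probability (borel vperm) R,
  (forall n, wcentral (marginal P n)) /\ represented_by c (marginal P) Pi.
Proof.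
have [P PP] := kolmogorov pimass_ge0 pimass_total pimass_coh.
have P1 n (y : wreath gT n) : marginal P n [set y] = (pimass y)%:E.
  rewrite marginalE (PP n); last exact: level_vcoord.
  congr (_%:E); rewrite /mass (big_pred1 y) // => z; apply/asboolP/eqP => [[x [<- xy]]|->].
    exact: xy.
  by have [x e] := vcoord_surj y; exists x.
exists P; split; last by apply/(represented_byP hc) => n x _; exact: P1.
move=> n; apply: wcentral_point => g y; rewrite !P1 /pimass.
have := shape_conj hc g^-1%g y; rewrite invgK -mulgA -conjgE => e.
by rewrite (perm_weight _ e) (funext (fun w => augm_perm (pnabla w) e)).
Qed.

End Converse.

(** * Averages over tuples of integers *)

Section IteratedAverage.
Local Open Scope ring_scope.
Variable R : realType.
Implicit Types (ns : seq nat) (F G : seq nat -> R).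

(** The expectation of [F] at independent uniform integers. The ranges may differ, as in a product
    of frequencies at two levels. *)
Fixpoint iavg ns F : R :=
  if ns is n :: ns' then n%:R^-1 * \sum_(i < n) iavg ns' (fun s => F (val i :: s))
  else F [::].

Lemma eq_iavg ns F G : (forall s, all2 ltn s ns -> F s = G s) -> iavg ns F = iavg ns G.
Proof.
elim: ns F G => [|n ns IHns] F G FG /=; first exact: FG.
congr (_ * _); apply: eq_bigr => i _; apply: IHns => s sns.
by apply: FG; rewrite /= ltn_ord.
Qed.

Lemma iavg_cat ns ns' F :
  iavg (ns ++ ns') F = iavg ns (fun s => iavg ns' (fun s' => F (s ++ s'))).
Proof.
elim: ns F => [|n ns IHns] F //=.
by congr (_ * _); apply: eq_bigr => i _; rewrite IHns.
Qed.

Lemma iavgZ ns a F : iavg ns (fun s => a * F s) = a * iavg ns F.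
Proof.
elim: ns F => [|n ns IHns] F //=.
by under eq_bigr do rewrite IHns; rewrite -mulr_sumr mulrCA.
Qed.

Lemma iavg_sum (I : finType) (Q : pred I) ns (F : I -> seq nat -> R) :
  iavg ns (fun s => \sum_(v | Q v) F v s) = \sum_(v | Q v) iavg ns (F v).
Proof.
elim: ns F => [|n ns IHns] F //=.
under eq_bigr do rewrite IHns.
by rewrite exchange_big /= mulr_sumr.
Qed.

Lemma iavg_all n r (p : pred nat) :
  iavg (nseq r n) (fun s => (all p s)%:R) = (#|[pred i : 'I_n | p i]|%:R / n%:R) ^+ r.
Proof.
elim: r => [|r IHr] //=.
under eq_bigr do (under eq_iavg => s _ do rewrite -mulnb natrM); rewrite exprS -IHr.
under eq_bigr do rewrite iavgZ.
rewrite -mulr_suml mulrA [_^-1 * _]mulrC; congr (_ / _ * _).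
rewrite -sum1_card natr_sum [RHS]big_mkcond /=.
by apply: eq_bigr => i _; rewrite inE; case: (p i).
Qed.

Lemma avg_dist m (f : 'I_m -> R) (q : R) : (0 < m)%N ->
  `|m%:R^-1 * \sum_(i < m) f i - q| <= m%:R^-1 * \sum_(i < m) `|f i - q|.
Proof.
move=> m0; have mR : m%:R != 0 :> R by rewrite pnatr_eq0 -lt0n.
have -> : m%:R^-1 * \sum_(i < m) f i - q = m%:R^-1 * \sum_(i < m) (f i - q).
  by rewrite sumrB sumr_const card_ord mulrBr -(mulr_natl q) mulKf.
rewrite normrM ger0_norm ?invr_ge0 ?ler0n // ler_wpM2l ?invr_ge0 ?ler0n //.
exact: ler_norm_sum.
Qed.

Lemma iavg_dist1 ns F (q : R) : all (ltn 0) ns -> (forall s, `|F s - q| <= 1) ->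
  `|iavg ns F - q| <= 1.
Proof.
elim: ns F => [|m ns IHns] F /=; first by move=> _; exact.
case/andP=> m0 ns0 F1; apply: le_trans (avg_dist _ _ m0) _.
have mR : 0 < m%:R :> R by rewrite ltr0n.
rewrite mulrC ler_pdivrMr // mul1r -[leRHS]mulr1n.
apply: le_trans (ler_sum _ (_ : forall i : 'I_m, true -> _ <= 1)) _.
  by move=> i _; apply: IHns.
by rewrite sumr_const card_ord.
Qed.

(** Only tuples with a repetition contribute, each at most 1. Every coordinate repeats one of at
    most [size pre + size ns] earlier values, with probability at most 1/n for each. [pre] holds the
    values already drawn. *)
Lemma iavg_bound ns (n : nat) F (q : R) (pre : seq nat) : (0 < n)%N ->
  all (leq n) ns -> uniq pre ->
  (forall s, `|F s - q| <= 1) ->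
  (forall s, size s = size ns -> uniq (pre ++ s) -> F s = q) ->
  `|iavg ns F - q| <= (size ns * (size pre + size ns))%:R / n%:R.
Proof.
move=> n0; elim: ns F pre => [|m ns IHns] F pre /= nns upre F1 Fq.
  by rewrite (Fq [::]) ?cats0 // subrr normr0 mulr_ge0 ?invr_ge0 ?ler0n.
case/andP: nns => nm nns; have m0 : (0 < m)%N by exact: leq_trans nm.
have mR : 0 < m%:R :> R by rewrite ltr0n.
have nR : 0 < n%:R :> R by rewrite ltr0n.
pose B : R := (size ns * ((size pre).+1 + size ns))%:R / n%:R.
have B0 : 0 <= B by rewrite divr_ge0 ?ler0n.
have step (i : 'I_m) : `|iavg ns (fun s => F (val i :: s)) - q| <= B + (val i \in pre)%:R.
  case: (boolP (val i \in pre)) => ipre.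
    apply: le_trans (iavg_dist1 _ _) _ => //; last by rewrite lerDr.
    by apply: sub_all nns => p; exact: leq_trans.
  rewrite addr0; apply: (IHns _ (val i :: pre)) => //; first by rewrite /= ipre.
  move=> s ss us; apply: Fq; first by rewrite /= ss.
  by move: us; rewrite -cat1s -catA uniq_catCA.
apply: le_trans (avg_dist _ _ m0) _.
apply: le_trans (ler_wpM2l _ (ler_sum _ (fun i _ => step i))) _.
  by rewrite invr_ge0 ler0n.
rewrite big_split /= sumr_const card_ord mulrDr -(mulr_natl B) mulKf ?gt_eqF //.
have cnt : \sum_(i < m) (val i \in pre)%:R <= (size pre)%:R :> R.
  rewrite -natr_sum ler_nat -(big_mkord xpredT (fun i => (i \in pre : nat))) /=.
  rewrite -big_mkcond sum1_count -size_filter uniq_leq_size ?filter_uniq ?iota_uniq //.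
  by move=> i; rewrite mem_filter => /andP[].
have : m%:R^-1 * \sum_(i < m) (val i \in pre)%:R <= (size pre)%:R / n%:R :> R.
  rewrite mulrC ler_pM ?invr_ge0 ?ler0n ?sumr_ge0 //.
  by rewrite lef_pV2 ?posrE // ler_nat.
move=> h; apply: le_trans (lerD (lexx _) h) _.
rewrite /B -mulrDl ler_wpM2r ?invr_ge0 ?ler0n // -natrD ler_nat; lia.
Qed.
End IteratedAverage.

(** * Sampling from a finite coloured partition *)

Section PatternCount.
Local Open Scope ring_scope.
Variables (R : realType) (L T : eqType).

(** The event that tagged integers realise a prescribed coloured partition: equal tags mean the same
    block, different tags different blocks, and each tag prescribes a colour. *)
Definition hard (cT : T -> L) (S : rel nat) (C : nat -> L) (z : seq (nat * T)) :=
  all (fun p => (C p.1 == cT p.2) && all (fun q => S p.1 q.1 == (p.2 == q.2)) z) z.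

Lemma hardP cT S C z : reflect
  ((forall p, p \in z -> C p.1 = cT p.2) /\
   (forall p q, p \in z -> q \in z -> S p.1 q.1 = (p.2 == q.2)))
  (hard cT S C z).
Proof.
apply: (iffP allP) => [H|[H1 H2] p pz].
  split=> [p /H/andP[/eqP] //|p q pz qz].
  by have /andP[_ /allP/(_ q qz)/eqP] := H p pz.
by rewrite H1 // eqxx; apply/allP => q qz; rewrite H2.
Qed.

Variables (S : rel nat) (C : nat -> L) (n : nat).
Hypotheses (Srefl : reflexive S) (Ssym : ssrbool.symmetric S)
  (Strans : forall i j, S i j -> S i =1 S j) (SC : forall i j, S i j -> C i = C j).

Definition srep (v : 'I_n) := [forall j : 'I_n, S v j ==> (v <= j)%N].

(** A power of the relative size of a block, carried by its least element alone; summed over [v] it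
    gives a power sum of the block frequencies of one colour. *)
Definition block (e : L * nat) (v : 'I_n) : R :=
  if srep v && (C v == e.1) then (#|[pred j : 'I_n | S v j]|%:R / n%:R) ^+ e.2 else 0.

Lemma srep_ex (i : 'I_n) : exists2 v, srep v & S v i.
Proof.
have [v Sv vmin] := @arg_minnP _ i (fun v : 'I_n => S v i) val (Srefl i).
exists v => //; apply/forallP => j; apply/implyP => Svj; apply: vmin.
by rewrite -(Strans Svj).
Qed.

Lemma srep_uniq (v w : 'I_n) : srep v -> srep w -> S v w -> v = w.
Proof.
move=> /forallP/(_ w)/implyP rv /forallP/(_ v)/implyP rw Svw; apply: val_inj.
by apply/eqP; rewrite eqn_leq rv ?rw // Ssym.
Qed.

Lemma blockM (a b : L * nat) (v : 'I_n) : block b v * block a v =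
  if b.1 == a.1 then block (b.1, (b.2 + a.2)%N) v else 0.
Proof.
rewrite /block /=; case: (srep v) => /=; last by rewrite mul0r if_same.
case: (C v =P b.1) => [->|Cb]; last first.
  by rewrite mul0r; case: eqP => // ->.
by case: eqP => _; rewrite ?mulr0 // exprD.
Qed.

Definition avoids (A : {set 'I_n}) (a : seq nat) :=
  all (fun i => [forall v in A, ~~ S (val v) i]) a.

Lemma avoidsP (A : {set 'I_n}) (a : seq nat) : reflect (forall i v, i \in a -> v \in A -> ~~ S (val v) i) (avoids A a).
Proof.
apply: (iffP allP) => [H i v ia vA|H i ia].
  by have /forallP/(_ v)/implyP := H i ia; apply.
by apply/forallP => v; apply/implyP => vA; exact: H.
Qed.

Lemma zip_nseq (b : seq nat) (t : T) : zip b (nseq (size b) t) = [seq (i, t) | i <- b].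
Proof. by elim: b => //= i b ->. Qed.

Lemma mem_zip1 (a : seq nat) (ts : seq T) i : size a = size ts -> i \in a ->
  exists2 q, q \in ts & (i, q) \in zip a ts.
Proof.
move=> sz; rewrite -[X in i \in X -> _](unzip1_zip (t := ts)) ?sz //.
move=> /mapP[[j q] z ->]; exists q => //.
by rewrite -[ts](unzip2_zip (s := a)) ?sz //; apply/mapP; exists (j, q).
Qed.

Lemma mem_zip (a : seq nat) (ts : seq T) p : p \in zip a ts -> (p.1 \in a) /\ (p.2 \in ts).
Proof.
elim: a ts => [|i a IHa] [|t ts] //=; rewrite !in_cons => /orP[/eqP -> /=|/IHa[-> ->]].
  by rewrite !eqxx.
by rewrite !orbT.
Qed.

Variables (cT : T -> L) (mu : T -> nat).
Definition tags rs := flatten [seq nseq (mu t) t | t <- rs].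

(** The integers tagged [t] realise their part of the pattern exactly when they fill a single block
    of the right colour that the other tags avoid. This is the recursion of [injsum], with blocks as
    variables and [A] as the set of blocks already used. *)
Lemma hard_step t rs (A : {set 'I_n}) (b a : seq nat) : t \notin rs ->
  (forall v, v \in A -> srep v) -> b != [::] -> all (fun i => i < n)%N b ->
  size a = size (tags rs) ->
  (hard cT S C (zip (b ++ a) (nseq (size b) t ++ tags rs)) && avoids A (b ++ a))%:R =
  \sum_(v | v \notin A) ((srep v && (C v == cT t))%:R * ((all (S v) b)%:R *
     (hard cT S C (zip a (tags rs)) && avoids (v |: A) a)%:R)) :> R.
Proof.
move=> trs repA b0 bn sa.
have tags_rs q : q \in tags rs -> q \in rs.
  by move=> /flattenP[_ /mapP[u urs ->]]; rewrite mem_nseq => /andP[_ /eqP ->].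
have nt q : q \in tags rs -> (t == q) = false.
  by move=> /tags_rs qrs; apply/eqP => tq; rewrite tq qrs in trs.
have [i0 i0b] : exists i, i \in b by case: b b0 {bn} => // i b' _; exists i; exact: mem_head.
have i0n : (i0 < n)%N by exact: (allP bn).
have [v0 rv0 Sv0] := srep_ex (Ordinal i0n).
rewrite zip_cat ?size_nseq // zip_nseq.
(* A block other than that of [i0] cannot contain all of [b], so at most one summand is nonzero. *)
have term v : v != v0 -> (srep v && (C v == cT t))%:R * ((all (S v) b)%:R *
     (hard cT S C (zip a (tags rs)) && avoids (v |: A) a)%:R) = 0 :> R.
  move=> vv0; case: (boolP (srep v)) => rv /=; last by rewrite mulr0n mul0r.
  case: (boolP (S v i0)) => Svi; last first.
    by rewrite (_ : all (S v) b = false) ?mul0r ?mulr0 //; apply/negbTE/allPn; exists i0.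
  case/eqP: vv0; apply: srep_uniq => //.
  by rewrite (Strans Svi) Ssym.
have e0 : (0 : R) = false%:R by [].
case: (boolP (v0 \in A)) => v0A.
  rewrite big1 => [|v vA]; last by apply: term; apply: contraNneq vA => ->.
  rewrite e0; congr (nat_of_bool _)%:R; apply/negbTE/negP => /andP[_ /avoidsP/(_ i0 v0)].
  by rewrite mem_cat i0b => /(_ isT v0A); rewrite Sv0.
rewrite (bigD1 v0) //= big1 ?addr0 => [|v /andP[_ vv0]]; last exact: term.
rewrite rv0 /= -!natrM !mulnb; congr (nat_of_bool _)%:R.
have sv i : S v0 i = S i0 i by exact: (Strans Sv0).
apply/andP/and3P => [[/hardP[H1 H2] /avoidsP Hf]|[/eqP Cv /allP Sb /andP[/hardP[H1 H2] /avoidsP Hf]]].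
  have zb i : i \in b -> (i, t) \in [seq (i, t) | i <- b] ++ zip a (tags rs).
    by move=> ib; rewrite mem_cat map_f.
  have za p : p \in zip a (tags rs) -> p \in [seq (i, t) | i <- b] ++ zip a (tags rs).
    by rewrite mem_cat orbC => ->.
  split.
  - by rewrite (SC Sv0) (H1 _ (zb _ i0b)).
  - by apply/allP => i ib; rewrite sv (H2 _ _ (zb _ i0b) (zb _ ib)) eqxx.
  - apply/andP; split.
      by apply/hardP; split=> [p /za/H1|p q /za pz /za qz] //; exact: H2.
    apply/avoidsP => i v ia; rewrite !inE => /orP[/eqP ->|vA]; last first.
      by apply: Hf; rewrite // mem_cat ia orbT.
    have [q qt iq] := mem_zip1 sa ia.
    by rewrite sv (H2 _ _ (zb _ i0b) (za _ iq)) nt.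
have cross i p : i \in b -> p \in zip a (tags rs) -> S i p.1 = false.
  move=> ib /mem_zip[pa _]; apply/negbTE.
  by rewrite -(Strans (Sb _ ib)); apply: Hf => //; rewrite !inE eqxx.
split.
  apply/hardP; split=> [p|p q]; rewrite !mem_cat.
    move=> /orP[/mapP[i ib ->] /=|/H1 //].
    by rewrite -Cv; apply/esym/SC/Sb.
  move=> /orP[/mapP[i ib ->] /=|pz] /orP[/mapP[j jb ->] /=|qz].
  - by rewrite eqxx -(Strans (Sb _ ib)) Sb.
  - by rewrite cross // nt //; have [] := mem_zip qz.
  - by rewrite Ssym cross // eq_sym nt //; have [] := mem_zip pz.
  - exact: H2.
apply/avoidsP => i v; rewrite mem_cat => /orP[ib|ia] vA; last first.
  by apply: Hf; rewrite // !inE vA orbT.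
apply/negP => Svi; case/negP: v0A; rewrite (_ : v0 = v) //.
apply: srep_uniq => //; first exact: repA.
by rewrite (Strans (Sb _ ib)) Ssym.
Qed.

Lemma iavg_hard rs (A : {set 'I_n}) : uniq rs -> all (fun t => mu t != 0%N) rs ->
  (forall v, v \in A -> srep v) ->
  iavg (nseq (size (tags rs)) n)
    (fun a => (hard cT S C (zip a (tags rs)) && avoids A a)%:R) =
  injsum block [seq (cT t, mu t) | t <- rs] A.
Proof.
elim: rs A => [|t rs IHrs] A //= /andP[trs urs] /andP[mt mrs] repA.
rewrite size_cat size_nseq nseqD iavg_cat.
transitivity (iavg (nseq (mu t) n) (fun b => \sum_(v | v \notin A)
   (srep v && (C v == cT t))%:R * (iavg (nseq (size (tags rs)) n) (fun a =>
     (hard cT S C (zip a (tags rs)) && avoids (v |: A) a)%:R) * (all (S v) b)%:R) : R)).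
  apply: eq_iavg => b bn; under eq_bigr do rewrite [X in _ * X]mulrC -iavgZ -iavgZ.
  rewrite -iavg_sum; apply: eq_iavg => a an.
  have [sb {}bn] : size b = mu t /\ all (fun i => i < n)%N b.
    by elim: (mu t) b bn => [|m IH] [|i b] //= /andP[-> /IH[-> ->]].
  have sa : size a = size (tags rs).
    by elim: (size _) a an => [|m IH] [|i a] //= /andP[_ /IH ->].
  rewrite /tags /= -sb (hard_step (t := t)) //.
  by rewrite -size_eq0 sb.
rewrite iavg_sum [RHS](eq_bigr (fun v => (srep v && (C v == cT t))%:R * (iavg (nseq (size (tags rs)) n) (fun a =>
     (hard cT S C (zip a (tags rs)) && avoids (v |: A) a)%:R) *
     (#|[pred j : 'I_n | S v j]|%:R / n%:R) ^+ mu t))).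
  by apply: eq_bigr => v _; rewrite !iavgZ iavg_all.
move=> v _; rewrite /block /=; case: (boolP (srep v)) => rv /=; last by rewrite !mul0r.
case: eqP => _; last by rewrite !mul0r.
rewrite mul1r mulrC IHrs // => u; rewrite !inE => /orP[/eqP ->//|]; exact: repA.
Qed.

Definition block_sum (l : L) (r : nat) : R := \sum_v block (l, r) v.

(** At the power sums of the block frequencies, [augm] is the probability that independent uniform
    integers below n realise the pattern: both are sums over injective choices of blocks. *)
Lemma augm_block rs : uniq rs -> all (fun t => mu t != 0%N) rs ->
  augm block_sum [seq (cT t, mu t) | t <- rs] =
  iavg (nseq (size (tags rs)) n) (fun a => (hard cT S C (zip a (tags rs)))%:R).
Proof.
move=> urs mrs; rewrite augm_injsum; last by move=> *; exact: blockM.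
rewrite -iavg_hard // => [|v]; last by rewrite inE.
apply: eq_iavg => a _; rewrite (_ : avoids _ a) ?andbT //.
by apply/avoidsP => i v _; rewrite inE.
Qed.

End PatternCount.

(** * The exchangeable coloured partition of the integers *)

Section VirtualCycles.
Local Open Scope ring_scope.
Local Open Scope classical_set_scope.
Variables (gT : finGroupType) (k : nat) (c : 'I_k.+1 -> {set gT}).
Hypothesis hc : enumerates_classes c.
Notation vperm := (virtual_perm gT).
Implicit Types x : vperm.

(** Read at the first level that contains both points; later levels agree by [same_vcoord_le]. *)
Definition vsame x (i j : nat) : bool :=
  same (vcoord (maxn i j).+1 x) (inord i) (inord j).

Definition vcol x (i : nat) : 'I_k.+1 := col c (vcoord i.+1 x) ord_max.

Lemma val_lift_ex n (i : 'I_n.+1) : (val i < n)%N ->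
  exists2 j : 'I_n, i = lift ord_max j & val j = val i.
Proof.
by move=> h; exists (Ordinal h) => //; apply: val_inj; rewrite val_lift_max.
Qed.

Lemma same_vcoord_le n m x (i j : 'I_n) (i' j' : 'I_m) : (n <= m)%N ->
  val i' = val i -> val j' = val j ->
  same (vcoord m x) i' j' = same (vcoord n x) i j.
Proof.
elim: m i' j' => [|m IHm] i' j'; first by case: i' => ? [].
rewrite leq_eqVlt => /orP[/eqP e|nm] ei ej.
  by subst n; congr (same _ _ _); apply: val_inj.
have [i1 e1 ei1] : exists2 u : 'I_m, i' = lift ord_max u & val u = val i'.
  by apply: val_lift_ex; rewrite ei (leq_trans (ltn_ord i)).
have [j1 e2 ej1] : exists2 u : 'I_m, j' = lift ord_max u & val u = val j'.
  by apply: val_lift_ex; rewrite ej (leq_trans (ltn_ord j)).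
by rewrite e1 e2 same_wproj wproj_vcoord; apply: IHm => //; rewrite ?ei1 ?ej1.
Qed.

Lemma col_vcoord_le n m x (i : 'I_n) (i' : 'I_m) : (n <= m)%N -> val i' = val i ->
  col c (vcoord m x) i' = col c (vcoord n x) i.
Proof.
elim: m i' => [|m IHm] i'; first by case: i' => ? [].
rewrite leq_eqVlt => /orP[/eqP e|nm] ei.
  by subst n; congr (col c _ _); apply: val_inj.
have [i1 e1 ei1] : exists2 u : 'I_m, i' = lift ord_max u & val u = val i'.
  by apply: val_lift_ex; rewrite ei (leq_trans (ltn_ord i)).
by rewrite e1 col_wproj // wproj_vcoord; apply: IHm => //; rewrite ei1.
Qed.

Lemma vsameE n x (i j : 'I_n) : vsame x i j = same (vcoord n x) i j.
Proof.
apply/esym/same_vcoord_le.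
- by rewrite gtn_max !ltn_ord.
- by rewrite /= inordK // ltnS leq_maxl.
- by rewrite /= inordK // ltnS leq_maxr.
Qed.

Lemma vcolE n x (i : 'I_n) : vcol x i = col c (vcoord n x) i.
Proof. by apply/esym/col_vcoord_le. Qed.

Lemma vsame_refl x : reflexive (vsame x).
Proof. by move=> i; rewrite /vsame same_refl. Qed.

Lemma vsame_sym x : ssrbool.symmetric (vsame x).
Proof. by move=> i j; rewrite /vsame maxnC same_sym. Qed.

Lemma vsame_trans x i j : vsame x i j -> vsame x i =1 vsame x j.
Proof.
move=> + l; pose n := (maxn (maxn i j) l).+1.
have [hi hj hl] : [/\ (i < n)%N, (j < n)%N & (l < n)%N] by rewrite /n; split; lia.
rewrite -[i]/(val (Ordinal hi)) -[j]/(val (Ordinal hj)) -[l]/(val (Ordinal hl)).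
rewrite !vsameE; exact: same_trans.
Qed.

Lemma vsame_col x i j : vsame x i j -> vcol x i = vcol x j.
Proof.
pose n := (maxn i j).+1.
have [hi hj] : (i < n)%N /\ (j < n)%N by rewrite /n; split; lia.
rewrite -[i]/(val (Ordinal hi)) -[j]/(val (Ordinal hj)) vsameE !vcolE.
by move=> /(same_col hc).
Qed.

Definition wperm_nat m (w : wreath gT m) (i : nat) : nat :=
  if insub i : option 'I_m is Some j then val (wperm w j) else i.

Lemma wperm_wemb m n (h : (m <= n)%N) (w : wreath gT m) (i : 'I_n) :
  val (wperm (wemb h w) i) = wperm_nat w i.
Proof. by rewrite permE /wemb_perm_fun /wperm_nat; case: insubP. Qed.

Lemma vsame_vact m (w : wreath gT m) x i j :
  vsame (vact w w x) i j = vsame x (wperm_nat w i) (wperm_nat w j).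
Proof.
pose n := (maxn m (maxn i j)).+1.
have [h hi hj] : [/\ (m <= n)%N, (i < n)%N & (j < n)%N] by rewrite /n; split; lia.
rewrite -[i]/(val (Ordinal hi)) -[j]/(val (Ordinal hj)) -!(wperm_wemb h) !vsameE.
rewrite (vcoord_vact _ _ _ h) -[X in (_ * _ * X)%g]invgK.
by rewrite -{1}[Ordinal hi](permK (wperm (wemb h w))) -{1}[Ordinal hj](permK (wperm (wemb h w))) same_conj.
Qed.

Lemma vcol_vact m (w : wreath gT m) x i : vcol (vact w w x) i = vcol x (wperm_nat w i).
Proof.
pose n := (maxn m i).+1.
have [h hi] : (m <= n)%N /\ (i < n)%N by rewrite /n; split; lia.
rewrite -[i]/(val (Ordinal hi)) -!(wperm_wemb h) !vcolE.
rewrite (vcoord_vact _ _ _ h) -[X in (_ * _ * X)%g]invgK.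
by rewrite -{1}[Ordinal hi](permK (wperm (wemb h w))) col_conj.
Qed.

(** Any two injective tuples of equal length are matched by a finite permutation, here with trivial
    group components. *)
Lemma wperm_nat_ex (a b : seq nat) : uniq a -> uniq b -> size a = size b ->
  exists n (w : wreath gT n), map (wperm_nat w) a = b.
Proof.
move=> ua ub sab; pose n := (\max_(i <- a ++ b) i).+1.
have ltn_ab i : i \in a ++ b -> (i < n)%N.
  by move=> iab; rewrite ltnS; exact: leq_bigmax_seq.
(* Both lists are completed to enumerations of 0, .., n-1, and the permutation matches equal
   positions. *)
pose ext s := s ++ [seq i <- iota 0 n | i \notin s].
have perm_ext s : uniq s -> {subset s <= a ++ b} -> perm_eq (ext s) (iota 0 n).
  move=> us sab'; apply: uniq_perm; rewrite ?iota_uniq //.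
    rewrite cat_uniq us filter_uniq ?iota_uniq // andbT.
    by apply/hasPn => i; rewrite mem_filter => /andP[].
  move=> i; rewrite mem_cat mem_filter mem_iota /=.
  by case: (boolP (i \in s)) => //= /sab'/ltn_ab.
have pa : perm_eq (ext a) (iota 0 n) by apply: perm_ext => // i ia; rewrite mem_cat ia.
have pb : perm_eq (ext b) (iota 0 n) by apply: perm_ext => // i ib; rewrite mem_cat ib orbT.
have szE s : perm_eq s (iota 0 n) -> size s = n by move/perm_size; rewrite size_iota.
have memE s i : perm_eq s (iota 0 n) -> (i \in s) = (i < n)%N.
  by move/perm_mem ->; rewrite mem_iota.
have uE s : perm_eq s (iota 0 n) -> uniq s by move/perm_uniq ->; exact: iota_uniq.
pose t i := nth 0%N (ext b) (index i (ext a)).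
have tn i : (i < n)%N -> (t i < n)%N.
  by move=> ilt; rewrite -(memE (ext b)) // mem_nth // (szE (ext b)) // -[X in (_ < X)%N](szE (ext a)) // index_mem memE.
pose f (i : 'I_n) : 'I_n := Ordinal (tn i (ltn_ord i)).
have finj : injective f.
  have idx (u : 'I_n) : (index (val u) (ext a) < size (ext b))%N.
    by rewrite (szE (ext b)) // -[X in (_ < X)%N](szE (ext a)) // index_mem memE ?ltn_ord.
  move=> i j /(congr1 val) /= /eqP; rewrite /t nth_uniq ?uE ?idx // => /eqP.
  move/(congr1 (nth 0%N (ext a))); rewrite !nth_index ?memE ?ltn_ord //; exact: val_inj.
pose w : wreath gT n := Wreath [ffun => 1%g] (perm finj).
exists n; exists w.
apply: (@eq_from_nth _ 0%N); rewrite size_map // => p pa'.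
rewrite (nth_map 0%N) // /wperm_nat.
have ia : nth 0%N a p \in a by exact: mem_nth.
rewrite insubT /=; first by apply: ltn_ab; rewrite mem_cat ia.
move=> h; rewrite permE /= /t.
have -> : nth 0%N a p = nth 0%N (ext a) p by rewrite nth_cat pa'.
rewrite index_uniq ?uE // ?nth_cat -?sab ?pa' //.
by rewrite size_cat (leq_trans pa') // leq_addr.
Qed.

(** Events about a tuple that commute with renaming the integers and depend only on the relations
    and colours of the listed integers. The first property yields exchangeability, the second
    measurability. *)
Definition natural (E : rel nat -> (nat -> 'I_k.+1) -> seq nat -> bool) :=
  (forall S C t a, E (fun i j => S (t i) (t j)) (C \o t) a = E S C (map t a)) /\
  (forall S S' C C' a, {in a &, S =2 S'} -> {in a, C =1 C'} -> E S C a = E S' C' a).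

Variable R : realType.
Variable P : probability (borel vperm) R.

Lemma measurable_natural E a : natural E ->
  measurable ([set x | E (vsame x) (vcol x) a] : set (borel vperm)).
Proof.
move=> [_ extE]; apply: measurable_cylinder; pose n := (\max_(i <- a) i).+1.
have ltn_a i : i \in a -> (i < n)%N by move=> ia; rewrite ltnS; exact: leq_bigmax_seq.
exists n => x y e /=; rewrite (extE _ (vsame y) _ (vcol y)) // => [i j /ltn_a hi /ltn_a hj|i /ltn_a hi].
  by rewrite -[i]/(val (Ordinal hi)) -[j]/(val (Ordinal hj)) !vsameE e.
by rewrite -[i]/(val (Ordinal hi)) !vcolE e.
Qed.

Lemma bmeas_natural E a : natural E ->
  bmeas (fun x : borel vperm => (E (vsame x) (vcol x) a)%:R : R).
Proof.
move=> nE; have := bmeas_indic (R := R) (measurable_natural a nE).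
rewrite (_ : (fun _ => _) = fun x : borel vperm => (E (vsame x) (vcol x) a)%:R) //.
by apply/funext => x; congr (nat_of_bool _)%:R; apply/idP/idP; rewrite inE.
Qed.

Lemma expect_natural E a : natural E ->
  expect P (fun x => (E (vsame x) (vcol x) a)%:R) = fine (P [set x | E (vsame x) (vcol x) a]).
Proof.
move=> nE; rewrite -(expect_indic P (measurable_natural a nE)).
congr (expect P _); apply/funext => x; congr (nat_of_bool _)%:R.
by apply/idP/idP; rewrite inE.
Qed.

Hypothesis cP : vcentral P.

(** Conjugating by an element that carries [a] to [b] renames the partition accordingly, and the
    measure is invariant. *)
Lemma exchangeable E a b : natural E -> uniq a -> uniq b -> size a = size b ->
  expect P (fun x => (E (vsame x) (vcol x) a)%:R) =
  expect P (fun x => (E (vsame x) (vcol x) b)%:R).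
Proof.
move=> nE ua ub sab; have [n [w wab]] := wperm_nat_ex ua ub sab.
have ev x : E (vsame (vact w w x)) (vcol (vact w w x)) a = E (vsame x) (vcol x) b.
  rewrite -wab -nE.1; apply: nE.2 => [i j _ _|i _]; [exact: vsame_vact | exact: vcol_vact].
rewrite !expect_natural // -(cP w (measurable_natural a nE)).
congr (fine _).
have -> // : vact w w @^-1` [set x | E (vsame x) (vcol x) a] = [set x | E (vsame x) (vcol x) b].
by apply/seteqP; split=> x; rewrite /preimage /= ev.
Qed.

Lemma expect_iavg (E : seq nat -> borel vperm -> R) (ns : seq nat) :
  (forall s, bmeas (E s)) ->
  bmeas (fun x : borel vperm => iavg ns (fun s => E s x)) /\
  expect P (fun x : borel vperm => iavg ns (fun s => E s x)) = iavg ns (fun s => expect P (E s)).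
Proof.
elim: ns E => [|n ns IHns] E bE /=; first by split; [exact: bE|].
have b (i : 'I_n) := (IHns _ (fun s => bE (val i :: s))).1.
split; first by apply: bmeasZ; apply: bmeas_sum.
rewrite expectZ; last exact: bmeas_sum.
congr (_ * _); rewrite expect_sum //; apply: eq_bigr => i _.
exact: (IHns _ (fun s => bE (val i :: s))).2.
Qed.

Lemma expect_natural_itv E a : natural E ->
  0 <= expect P (fun x => (E (vsame x) (vcol x) a)%:R) <= 1.
Proof.
move=> nE; rewrite expect_ge0 => [|x]; last exact: ler0n.
rewrite -[leRHS](expect_cst P 1); apply: le_expect => [||x].
- exact: bmeas_natural.
- exact: bmeas_cst.
- by case: (E _ _ _); rewrite ?lexx ?ler01.
Qed.

(** By exchangeability injective tuples all give the same expectation, so only tuples with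
    repetitions cause an error. *)
Lemma expect_iavg_natural E ns n a : natural E -> (0 < n)%N -> all (leq n) ns ->
  uniq a -> size a = size ns ->
  `|expect P (fun x => iavg ns (fun s => (E (vsame x) (vcol x) s)%:R)) -
    expect P (fun x => (E (vsame x) (vcol x) a)%:R)| <= (size ns * size ns)%:R / n%:R.
Proof.
move=> nE n0 nns ua sa.
rewrite (expect_iavg _ (fun s => bmeas_natural s nE)).2.
apply: (iavg_bound (pre := [::])) => // [s|s ss us]; last by apply: exchangeable; rewrite ?ss.
have := expect_natural_itv s nE; have := expect_natural_itv a nE.
move: (expect P _) (expect P _) => p q /andP[p0 p1] /andP[q0 q1].
by rewrite ler_norml; apply/andP; split; lra.
Qed.

End VirtualCycles.

(** * The point of [nabla] given by a finite coloured partition *)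

Section FiniteFrequencies.
Local Open Scope ring_scope.
Local Open Scope classical_set_scope.
Variables (R : realType) (k : nat) (S : rel nat) (C : nat -> 'I_k.+1) (n : nat).
Hypotheses (Srefl : reflexive S) (Ssym : ssrbool.symmetric S)
  (Strans : forall i j, S i j -> S i =1 S j).
Hypothesis n_gt0 : (0 < n)%N.

Definition frequencies (l : 'I_k.+1) : seq R :=
  sort (fun a b => b <= a) [seq #|[pred j : 'I_n | S v j]|%:R / n%:R |
    v : 'I_n <- enum 'I_n & srep S v && (C v == l)].

Let x l i : R := nth 0 (frequencies l) i.

Let freq_ge0 l a : a \in frequencies l -> 0 <= a.
Proof. by rewrite mem_sort => /mapP[v _ ->]; rewrite divr_ge0 ?ler0n. Qed.

Let x_ge0 l i : 0 <= x l i.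
Proof.
rewrite /x; case: (ltnP i (size (frequencies l))) => h; last by rewrite nth_default.
by apply: (@freq_ge0 l); exact: mem_nth.
Qed.

Let x_nincr l i : x l i.+1 <= x l i.
Proof.
case: (ltnP i.+1 (size (frequencies l))) => h; last by rewrite {1}/x nth_default // x_ge0.
have /(sortedP 0)/(_ i h) : sorted (fun a b : R => b <= a) (frequencies l).
  by apply: sort_sorted => a b; exact: le_total.
by [].
Qed.

Let sum_frequencies l r : \sum_(a <- frequencies l) a ^+ r.+1 = block_sum R S C n l r.+1.
Proof.
rewrite (perm_big _ (permEl (perm_sort _ _))) big_map big_filter big_enum_cond /=.
by rewrite /block_sum big_mkcond; apply: eq_bigr => v _; rewrite /block /=; case: ifP.
Qed.

Let sum_x l r N : (size (frequencies l) <= N)%N ->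
  \sum_(i < N) x l i ^+ r.+1 = block_sum R S C n l r.+1.
Proof.
move=> h; rewrite -(big_mkord xpredT (fun i => x l i ^+ r.+1)) (big_cat_nat _ h) //=.
rewrite [X in _ + X](_ : _ = 0) ?addr0 -?sum_frequencies; last first.
  by rewrite big_nat big1 // => i /andP[hi _]; rewrite /x nth_default // expr0n.
by rewrite [RHS](big_nth 0).
Qed.

Lemma sum_block_sum1 : \sum_l block_sum R S C n l 1 = 1.
Proof.
rewrite /block_sum exchange_big /=.
have nR : n%:R != 0 :> R by rewrite pnatr_eq0 -lt0n.
transitivity (\sum_(v : 'I_n) \sum_(j : 'I_n) (srep S v && S v j)%:R / n%:R : R).
  apply: eq_bigr => v _; rewrite (bigD1 (C v)) //= big1 ?addr0; last first.
    by move=> l ne; rewrite /block /= eq_sym (negbTE ne) andbF.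
  rewrite /block /= eqxx andbT; case: (srep S v); last by rewrite big1 // => j _; rewrite mul0r.
  rewrite expr1 -mulr_suml -sum1_card natr_sum big_mkcond; congr (_ / _).
  by apply: eq_bigr => j _; rewrite inE; case: (S v j).
rewrite exchange_big /= (eq_bigr (fun=> n%:R^-1)) => [|j _].
  by rewrite sumr_const card_ord -(mulr_natl n%:R^-1) mulfV.
have [v rv Sv] := srep_ex Srefl Strans j.
rewrite (bigD1 v) //= rv Sv mul1r big1 ?addr0 // => w wv.
case: (boolP (srep S w)) => rw /=; last by rewrite mul0r.
case: (boolP (S w j)) => Sw; last by rewrite mul0r.
case/eqP: wv; apply: (srep_uniq Ssym) => //.
by rewrite (Strans Sw) Ssym.
Qed.

Let delta l : R := block_sum R S C n l 1.

Let partial_le l N : \sum_(i < N) x l i <= delta l.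
Proof.
rewrite /delta -(@sum_x l 0 _ (leq_maxr N (size (frequencies l)))).
under [leRHS]eq_bigr do rewrite expr1.
rewrite -!(big_mkord xpredT (fun i => x l i)).
rewrite [leRHS](big_cat_nat _ (leq_maxl N _)) //= lerDl.
exact: sumr_ge0.
Qed.

Let freq_nabla : ((x, delta) : nabla_ambient R k.+1) \in @nabla_set R k.+1.
Proof.
apply/mem_set; split=> //=; last exact: sum_block_sum1.
  by move=> l; apply: sumr_ge0 => v _; rewrite /block; case: ifP => // _; rewrite exprn_ge0 ?divr_ge0 ?ler0n.
move=> l; apply: lime_le.
  by apply: is_cvg_nneseries => i _ _; rewrite lee_fin.
by apply: nearW => N; rewrite sumEFin lee_fin big_mkord.
Qed.

(** Decreasing block frequencies padded by zeros. There is no dust, so its power sums, including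
    that of degree 1, are those of the blocks. *)
Definition freq_point : nabla R k.+1 := exist _ ((x, delta) : nabla_ambient R k.+1) freq_nabla.

Lemma pnabla_freq l r : pnabla freq_point l r.+1 = block_sum R S C n l r.+1.
Proof.
case: r => [|r]; first by rewrite pnabla1.
rewrite pnablaE; apply/cvg_lim => //; apply: cvg_near_cst.
near=> N; rewrite /series /= big_mkord sum_x //.
by near: N; exact: nbhs_infty_ge.
Unshelve. all: by end_near. Qed.

End FiniteFrequencies.

(** * Almost sure summability from geometric bounds in mean *)

Section AlmostSureSummability.
Local Open Scope ring_scope.
Local Open Scope classical_set_scope.
Context {d : measure_display} {T : measurableType d} {R : realType}.
Variables (P : probability T R) (D : nat -> T -> R) (K : R).
Hypotheses (K0 : 0 <= K) (bD : forall j, bmeas (D j)).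
Hypothesis ED : forall j, expect P (fun t => `|D j t|) <= K * 2^-1 ^+ j.

Lemma bmeas_norm (f : T -> R) : bmeas f -> bmeas (fun t => `|f t|).
Proof.
move=> [mf [M fM]]; split; first exact: measurableT_comp.
by exists M => t; rewrite normr_id.
Qed.

Definition summable_set : set T := [set t | (\sum_(j <oo) `|D j t|%:E < +oo)%E].

Let mDE j : measurable_fun setT (fun t => `|D j t|%:E).
Proof. by apply/measurable_EFinP; exact: (bmeas_norm (bD j)).1. Qed.

Let mS : measurable_fun setT (fun t => \sum_(j <oo) `|D j t|%:E)%E.
Proof. by apply: ge0_emeasurable_sum => // j t _ _; rewrite lee_fin. Qed.

Lemma measurable_summable_set : measurable summable_set.
Proof. by have := emeasurable_fun_infty_o measurableT mS +oo%E; rewrite setTI. Qed.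

(** The sum of the absolute values has finite expectation, bounded by a geometric series, hence is
    finite almost everywhere. *)
Lemma ae_summable_set : {ae P, forall t, summable_set t}.
Proof.
have fin : (\int[P]_t (\sum_(j <oo) `|D j t|%:E) < +oo)%E.
  rewrite integral_nneseries //.
  rewrite (eq_eseriesr (fun j _ => integral_expect P (bmeas_norm (bD j)))).
  apply: (@le_lt_trans _ _ (K * 2)%:E); last exact: ltry.
  apply: lime_le.
    by apply: is_cvg_nneseries => j _ _; rewrite lee_fin expect_ge0.
  apply: nearW => N; rewrite sumEFin lee_fin.
  apply: le_trans (ler_sum _ (fun j _ => ED j)) _.
  have := @geometric_le_lim R N K 2^-1 K0.
  rewrite /series /geometric /= => H; apply: le_trans (H _ _) _.
  - by rewrite invr_gt0.
  - by rewrite ger0_norm ?invr_ge0 // invf_lt1 // ltr1n.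
  - by rewrite (_ : 1 - 2^-1 = 2^-1 :> R) ?invrK //; lra.
have int : P.-integrable setT (fun t => \sum_(j <oo) `|D j t|%:E)%E.
  apply/integrableP; split=> //; under eq_integral => t _.
    by rewrite gee0_abs; [over | apply: nneseries_ge0 => j _ _; rewrite lee_fin].
  exact: fin.
have := integrable_ae measurableT int.
by apply: filterS => t /(_ I); rewrite /summable_set /= fin_numElt => /andP[].
Qed.

Lemma summable_set_cvg t : summable_set t -> cvgn (series (D ^~ t)).
Proof.
move=> Gt; apply: normed_cvg; apply: nondecreasing_is_cvgn.
  apply: nondecreasing_series => j _ _; exact: normr_ge0.
have S0 : (0 <= \sum_(j <oo) `|D j t|%:E)%E by apply: nneseries_ge0 => j _ _; rewrite lee_fin.
exists (fine (\sum_(j <oo) `|D j t|%:E)%E) => _ [N _ <-].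
rewrite -lee_fin fineK ?ge0_fin_numE // /series /= -sumEFin.
by apply: nneseries_lim_ge => j _ _; rewrite lee_fin.
Qed.

End AlmostSureSummability.

(** * Pattern events and second moments of the frequencies *)

Section TaggedEvents.
Variable k : nat.
Local Notation L := 'I_k.+1.

Definition tagged (T : eqType) (cT : T -> L) (ts : seq T) (S : rel nat) (C : nat -> L)
  (a : seq nat) := hard cT S C (zip a ts).

Lemma natural_tagged (T : eqType) (cT : T -> L) ts : natural (tagged cT ts).
Proof.
split=> [S C t a|S S' C C' a SS' CC']; rewrite /tagged /hard.
  have -> : zip (map t a) ts = [seq (t p.1, p.2) | p <- zip a ts].
    by elim: a ts => [|i a IHa] [|u ts] //=; rewrite IHa.
  by rewrite all_map; apply: eq_all => p /=; rewrite all_map.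
apply: eq_in_all => p /mem_zip[pa _]; rewrite CC' //; congr andb.
by apply: eq_in_all => q /mem_zip[qa _]; rewrite SS'.
Qed.

(** Two occurrences on consecutive parts of the tuple, with no relation imposed between them: the
    event whose average is a product of two frequencies. *)
Definition twice (m : nat) (E : rel nat -> (nat -> L) -> seq nat -> bool) S C a :=
  E S C (take m a) && E S C (drop m a).

Lemma natural_twice m E : natural E -> natural (twice m E).
Proof.
move=> [mapE extE]; split=> [S C t a|S S' C C' a SS' CC'].
  by rewrite /twice -map_take -map_drop; congr (_ && _); exact: mapE.
congr (_ && _); apply: extE.
- by move=> i j /mem_take ia /mem_take ja; exact: SS'.
- by move=> i /mem_take ia; exact: CC'.
- by move=> i j /mem_drop ia /mem_drop ja; exact: SS'.
- by move=> i /mem_drop ia; exact: CC'.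
Qed.

End TaggedEvents.

Section Frequencies.
Local Open Scope ring_scope.
Local Open Scope classical_set_scope.
Variables (R : realType) (gT : finGroupType) (k : nat) (c : 'I_k.+1 -> {set gT}).
Hypothesis hc : enumerates_classes c.
Notation vperm := (virtual_perm gT).
Notation nab := (nabla R k.+1).
Notation vcol := (vcol c).

Definition freq n l r (x : borel vperm) : R := block_sum R (vsame x) (vcol x) n l r.

Lemma augm_freq (T : eqType) (cT : T -> 'I_k.+1) (mu : T -> nat) rs n (x : borel vperm) :
  uniq rs -> all (fun t => mu t != 0%N) rs ->
  augm (fun l r => freq n l r x) [seq (cT t, mu t) | t <- rs] =
  iavg (nseq (size (tags mu rs)) n)
    (fun a => (tagged cT (tags mu rs) (vsame x) (vcol x) a)%:R).
Proof.
move=> urs mrs; apply: augm_block => //.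
- exact: vsame_refl.
- exact: vsame_sym.
- exact: vsame_trans.
- exact: vsame_col.
Qed.

Definition cyc (l : 'I_k.+1) (r : nat) := tagged (fun _ : unit => l) (nseq r.+1 tt).

Lemma freqE n l r x : freq n l r.+1 x =
  iavg (nseq r.+1 n) (fun s => (cyc l r (vsame x) (vcol x) s)%:R).
Proof.
have := @augm_freq _ (fun _ : unit => l) (fun _ => r.+1) [:: tt] n x isT isT.
by rewrite /= augm_cons augm_nil /= big_nil mulr1 subr0 /tags /= cats0 size_nseq.
Qed.

Lemma freqM n n' l r x : freq n l r.+1 x * freq n' l r.+1 x =
  iavg (nseq r.+1 n ++ nseq r.+1 n')
    (fun s => (twice r.+1 (cyc l r) (vsame x) (vcol x) s)%:R).
Proof.
rewrite iavg_cat [in LHS]mulrC [X in _ * X]freqE -iavgZ; apply: eq_iavg => b bn.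
rewrite mulrC freqE -iavgZ; apply: eq_iavg => a _.
have sb : size b = r.+1.
  by move: bn; rewrite -[RHS](size_nseq r.+1 n); elim: b (nseq _ _) => [|i b IH] [|m ns] //= /andP[_ /IH ->].
by rewrite /twice take_size_cat // drop_size_cat // -natrM mulnb.
Qed.

Lemma bmeas_freq n l r : bmeas (freq n l r.+1).
Proof.
rewrite (_ : freq n l r.+1 = fun x => iavg (nseq r.+1 n)
   (fun s => (cyc l r (vsame x) (vcol x) s)%:R)); last by apply/funext => x; exact: freqE.
apply: (expect_iavg (dirac (point : borel vperm)) (E := fun s (x : borel vperm) => (cyc l r (vsame x) (vcol x) s)%:R) _ _).1 => s.
exact/bmeas_natural/natural_tagged.
Qed.

Variable P : probability (borel vperm) R.
Hypothesis cP : vcentral P.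

Lemma expect_freqM n n' m l r : (0 < m)%N -> (m <= n)%N -> (m <= n')%N ->
  `|expect P (fun x => freq n l r.+1 x * freq n' l r.+1 x) -
    expect P (fun x => (twice r.+1 (cyc l r) (vsame x) (vcol x) (iota 0 (r.+1 + r.+1)))%:R)|
  <= ((r.+1 + r.+1) ^ 2)%:R / m%:R.
Proof.
move=> m0 mn mn'; under eq_fun do rewrite freqM.
have sz : size (nseq r.+1 n ++ nseq r.+1 n') = (r.+1 + r.+1)%N.
  by rewrite size_cat !size_nseq.
rewrite -mulnn -sz; apply: (expect_iavg_natural hc cP) => //.
- by apply: natural_twice; exact: natural_tagged.
- by rewrite all_cat !all_nseq mn mn' !orbT.
- exact: iota_uniq.
- by rewrite size_iota sz.
Qed.

Definition incr j l r (x : borel vperm) := freq (4 ^ j.+1) l r.+1 x - freq (4 ^ j) l r.+1 x.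

Lemma bmeas_incr j l r : bmeas (incr j l r).
Proof. by apply: bmeasB; exact: bmeas_freq. Qed.

(** The increment has mean square O(4^-j), hence mean O(2^-j); this is why the levels are powers of
    4. *)
Lemma expect_incr j l r :
  expect P (fun x => `|incr j l r x|) <= (((r.+1 + r.+1) ^ 2)%:R * 2 + 1) * 2^-1 ^+ j.
Proof.
set B : R := ((r.+1 + r.+1) ^ 2)%:R; set h := fun n => freq n l r.+1.
have B0 : 0 <= B by exact: ler0n.
have four (i : nat) : (0 < 4 ^ i)%N by rewrite expn_gt0.
have le4 : (4 ^ j <= 4 ^ j.+1)%N by rewrite leq_exp2l.
pose q := expect P (fun x => (twice r.+1 (cyc l r) (vsame x) (vcol x) (iota 0 (r.+1 + r.+1)))%:R).
have b n n' : bmeas (fun x => h n x * h n' x) by apply: bmeasM; exact: bmeas_freq.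
(* In the expanded square the common value [q] cancels, as 1 + 1 - 2 = 0, and the errors add up to
   four times the bound of [expect_freqM]. *)
have sq : expect P (fun x => incr j l r x ^+ 2) <= 4 * (B / (4 ^ j)%:R).
  have -> : (fun x => incr j l r x ^+ 2) = (fun x => h (4 ^ j.+1)%N x * h (4 ^ j.+1)%N x
      + h (4 ^ j)%N x * h (4 ^ j)%N x - 2 * (h (4 ^ j.+1)%N x * h (4 ^ j)%N x)).
    by apply/funext => x; rewrite /incr -/(h _) -/(h (4 ^ j)%N); ring.
  rewrite expectB ?expectD ?expectZ //; last 2 first.
  - exact: bmeasD.
  - exact: bmeasZ.
  have := expect_freqM l r (four j) le4 le4.
  have := expect_freqM l r (four j) le4 (leqnn _).
  have := expect_freqM l r (four j) (leqnn _) (leqnn _).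
  rewrite -/q -/B !ler_norml -/(h (4 ^ j)%N) -/(h (4 ^ j.+1)%N).
  move: (expect P _) (expect P _) (expect P _) => e1 e2 e3 /andP[? ?] /andP[? ?] /andP[? ?].
  lra.
have e2 : 2 ^+ j * 2^-1 ^+ j = 1 :> R by rewrite -exprMn mulfV // expr1n.
have e4 : (4 ^ j)%:R^-1 = 2^-1 ^+ j * 2^-1 ^+ j :> R.
  by rewrite natrX -exprMn -exprVn; congr (_ ^+ j); rewrite -invfM; congr _^-1; ring.
set t : R := 2^-1 ^+ j in e2 e4 *; set s : R := 2 ^+ j in e2 *.
have t0 : 0 < t by rewrite exprn_gt0 // invr_gt0.
have s0 : 0 < s by rewrite exprn_gt0.
(* With [s * t = 1], the square of [s * y - 1] being nonnegative gives y <= (s y^2 + t) / 2 for y =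
   |incr|; the weights 2^j and 2^-j balance the two terms. *)
apply: (@le_trans _ _ (expect P (fun x => s / 2 * incr j l r x ^+ 2 + t / 2))).
  apply: le_expect => [||x].
  - exact/bmeas_norm/bmeas_incr.
  - apply: bmeasD; last exact: bmeas_cst.
    by apply: bmeasZ; apply: bmeasX; exact: bmeas_incr.
  - rewrite -[incr j l r x ^+ 2]real_normK ?num_real //.
    have : 0 <= (s * `|incr j l r x| - 1) ^+ 2 * t by rewrite mulr_ge0 ?sqr_ge0 ?ltW.
    move: `|_| => y; rewrite (_ : (s * y - 1) ^+ 2 * t = (s * t) * (s * y ^+ 2) - 2 * (s * t) * y + t); last by ring.
    by rewrite e2; lra.
have bi2 : bmeas (fun x => incr j l r x ^+ 2) by apply: bmeasX; exact: bmeas_incr.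
rewrite expectD; [|exact: bmeasZ|exact: bmeas_cst].
rewrite expectZ // expect_cst.
have h1 : s / 2 * expect P (fun x => incr j l r x ^+ 2) <= s / 2 * (4 * (B / (4 ^ j)%:R)).
  by apply: ler_wpM2l => //; rewrite divr_ge0 // ltW.
apply: le_trans (lerD h1 (lexx _)) _.
rewrite e4 (_ : s / 2 * (4 * (B * (t * t))) = (s * t) * (2 * B * t)); last by field.
by rewrite e2 mul1r; nra.
Qed.

End Frequencies.

(** * The pattern of a given element *)

Section Enumeration.
Variables (gT : finGroupType) (k : nat) (c : 'I_k.+1 -> {set gT}).
Hypothesis hc : enumerates_classes c.
Variables (n : nat) (w : wreath gT n).

Definition cyc_size (i : 'I_n) : nat := #|porbit (wperm w) i|.

Definition cyc_enum : seq 'I_n := flatten [seq enum (porbit (wperm w) i) | i <- reps w].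

Lemma cyc_enum_uniq : uniq cyc_enum.
Proof.
suff gen rs : uniq rs -> {subset rs <= reps w} ->
    uniq (flatten [seq enum (porbit (wperm w) i) | i <- rs]).
  by apply: gen => //; exact: reps_uniq.
elim: rs => //= i rs IHrs /andP[irs urs] sub.
rewrite cat_uniq enum_uniq IHrs // ?andbT => [|j jrs]; last by apply: sub; rewrite in_cons jrs orbT.
apply/hasPn => j /flattenP[_ /mapP[i' i'rs ->]]; rewrite !fintype.mem_enum => i'j.
apply/negP => ij; case/negP: irs; rewrite (_ : i = i') //.
apply: (reps_inj (x := w)); rewrite ?sub ?mem_head ?in_cons ?i'rs ?orbT //.
by rewrite (same_trans i' (ij : same w i j)) same_sym.
Qed.

Lemma zip_cyc_enum : zip (map val cyc_enum) (tags cyc_size (reps w)) =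
  flatten [seq [seq (val j, i) | j <- enum (porbit (wperm w) i)] | i <- reps w].
Proof.
rewrite /cyc_enum /tags; elim: (reps w) => //= i rs IHrs.
rewrite map_cat zip_cat; last by rewrite size_map size_nseq -cardE.
rewrite IHrs; congr (_ ++ _).
have -> : cyc_size i = size (map val (enum (porbit (wperm w) i))).
  by rewrite size_map -cardE.
by rewrite zip_nseq -map_comp.
Qed.

Lemma mem_zip_cyc (p : nat * 'I_n) :
  reflect (exists i, [/\ p = (val i, p.2), p.2 \in reps w & same w p.2 i])
    (p \in zip (map val cyc_enum) (tags cyc_size (reps w))).
Proof.
rewrite zip_cyc_enum; apply: (iffP flattenP) => [[_ /mapP[r rw ->] /mapP[i ir ->]]|[i [-> rw ri]]].
  by exists i; split=> //=; rewrite fintype.mem_enum in ir.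
exists [seq (val j, p.2) | j <- enum (porbit (wperm w) p.2)]; first exact: map_f.
by apply/mapP; exists i; rewrite ?fintype.mem_enum.
Qed.

(** Each point is tagged by the representative of its cycle in [w], so the pattern event says that
    the coloured partition at level n is that of [w]. *)
Lemma tagged_cyc (x : virtual_perm gT) :
  tagged (col c w) (tags cyc_size (reps w)) (vsame x) (vcol c x) (map val cyc_enum) =
  eqcp c w (vcoord n x).
Proof.
apply/hardP/eqcpP => [[H1 H2]|[H1 H2]]; last first.
  split=> [p /mem_zip_cyc[i [-> _ ri]]|p q /mem_zip_cyc[i [-> rw ri]] /mem_zip_cyc[j [-> sw sj]]] /=.
    by rewrite vcolE // -H1 (same_col hc ri).
  rewrite vsameE -H2; apply/idP/eqP => [ij|rs]; last by rewrite -(same_trans j ri) rs.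
  apply: (reps_inj (x := w)) => //.
  by rewrite (same_trans q.2 ri) (same_trans q.2 ij) same_sym.
have mem i : exists2 r, (val i, r) \in zip (map val cyc_enum) (tags cyc_size (reps w)) &
    r \in reps w /\ same w r i.
  have [r rw ir] := rep_ex w i; rewrite same_sym in ir.
  by exists r => //; apply/mem_zip_cyc; exists i.
split=> [i|i j].
  by have [r /H1 /= + [_ ri]] := mem i; rewrite vcolE // (same_col hc ri).
have [r ir [rw ri]] := mem i; have [s js [sw sj]] := mem j.
have := H2 _ _ ir js; rewrite /= vsameE => ->.
apply/idP/eqP => [ij|rs]; last by rewrite -(same_trans j ri) rs.
apply: (reps_inj (x := w)) => //.
by rewrite (same_trans s ri) (same_trans s ij) same_sym.
Qed.

Lemma size_cyc_tags : size (map val cyc_enum) = size (tags cyc_size (reps w)).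
Proof.
rewrite size_map /cyc_enum /tags; elim: (reps w) => //= i rs IHrs.
by rewrite !size_cat IHrs size_nseq -cardE.
Qed.

Lemma cyc_size_gt0 rs : all (fun i => cyc_size i != 0%N) rs.
Proof.
apply/allP => i _; rewrite -lt0n; apply/card_gt0P; exists i; exact: porbit_id.
Qed.

End Enumeration.

(** * From a central measure to a measure on [nabla] *)

Section DirectLimit.
Local Open Scope ring_scope.
Local Open Scope classical_set_scope.
Variables (R : realType) (gT : finGroupType) (k : nat) (c : 'I_k.+1 -> {set gT}).
Hypothesis hc : enumerates_classes c.
Notation vperm := (virtual_perm gT).
Notation nab := (nabla R k.+1).
Notation shape := (shape c).
Notation freq := (@freq R gT k c).
Variable P : probability (borel vperm) R.
Hypothesis cP : vcentral P.

Let u (l : 'I_k.+1) r (x : borel vperm) j : R := freq (4 ^ j) l r.+1 x.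

Definition good : set (borel vperm) :=
  [set x | forall l r, summable_set (fun j => incr R c j l r) x].

Lemma measurable_good : measurable good.
Proof.
apply: measurable_forall => l; apply: measurable_forall => r.
by apply: measurable_summable_set => j; exact: bmeas_incr.
Qed.

Lemma ae_good : {ae P, forall x, good x}.
Proof.
suff H l r : {ae P, forall x, summable_set (fun j => incr R c j l r) x}.
  apply: (@filter_forall _ _ (fun l x => forall r, summable_set (fun j => incr R c j l r) x)) => l.
  exact: ae_foralln.
apply: (@ae_summable_set _ _ _ _ _ (((r.+1 + r.+1) ^ 2)%:R * 2 + 1)).
- by rewrite addr_ge0 ?mulr_ge0.
- by move=> j; exact: bmeas_incr.
- by move=> j; exact: expect_incr.
Qed.

Lemma good_cvg x l r : good x -> cvgn (u l r x).
Proof.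
move=> /(_ l r)/summable_set_cvg.
rewrite (_ : series _ = [sequence u l r x j - u l r x 0%N]_j); last first.
  by rewrite -telescopeK.
move=> /cvg_ex[a ua]; apply/cvg_ex; exists (a + u l r x 0%N).
suff : (fun j => u l r x j - u l r x 0%N + u l r x 0%N) @ \oo --> a + u l r x 0%N.
  by under eq_fun do rewrite subrK.
apply: cvgD; [exact: ua | exact: cvg_cst].
Qed.

(** On [good] the power sums of the points [freq_point] at the levels 4^j converge, and
    [nabla_cluster] realises the limits by a point of [nabla]. The point is chosen without regard to
    measurability, which follows because its power sums are measurable. *)
Lemma frequency_limit : exists2 om : borel vperm -> borel nab,
  measurable_fun setT om &
  forall x l r, good x -> u l r x @ \oo --> pnabla (om x) l r.+1.
Proof.
have ex x : exists w : nab, good x -> forall l r, u l r x @ \oo --> pnabla w l r.+1.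
  have [gx|] := pselect (good x); last by exists point.
  have j0 j : (0 < 4 ^ j)%N by rewrite expn_gt0.
  pose v j : nab := freq_point R (vcol c x) (@vsame_refl _ x) (@vsame_sym _ x)
    (@vsame_trans _ x) (j0 j).
  have vc l r : (fun j => pnabla (v j) l r.+1) @ \oo --> limn (u l r x).
    by under eq_fun do rewrite pnabla_freq; exact: good_cvg.
  by have [w wP] := nabla_cluster vc; exists w => _ l r; rewrite wP; exact: good_cvg.
pose om x : borel nab := if x \in good then projT1 (cid (ex x)) else point.
have omP x l r : good x -> u l r x @ \oo --> pnabla (om x) l r.+1.
  by move=> gx; rewrite /om mem_set //; exact: (projT2 (cid (ex x))).
exists om => //; apply: measurable_to_nabla => l r.
pose a : R := pnabla (point : nab) l r.+1.
(* Off [good] the chosen point is constant; these functions have the right limit on both sets. *)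
apply: (@measurable_fun_cvg _ _ _ _ (fun j x => (x \in good)%:R * (u l r x j - a) + a)).
  move=> j; apply: (proj1 (_ : bmeas _)); apply: bmeasD; last exact: bmeas_cst.
  apply: bmeasM; first by apply: bmeas_indic; exact: measurable_good.
  by apply: bmeasB; [exact: bmeas_freq | exact: bmeas_cst].
move=> x _; rewrite /om; case: ifPn => [/set_mem gx|_].
  under eq_fun do rewrite mul1r subrK.
  by have := omP x l r gx; rewrite /om mem_set.
by under eq_fun do rewrite mul0r add0r; exact: cvg_cst.
Qed.

(** The proportion [f j] of tuples below 4^j showing the pattern of [w] has an expectation whose
    limit is computed twice: by dominated convergence, as it is [augm] of the empirical power sums,
    and by exchangeability. *)
Lemma expect_augm_limit (om : borel vperm -> borel nab) n (w : wreath gT n) :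
  (forall x l r, good x -> u l r x @ \oo --> pnabla (om x) l r.+1) ->
  measurable_fun setT om ->
  expect P (fun x => augm (pnabla (om x)) (shape w)) =
  expect P (fun x => (eqcp c w (vcoord n x))%:R).
Proof.
move=> omP mom; pose ts := tags (cyc_size w) (reps w).
pose E := tagged (col c w) ts.
have nE : natural E by exact: natural_tagged.
pose f j x := iavg (nseq (size ts) (4 ^ j)%N) (fun a => (E (vsame x) (vcol c x) a)%:R) : R.
have four j : (0 < 4 ^ j)%N by rewrite expn_gt0.
have fE j x : f j x = augm (fun l r => freq (4 ^ j) l r x) (shape w).
  exact/esym/(@augm_freq R gT k c hc _ (col c w) _ _ _ x (reps_uniq w) (cyc_size_gt0 w (reps w))).
have lim1 : (fun j => expect P (f j)) @ \oo --> expect P (fun x => augm (pnabla (om x)) (shape w)).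
  apply: (cvg_expect (M := 1)).
  - move=> j; apply: (expect_iavg P (E := fun s (x : borel vperm) => (E (vsame x) (vcol c x) s)%:R) _ _).1 => s.
    exact: bmeas_natural.
  - have [mA bA] := bmeas_augm R (shape_gt0 c w).
    split; first exact: (measurableT_comp mA mom).
    by have [M bM] := bA; exists M => x; exact: bM.
  - move=> j x; rewrite -[f j x]subr0; apply: iavg_dist1.
      by rewrite all_nseq; apply/orP; right; exact: four.
    by move=> a; rewrite subr0; case: (E _ _ _); rewrite ?normr1 ?normr0.
  - apply: filterS ae_good => x gx.
    (* Convergence is known in positive degrees only; [r.-1.+1] changes nothing there, and degree 0
       does not occur in [augm] of a shape. *)
    have predE (p : 'I_k.+1 -> nat -> R) :
        augm p (shape w) = augm (fun l r => p l r.-1.+1) (shape w).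
      by apply: (@eq_augm _ _ _ _ _ n); rewrite ?shape_gt0 ?sumn_shape // => l [|r].
    under eq_fun do rewrite fE predE.
    by rewrite predE; apply: cvg_augm => l r; exact: omP.
have lim2 : (fun j => expect P (f j)) @ \oo --> expect P (fun x => (eqcp c w (vcoord n x))%:R).
  pose q := expect P (fun x => (eqcp c w (vcoord n x))%:R : R).
  pose B : R := (size ts * size ts)%:R.
  have bound j : `|expect P (f j) - q| <= B / (4 ^ j)%:R.
    have qE : q = expect P (fun x => (E (vsame x) (vcol c x) (map val (cyc_enum w)))%:R).
      by congr (expect P _); apply/funext => x; rewrite /E tagged_cyc.
    rewrite qE /B -(size_nseq (size ts) (4 ^ j)%N).
    apply: (expect_iavg_natural hc cP nE) => //.
    - by rewrite all_nseq; apply/orP; right; exact: leqnn.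
    - by rewrite map_inj_uniq; [exact: cyc_enum_uniq | exact: val_inj].
    - by rewrite size_nseq size_cyc_tags.
  have z : (fun j => B / (4 ^ j)%:R) @ \oo --> (0 : R).
    have := @cvg_geometric R B 4^-1.
    rewrite ger0_norm ?invr_ge0 // invf_lt1 // ltr1n => /(_ isT).
    apply: cvg_trans; rewrite (_ : geometric _ _ = (fun j => B / (4 ^ j)%:R)) //.
    by apply/funext => j; rewrite /geometric /= exprVn natrX.
  apply/cvgrPdist_lt => e e0; move/cvgrPdist_lt : z => /(_ e e0).
  apply: filterS => j; rewrite sub0r normrN distrC; apply: le_lt_trans.
  exact: le_trans (bound j) (ler_norm _).
exact: (cvg_unique _ lim1 lim2).
Qed.

(** The representing measure is the law of the limit point. The probability of the coloured
    partition of [w] is [weight] times the mass of [w], since all elements with this partition are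
    conjugate to [w] and have equal mass by centrality. *)
Lemma direct : exists Pi : probability (borel nab) R, represented_by c (marginal P) Pi.
Proof.
have [om mom omP] := frequency_limit.
exists (push P mom); apply/(represented_byP hc) => n w _.
rewrite expect_push; last exact/bmeas_augm/shape_gt0.
rewrite (_ : _ \o om = fun x => augm (pnabla (om x)) (shape w)) // expect_augm_limit //.
have cM := wcentral_marginal (n := n) cP.
have mpre (B : set (wreath gT n)) : measurable (@vcoord gT n @^-1` B : set (borel vperm)).
  by apply: measurable_cylinder; exists n; exact: level_vcoord.
have Mw y : eqcp c w y -> P (@vcoord gT n @^-1` [set y]) = marginal P n [set w].
  move=> /(eqcp_conj hc)[v yv _]; rewrite -marginalE.
  rewrite -(cM v^-1%g [set y] (@wreath_measurable _ _ _)).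
  have {}yv : y = (w ^ v^-1)%g by rewrite conjgE invgK mulgA.
  by congr (marginal P n _); apply/seteqP; split=> z /=; rewrite yv; [move/conjg_inj | move=> ->].
have -> : expect P (fun x => (eqcp c w (vcoord n x))%:R) =
    fine (P (@vcoord gT n @^-1` [set y | eqcp c w y])).
  rewrite -(expect_indic P (mpre _)); congr (expect P _); apply/funext => x.
  by congr (nat_of_bool _)%:R; apply/idP/idP; rewrite inE.
rewrite (prob_preimage P (fun y => mpre [set y])).
rewrite (eq_bigr (fun=> marginal P n [set w])) => [|y /set_mem]; last exact: Mw.
have fw : marginal P n [set w] \is a fin_num by rewrite fin_num_measure //; exact: wreath_measurable.
rewrite -(fineK fw) sumEFin /= sumr_const.
have -> : #|[pred y | y \in [set y | eqcp c w y]]| = weight c (shape w).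
  by rewrite -card_eqcp //; apply: eq_card => y; rewrite !inE; apply/idP/idP; rewrite inE.
rewrite -(mulr_natl (fine _)) mulKf // pnatr_eq0 -lt0n; exact: weight_gt0.
Qed.

End DirectLimit.

Theorem theorem3p2 (R : realType) (gT : finGroupType) (k : nat)
    (c : 'I_k.+1 -> {set gT}) (hc : enumerates_classes c) :
  (forall P : probability (borel (virtual_perm gT)) R, vcentral P ->
     exists Pn : forall n, probability (borel (wreath gT n)) R,
       [/\ forall n, wcentral (Pn n),
           is_proj_limit P Pn
         & exists Pi : probability (borel (nabla R k.+1)) R,
             represented_by c Pn Pi /\
             forall Pi' : probability (borel (nabla R k.+1)) R,
               represented_by c Pn Pi' -> eq_on_measurable Pi' Pi]) /\
  (forall Pi : probability (borel (nabla R k.+1)) R,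
     exists P : probability (borel (virtual_perm gT)) R,
       vcentral P /\
       (exists Pn : forall n, probability (borel (wreath gT n)) R,
          [/\ forall n, wcentral (Pn n), is_proj_limit P Pn
            & represented_by c Pn Pi]) /\
       forall P' : probability (borel (virtual_perm gT)) R,
         vcentral P' ->
         (exists Pn : forall n, probability (borel (wreath gT n)) R,
            [/\ forall n, wcentral (Pn n), is_proj_limit P' Pn
              & represented_by c Pn Pi]) ->
         eq_on_measurable P' P).
Proof.
split=> [P cP|Pi].
  exists (marginal P); split=> [n||]; [exact: wcentral_marginal | exact: marginal_proj_limit |].
  have [Pi rP] := direct hc cP; exists Pi; split=> // Pi' rP'.
  by move=> A mA; exact: (represented_unique hc rP' rP mA).
have [P [wP rP]] := converse hc Pi.
exists P; split; first exact: vcentral_marginal.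
split; first by exists (marginal P); split=> //; exact: marginal_proj_limit.
move=> P' _ [Pn [_ lP' rP']].
by move=> A mA; exact: (represented_proj_unique hc lP' (@marginal_proj_limit _ _ P) rP' rP mA).
Qed.
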